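(* Let $t>0$ be fixed and $a\ge0$. Suppose $T\in S^a(\mathbb{R}^d)'$ is such that $M_tT=\phi_{ia}(te_1)T$. Then $T$ is an eigendistribution of $\Delta$ with eigenvalue $-a^2$, i.e. $\Delta T=-a^2T$.
   Context: $\Delta=-\sum_{j=1}^d\frac{\partial^2}{\partial x_j^2}$ (note the sign). $e_1=(1,0,\dots,0)\in\mathbb{R}^d$. For $a\ge0$, $S^a(\mathbb{R}^d)$ is the space of $C^\infty$ functions $f$ on $\mathbb{R}^d$ with $\gamma_{m,\alpha}(f)=\sup_{x\in\mathbb{R}^d}e^{a|x|}(1+|x|)^m|D^\alpha f(x)|<\infty$ for all integers $m\ge0$ and all multi-indices $\alpha$, with the Fréchet topology given by these seminorms ($S^0(\mathbb{R}^d)$ is the Schwartz space); $S^a(\mathbb{R}^d)'$ is its dual. For $T\in S^a(\mathbb{R}^d)'$, $\langle\Delta T,\psi\rangle=\langle T,\Delta\psi\rangle$. $d\sigma$ is the normalized surface measure on the unit sphere $S^{d-1}$; $\phi_\lambda(x)=\int_{S^{d-1}}e^{i\lambda x\cdot\omega}\,d\sigma(\omega)$ for $\lambda\in\mathbb{C}$, $x\in\mathbb{R}^d$. The spherical average is $M_tf(x)=\int_{S^{d-1}}f(x-t\omega)\,d\sigma(\omega)$, which maps $S^a(\mathbb{R}^d)$ continuously to itself; for $T\in S^a(\mathbb{R}^d)'$, $\langle M_tT,f\rangle=\langle T,M_tf\rangle$ for all $f\in S^a(\mathbb{R}^d)$.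
   Formalization: The dimension is assumed to satisfy d ≥ 2; for d = 1 the claim fails for every a ≥ 0 and t > 0, e.g. T = e^{(a+2πi/t)x} satisfies M_tT = cosh(at)T = φ_{ia}(te_1)T but ΔT = -(a+2πi/t)²T ≠ -a²T. *)

(* Defs.v *)
From HB Require Import structures.
From mathcomp Require Import all_boot all_order all_algebra.
From mathcomp Require Import all_classical all_reals all_analysis.
From mathcomp Require Import complex.
Set Implicit Arguments.
Unset Strict Implicit.
Unset Printing Implicit Defensive.
Import Order.TTheory GRing.Theory Num.Theory.
Import numFieldNormedType.Exports.

Local Open Scope classical_set_scope.
Local Open Scope ring_scope.
Local Open Scope complex_scope.

Section Euclidean.
Context {R : realType}.

Definition cmod (z : R[i]) : R :=
  Num.sqrt (complex.Re z ^+ 2 + complex.Im z ^+ 2).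

Definition cexp (z : R[i]) : R[i] :=
  (expR (complex.Re z))%:C * (cos (complex.Im z) +i* sin (complex.Im z)).

Definition dotv d (x y : 'rV[R]_d) : R := \sum_j x 0 j * y 0 j.

(* The library norm on row vectors is the sup norm; |x| is the Euclidean one. *)
Definition enorm d (x : 'rV[R]_d) : R := Num.sqrt (dotv x x).

Definition e1 d : 'rV[R]_d := \row_j (j == 0 :> nat)%:R.

End Euclidean.

Section SphericalMeans.
Context {R : realType}.

(* Integral against the normalized surface measure of the unit sphere of R^d,
   in spherical coordinates: for k >= 1, writing a point of S^k as
   (cos th, sin th * w) with th in [0, pi] and w in S^(k-1), the surface
   measure is sin^(k-1) th dth dS(w), and each step is normalized by
   \int_0^pi sin^(k-1) th dth.  S^0 = {1, -1} carries mass 1/2 at each point.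
   The value for d = 0 (empty sphere) is a dummy. *)
Fixpoint sphere_meanR (d : nat) : ('rV[R]_d -> R) -> R :=
  match d with
  | 0 => fun=> 0
  | k.+1 => match k return (('rV[R]_k -> R) -> R) -> ('rV[R]_k.+1 -> R) -> R with
    | 0 => fun _ F => (F (const_mx 1) + F (const_mx (- 1))) / 2
    | j.+1 => fun mean F =>
        (\int[lebesgue_measure]_(th in `[0, pi])
           (sin th ^+ j *
            mean (fun w => F (row_mx (cos th)%:M (sin th *: w) : 'rV_(1 + j.+1)))))
        / (\int[lebesgue_measure]_(th in `[0, pi]) (sin th ^+ j))
    end (@sphere_meanR k)
  end.

Definition sphere_mean d (F : 'rV[R]_d -> R[i]) : R[i] :=
  sphere_meanR (fun w => complex.Re (F w)) +i*
  sphere_meanR (fun w => complex.Im (F w)).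

Definition phi d (lambda : R[i]) (x : 'rV[R]_d) : R[i] :=
  sphere_mean (fun w : 'rV[R]_d => cexp ((0 +i* 1) * lambda * (dotv x w)%:C)).

Definition spherical_average d (t : R) (f : 'rV[R]_d -> R[i]) :
    'rV[R]_d -> R[i] :=
  fun x => sphere_mean (fun w : 'rV[R]_d => f (x - t *: w)).

End SphericalMeans.

Section Derivatives.
Context {R : realType} {d : nat}.
Implicit Types (f : 'rV[R]_d -> R[i]) (x : 'rV[R]_d) (i : 'I_d).

Definition ReF f : 'rV[R]_d -> R := fun x => complex.Re (f x).
Definition ImF f : 'rV[R]_d -> R := fun x => complex.Im (f x).

Definition partial i f : 'rV[R]_d -> R[i] := fun x =>
  'D_(delta_mx 0 i) (ReF f) x +i* 'D_(delta_mx 0 i) (ImF f) x.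

Definition partials (s : seq 'I_d) f : 'rV[R]_d -> R[i] := foldr partial f s.

Definition smooth f := forall s : seq 'I_d,
  [/\ continuous (ReF (partials s f)), continuous (ImF (partials s f))
    & forall i x, derivable (ReF (partials s f)) x (delta_mx 0 i) /\
                  derivable (ImF (partials s f)) x (delta_mx 0 i)].

Definition Dmulti (alpha : {ffun 'I_d -> nat}) f : 'rV[R]_d -> R[i] :=
  partials (flatten [seq nseq (alpha i) i | i <- enum 'I_d]) f.

Definition laplacian f : 'rV[R]_d -> R[i] :=
  fun x => - \sum_(i < d) partial i (partial i f) x.

End Derivatives.

Section Distributions.
Context {R : realType} {d : nat}.
Implicit Types (a t : R) (f g : 'rV[R]_d -> R[i])
  (T : ('rV[R]_d -> R[i]) -> R[i]).

Definition gamma a (m : nat) (alpha : {ffun 'I_d -> nat}) f : \bar R :=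
  ereal_sup (range (fun x : 'rV[R]_d =>
    (expR (a * enorm x) * (1 + enorm x) ^+ m * cmod (Dmulti alpha f x))%:E)).

Definition Sa a : set ('rV[R]_d -> R[i]) :=
  [set f | smooth f /\ forall m alpha, (gamma a m alpha f < +oo)%E].

(* Neighbourhoods of f in S^a for the topology given by the seminorms gamma:
   sets containing a finite intersection of seminorm balls around f. *)
Definition Sa_nbhs a f (U : set ('rV[R]_d -> R[i])) : Prop :=
  exists (s : seq (nat * {ffun 'I_d -> nat})) (delta : R), 0 < delta /\
    forall g, Sa a g ->
      (forall p, p \in s ->
         (gamma a p.1 p.2 (fun x => g x - f x)%R < delta%:E)%E) ->
      U g.

(* Elements of S^a(R^d)' are represented by functionals on all functions, of
   which only the values on S^a matter: they are linear and continuous on S^a,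
   and two of them are equal in S^a(R^d)' when they agree on S^a. *)
Definition Sa_dual a T : Prop :=
  (forall (c : R[i]) f g, Sa a f -> Sa a g ->
     T (fun x => c * f x + g x) = c * T f + T g) /\
  (forall f, Sa a f -> forall eps : R, 0 < eps ->
     Sa_nbhs a f [set g | cmod (T g - T f) < eps]).

Definition dual_eq a T1 T2 : Prop := forall f, Sa a f -> T1 f = T2 f.

Definition dual_scale (c : R[i]) T := fun f => c * T f.

Definition dual_laplacian T := fun f => T (laplacian f).

Definition dual_average t T := fun f => T (spherical_average t f).

End Distributions.

(* Main.v *)
(* Put L = Delta + a^2 and c = phi_(ia)(t e_1) = mean of exp(-a t w_1) > 0, so that
   every exponential exp(z . x) with |z| = a is an eigenfunction of A = (M_t / c)^2 with
   eigenvalue 1 and is killed by L, while T (A f) = T f.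

   Conjugating by exp(z . x) turns A into the convolution with a probability measure on
   the ball of radius 2 t, and d_j + z_j into d_j; moreover L is the sum over j of
   (z_j - d_j) (d_j + z_j).
   Integrating by parts along rotations in the (i, j) plane writes
   minor(w, v)^2 (d_j + z_j) as a multiple of a difference P - M of positive kernels;
   together with the lazy walk that steps along P, M or the rest of A, this gives
   |A^(n^3) (d_j + z_j) u| = O(1/n) in the sense of local exponential bounds, hence
   (L A^(n^3))^q f tends to 0 in the seminorms used by T as soon as q > 3 m, where m is the
   polynomial order of T: the supports have radius O(n^3), which costs n^(3 m).
   Since T ((L A^(n^3))^q f) = T (L^q f), this gives T (L^q f) = 0.

   The power q is lowered to 1 by the expansion
   M_t u = c u - psi L u + W (L^2 u), psi > 0,
   which comes from the Darboux equation through the Wronskian with phi: if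
   T (L^(q+2) f) = 0 for all f, then applying T to M_t (L^q f) gives T (L^(q+1) f) = 0. *)
Require Import Defs.
From HB Require Import structures.
From mathcomp Require Import all_boot all_order all_algebra.
From mathcomp Require Import all_classical all_reals all_analysis.
From mathcomp Require Import complex.
From mathcomp Require Import ring lra.
Set Implicit Arguments.
Unset Strict Implicit.
Unset Printing Implicit Defensive.
Import Order.TTheory GRing.Theory Num.Theory.
Import numFieldNormedType.Exports.
Local Open Scope classical_set_scope.
Local Open Scope ring_scope.

(** On the strip |Im lambda| <= a the equation phi_lambda(t e_1) = c holds only at lambda = ia and
    -ia, so T should be concentrated spectrally there and some power of L should kill it. But these
    points lie at the edge of the domain of the Fourier transform on S^a; the argument is therefore
    real-variable, an iteration of A at its top eigenvalue 1 whose gain must beat a loss depending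
    on m. The square of M_t is used because a partial derivative of the surface measure of one
    sphere is not a measure, whereas for w + v with w, v on the sphere the rotations of w and of v
    move the sum in independent directions of the (i, j) plane wherever minor(w, v) is nonzero. This
    is where d >= 2 enters: for d = 1 and a = 0 the equation cos(lambda t) = 1 has further real
    solutions. The vector z is not fixed: at each x it is chosen along x, so that exp(-z . x) is
    exactly exp(-a |x|), and all constants depend on z only through |z| = a. Measures appear as
    bounded linear functionals on continuous functions, so that all integration reduces to [0, pi]
    and [0, 1]. *)

Section Continuity.
Context {R : realType} {T : topologicalType}.
Implicit Types f g : T -> R.

Lemma cont_cst (c : R) : continuous (fun _ : T => c).
Proof. by move=> x; exact: cvg_cst. Qed.

Lemma contD f g : continuous f -> continuous g -> continuous (fun x => f x + g x).
Proof. by move=> hf hg x; apply: cvgD; [exact: hf|exact: hg]. Qed.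

Lemma contN f : continuous f -> continuous (fun x => - f x).
Proof. by move=> hf x; apply: cvgN; exact: hf. Qed.

Lemma contM f g : continuous f -> continuous g -> continuous (fun x => f x * g x).
Proof. by move=> hf hg x; apply: cvgM; [exact: hf|exact: hg]. Qed.

Lemma contX f n : continuous f -> continuous (fun x => f x ^+ n).
Proof.
move=> hf; elim: n => [|n IH]; first exact: cont_cst.
have -> : (fun x => f x ^+ n.+1) = (fun x => f x * f x ^+ n).
  by apply/funext => x; rewrite exprS.
exact: contM.
Qed.

Lemma contV f : (forall x, f x != 0) -> continuous f -> continuous (fun x => (f x)^-1).
Proof. by move=> h0 hf x; apply: cvgV; [exact: h0|exact: hf]. Qed.

Lemma cont_sum (I : Type) (r : seq I) (P : pred I) (F : I -> T -> R) :
  (forall i, continuous (F i)) -> continuous (fun x => \sum_(i <- r | P i) F i x).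
Proof.
move=> hF; elim: r => [|i r IH].
  have -> : (fun x => \sum_(i <- [::] | P i) F i x) = (fun=> 0).
    by apply/funext => x; rewrite big_nil.
  exact: cont_cst.
case: (boolP (P i)) => Pi.
  have -> : (fun x => \sum_(j <- i :: r | P j) F j x) =
            (fun x => F i x + \sum_(j <- r | P j) F j x).
    by apply/funext => x; rewrite big_cons Pi.
  exact: contD.
have -> : (fun x => \sum_(j <- i :: r | P j) F j x) =
          (fun x => \sum_(j <- r | P j) F j x).
  by apply/funext => x; rewrite big_cons (negbTE Pi).
exact: IH.
Qed.

Lemma cont_comp (U V : topologicalType) (f : T -> U) (g : U -> V) :
  continuous f -> continuous g -> continuous (fun x => g (f x)).
Proof. by move=> hf hg x; apply: continuous_comp; [exact: hf|exact: hg]. Qed.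

Lemma cont_pair (U V : topologicalType) (f : T -> U) (g : T -> V) :
  continuous f -> continuous g -> continuous (fun x => (f x, g x)).
Proof. by move=> hf hg x; apply: cvg_pair; [exact: hf|exact: hg]. Qed.

Lemma contDv (V : normedModType R) (f g : T -> V) :
  continuous f -> continuous g -> continuous (fun x => f x + g x).
Proof. by move=> hf hg x; apply: cvgD; [exact: hf|exact: hg]. Qed.

Lemma contNv (V : normedModType R) (f : T -> V) :
  continuous f -> continuous (fun x => - f x).
Proof. by move=> hf x; apply: cvgN; exact: hf. Qed.

Lemma contZv (V : normedModType R) (f : T -> R) (g : T -> V) :
  continuous f -> continuous g -> continuous (fun x => f x *: g x).
Proof. by move=> hf hg x; apply: cvgZ; [exact: hf|exact: hg]. Qed.

Lemma cont_coord m n (f : T -> 'M[R]_(m, n)) i j :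
  continuous f -> continuous (fun x => f x i j).
Proof.
move=> hf; apply: (cont_comp hf (g := fun M : 'M[R]_(m, n) => M i j)).
exact: coord_continuous.
Qed.

Lemma cont_mx m n (f : T -> 'M[R]_(m, n)) :
  (forall i j, continuous (fun x => f x i j)) -> continuous f.
Proof.
move=> hf x; apply/cvgrPdist_le => e e0.
near=> y.
rewrite /Num.Def.normr/= mx_normrE (bigmax_le _ (ltW e0))//= => i _.
rewrite !mxE/=.
move: i; near: y; apply: filter_forall => /= i.
exact: ((cvgrPdist_le _ _).1 (hf i.1 i.2 x) _ e0).
Unshelve. all: by end_near. Qed.

End Continuity.

Lemma cont_cstv (T V : topologicalType) (c : V) : continuous (fun _ : T => c).
Proof. by move=> x; exact: cvg_cst. Qed.

Lemma cont_fst (T U V : topologicalType) (f : T -> U * V) :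
  continuous f -> continuous (fun x => (f x).1).
Proof. by move=> hf; apply: (cont_comp hf) => p; exact: cvg_fst. Qed.

Lemma cont_snd (T U V : topologicalType) (f : T -> U * V) :
  continuous f -> continuous (fun x => (f x).2).
Proof. by move=> hf; apply: (cont_comp hf) => p; exact: cvg_snd. Qed.

Lemma cont_id (T : topologicalType) : continuous (fun x : T => x).
Proof. by move=> x; exact: cvg_id. Qed.

(** * Functionals carried by a compact set: continuity and differentiation in a parameter *)

Section BoundedFunctionals.
Context {R : realType} {U : topologicalType}.
Implicit Types (K : set U) (F G : U -> R) (Lam : (U -> R) -> R).

(* Stands for integration against a signed measure of mass at most C carried by K. *)
Definition bfun K (C : R) Lam : Prop :=
  (forall c F G, continuous F -> continuous G ->
     Lam (fun u => c * F u + G u) = c * Lam F + Lam G) /\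
  (forall F b, continuous F -> (forall u, K u -> `|F u| <= b) ->
     `|Lam F| <= C * b).

Variables (K : set U) (C : R) (Lam : (U -> R) -> R).
Hypothesis hL : bfun K C Lam.

Lemma bfun0 : Lam (fun _ => 0) = 0.
Proof.
have := hL.1 1 _ _ (@cont_cst R U 0) (@cont_cst R U 0).
have -> : (fun _ : U => 1 * 0 + 0 : R) = (fun=> 0).
  by apply/funext => x; rewrite mulr0 addr0.
lra.
Qed.

Lemma bfunZ c F : continuous F -> Lam (fun u => c * F u) = c * Lam F.
Proof.
move=> hF; have := hL.1 c _ _ hF (@cont_cst R U 0).
rewrite bfun0 addr0 => <-; congr Lam.
by apply/funext => x; rewrite addr0.
Qed.

Lemma bfunD F G : continuous F -> continuous G ->
  Lam (fun u => F u + G u) = Lam F + Lam G.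
Proof.
move=> hF hG; have := hL.1 1 _ _ hF hG; rewrite mul1r => <-.
by congr Lam; apply/funext => x; rewrite mul1r.
Qed.

Lemma bfunN F : continuous F -> Lam (fun u => - F u) = - Lam F.
Proof.
move=> hF; have := bfunZ (-1) hF; rewrite mulN1r => <-.
by congr Lam; apply/funext => x; rewrite mulN1r.
Qed.

Lemma bfunB F G : continuous F -> continuous G ->
  Lam (fun u => F u - G u) = Lam F - Lam G.
Proof. by move=> hF hG; rewrite bfunD//; [rewrite bfunN|exact: contN]. Qed.

Lemma bfun_sum (I : Type) (r : seq I) (P : pred I) (F : I -> U -> R) :
  (forall i, continuous (F i)) ->
  Lam (fun u => \sum_(i <- r | P i) F i u) = \sum_(i <- r | P i) Lam (F i).
Proof.
move=> hF; elim: r => [|i r IH].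
  rewrite big_nil -[RHS]bfun0; congr Lam.
  by apply/funext => x; rewrite big_nil.
rewrite big_cons -IH; case: (boolP (P i)) => Pi.
  rewrite -bfunD//; last exact: cont_sum.
  by congr Lam; apply/funext => x; rewrite big_cons Pi.
by congr Lam; apply/funext => x; rewrite big_cons (negbTE Pi).
Qed.

Lemma bfun_eq F G : continuous F -> continuous G ->
  (forall u, K u -> F u = G u) -> Lam F = Lam G.
Proof.
move=> hF hG FG; apply/eqP; rewrite -subr_eq0 -bfunB// -normr_le0.
rewrite -[leRHS](mulr0 C); apply: hL.2.
  by apply: contD => //; exact: contN.
by move=> u /FG ->; rewrite subrr normr0.
Qed.

(** Compactness of K makes [G p] tend to [G p0] uniformly on K, and the bound on [Lam] turns this
    into convergence of the values. *)
Lemma bfun_cont (P : topologicalType) (G : P -> U -> R) :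
  compact K -> continuous (fun z : P * U => G z.1 z.2) ->
  continuous (fun p => Lam (G p)).
Proof.
move=> /compact_near_coveringP cK hG p0.
have hGp p : continuous (G p).
  apply: (@cont_comp U (P * U)%type R (fun u => (p, u)) (fun z => G z.1 z.2)) => //.
  by apply: cont_pair; [move=> ?; exact: cvg_cst|exact: cont_id].
apply/cvgrPdist_le => e e0.
(* C may be zero, so the tolerance is divided by |C| + 1. *)
have C0 : 0 < `|C| + 1 by rewrite ltr_wpDl.
have b0 : 0 < e / (`|C| + 1) by rewrite divr_gt0.
have /(cK _ (nbhs p0) (fun p u => `|G p0 u - G p u| <= e / (`|C| + 1))) :
    forall u, K u -> \forall u' \near u & p \near p0,
      `|G p0 u' - G p u'| <= e / (`|C| + 1).
  move=> u _.
  have hH : continuous (fun z : U * P => G p0 z.1 - G z.2 z.1).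
    apply: contD.
      apply: (@cont_comp _ U R (fun z : U * P => z.1) (G p0)) => //.
      by apply: cont_fst; exact: cont_id.
    apply: contN.
    apply: (@cont_comp _ (P * U)%type R (fun z : U * P => (z.2, z.1)) (fun z => G z.1 z.2)) => //.
    by apply: cont_pair; [apply: cont_snd|apply: cont_fst]; exact: cont_id.
  have := hH (u, p0); move=> /cvgrPdist_le /(_ _ b0) /=.
  rewrite subrr => H.
  by apply: filterS H => -[z1 z2] /=; rewrite sub0r normrN.
rewrite /= => H.
near=> p.
rewrite -bfunB//.
apply: (@le_trans _ _ (C * (e / (`|C| + 1)))).
  apply: hL.2; first by apply: contD => //; exact: contN.
  by near: p; exact: H.
rewrite mulrA ler_pdivrMr// mulrC ler_pM2l//.
by rewrite (le_trans (ler_norm _))// lerDl.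
Unshelve. all: by end_near. Qed.

(** Differentiation under the functional: for u in K the difference quotient is a value [G' c u]
    with c between s and h + s, and compactness of K makes it close to [G' s u] uniformly in u. *)
Lemma bfun_derive (G G' : R -> U -> R) : compact K ->
  continuous (fun z : R * U => G z.1 z.2) ->
  continuous (fun z : R * U => G' z.1 z.2) ->
  (forall (s : R) u, is_derive s 1 (G ^~ u) (G' s u)) ->
  forall s : R, is_derive s 1 (fun s => Lam (G s)) (Lam (G' s)).
Proof.
move=> /compact_near_coveringP cK hG hG' dG s.
have hGp (g : R -> U -> R) p : continuous (fun z : R * U => g z.1 z.2) ->
    continuous (g p).
  move=> hg; apply: (@cont_comp U (R * U)%type R (fun u => (p, u)) (fun z => g z.1 z.2)) => //.
  by apply: cont_pair; [move=> ?; exact: cvg_cst|exact: cont_id].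
have hGs p := hGp _ p hG; have hGs' p := hGp _ p hG'.
suff H : (fun h : R => h^-1 *: (Lam (G (h *: 1 + s)) - Lam (G s))) @ 0^' --> Lam (G' s).
  apply: DeriveDef; first by apply/cvg_ex; exists (Lam (G' s)).
  exact: (cvg_lim (@Rhausdorff R) H).
apply/cvgrPdist_le => e e0.
have C0 : 0 < `|C| + 1 by rewrite ltr_wpDl.
have b0 : 0 < e / (`|C| + 1) by rewrite divr_gt0.
have /(cK _ (nbhs s) (fun p u => `|G' s u - G' p u| <= e / (`|C| + 1))) :
    forall u, K u -> \forall u' \near u & p \near s,
      `|G' s u' - G' p u'| <= e / (`|C| + 1).
  move=> u _.
  have hH : continuous (fun z : U * R => G' s z.1 - G' z.2 z.1).
    apply: contD.
      apply: (@cont_comp _ U R (fun z : U * R => z.1) (G' s)) => //.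
      by apply: cont_fst; exact: cont_id.
    apply: contN.
    apply: (@cont_comp _ (R * U)%type R (fun z : U * R => (z.2, z.1)) (fun z => G' z.1 z.2)) => //.
    by apply: cont_pair; [apply: cont_snd|apply: cont_fst]; exact: cont_id.
  have := hH (u, s); move=> /cvgrPdist_le /(_ _ b0) /=.
  rewrite subrr => H.
  by apply: filterS H => -[z1 z2] /=; rewrite sub0r normrN.
move=> /nbhs_ballP [del /= del0 H].
near=> h.
have h0 : h != 0 by near: h; exact: nbhs_dnbhs_neq.
have hd : `|h| < del by near: h; exact: dnbhs0_lt.
have -> : h^-1 *: (Lam (G (h *: 1 + s)) - Lam (G s)) =
          Lam (fun u => h^-1 * (G (h + s) u - G s u)).
  rewrite bfunZ ?bfunB//; first by rewrite /GRing.scale/= mulr1.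
  by apply: contD => //; exact: contN.
rewrite -bfunB//; last first.
  by apply: contM; [exact: cont_cst|apply: contD => //; exact: contN].
apply: (@le_trans _ _ (C * (e / (`|C| + 1)))); last first.
  rewrite mulrA ler_pdivrMr// mulrC ler_pM2l//.
  by rewrite (le_trans (ler_norm _))// lerDl.
apply: hL.2.
  apply: contD => //; apply: contN; apply: contM; first exact: cont_cst.
  by apply: contD => //; exact: contN.
move=> u Ku.
have mvt (a b : R) : a < b -> exists2 c, c \in `]a, b[ & G b u - G a u = G' c u * (b - a).
  move=> ab; apply: MVT => //; apply: continuous_subspaceT => z.
  by apply: differentiable_continuous; apply/derivable1_diffP; exact: (dG z u).(ex_derive).
suff [c cs ->] : exists2 c, `|c - s| < del & h^-1 * (G (h + s) u - G s u) = G' c u.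
  by apply: (H c) => //; rewrite /ball/= distrC.
case: (ltP 0 h) => h0'.
  have [|c] := mvt s (h + s); first by rewrite ltrDr.
  rewrite in_itv/= => /andP[c1 c2] ->; exists c.
    rewrite ger0_norm ?subr_ge0 ?ltW// (lt_le_trans _ (ltW hd))// ltrBlDr.
    by rewrite (lt_le_trans c2)// lerD2r ler_norm.
  by rewrite addrK mulrCA mulVf ?mulr1.
have hlt0 : h < 0 by rewrite lt_neqAle h0 h0'.
have [|c] := mvt (h + s) s; first by rewrite gtrDr.
rewrite in_itv/= => /andP[c1 c2] E; exists c.
  rewrite distrC ger0_norm ?subr_ge0 ?ltW// (lt_le_trans _ (ltW hd))//.
  by rewrite ltrBlDr -ltrBlDl (le_lt_trans _ c1)// addrC lerD2r ltr0_norm// opprK.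
have -> : G (h + s) u - G s u = G' c u * h by move: E; lra.
by rewrite mulrCA mulVf ?mulr1.
Unshelve. all: by end_near. Qed.

End BoundedFunctionals.

(** * Rules for directional derivatives, in pointwise form *)

Section PointwiseDerivatives.
Context {R : realType} {V : normedModType R}.
Implicit Types (f g : V -> R) (x v : V).

Lemma is_deriveDp f g x v (df dg : R) : is_derive x v f df -> is_derive x v g dg ->
  is_derive x v (fun y => f y + g y) (df + dg).
Proof. by move=> hf hg; exact: (is_deriveD hf hg). Qed.

Lemma is_deriveMp f g x v (df dg : R) : is_derive x v f df -> is_derive x v g dg ->
  is_derive x v (fun y => f y * g y) (df * g x + f x * dg).
Proof.
move=> hf hg; apply: (is_derive_eq (is_deriveM hf hg)).
by rewrite /GRing.scale/=; ring.
Qed.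

Lemma is_deriveNp f x v (df : R) : is_derive x v f df ->
  is_derive x v (fun y => - f y) (- df).
Proof. by move=> hf; exact: (is_deriveN hf). Qed.

Lemma is_deriveZp f x v (c df : R) : is_derive x v f df ->
  is_derive x v (fun y => c * f y) (c * df).
Proof. by move=> hf; exact: (is_deriveZ c hf). Qed.

Lemma is_deriveXp f x v (df : R) n : is_derive x v f df ->
  is_derive x v (fun y => f y ^+ n.+1) (n.+1%:R * f x ^+ n * df).
Proof.
move=> hf; elim: n => [|n IH].
  by rewrite expr0 mulr1 mul1r; exact: hf.
have -> : (fun y => f y ^+ n.+2) = (fun y => f y * f y ^+ n.+1).
  by apply/funext => y; rewrite exprS.
apply: (is_derive_eq (is_deriveMp hf IH)).
by rewrite !exprS -[in RHS]natr1; ring.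
Qed.

Lemma is_derive_sump (I : Type) (r : seq I) (P : pred I) (F : I -> V -> R)
    (dF : I -> R) x v :
  (forall i, is_derive x v (F i) (dF i)) ->
  is_derive x v (fun y => \sum_(i <- r | P i) F i y) (\sum_(i <- r | P i) dF i).
Proof.
move=> hF; elim: r => [|i r IH].
  rewrite big_nil (_ : (fun y => _) = cst 0); first exact: is_derive_cst.
  by apply/funext => y; rewrite big_nil.
rewrite big_cons; case: ifPn => Pi.
  rewrite (_ : (fun y => _) = (fun y => F i y + \sum_(j <- r | P j) F j y)).
    exact: is_deriveDp.
  by apply/funext => y; rewrite big_cons Pi.
rewrite (_ : (fun y => _) = (fun y => \sum_(j <- r | P j) F j y)) //.
by apply/funext => y; rewrite big_cons (negbTE Pi).
Qed.

(** Reduces a directional derivative to a derivative in one real variable, where the chain rule and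
    the mean value theorem are available. *)
Lemma is_derive_line f x v (df : R) :
  is_derive x v f df <-> is_derive (0 : R) (1 : R) (fun h : R => f (h *: v + x)) df.
Proof.
have E : (fun h : R => h^-1 *: (f (h *: v + x) - f x)) =
         (fun h : R => h^-1 *: ((fun h : R => f (h *: v + x)) (h *: (1 : R) + 0) -
                                (fun h : R => f (h *: v + x)) 0)).
  by apply/funext => h /=; rewrite addr0 scale0r add0r [_%:A]mulr1.
split=> -[h1 h2]; apply: DeriveDef.
- by move: h1; rewrite /derivable E.
- by move: h2; rewrite /derive E.
- by rewrite /derivable E.
- by rewrite /derive E.
Qed.

Lemma is_derive_comp1 (f g : R -> R) (s df dg : R) :
  is_derive s 1 f df -> is_derive (f s) 1 g dg ->
  is_derive s 1 (fun r => g (f r)) (dg * df).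
Proof.
move=> hf hg.
exact: (@is_derive1_comp R g f s dg df).
Qed.

Lemma is_derive_comp f (g : R -> R) x v (df dg : R) :
  is_derive x v f df -> is_derive (f x) 1 g dg ->
  is_derive x v (fun y => g (f y)) (dg * df).
Proof.
move=> /is_derive_line hf hg; apply/is_derive_line.
by apply: (is_derive_comp1 hf); rewrite scale0r add0r.
Qed.

End PointwiseDerivatives.

(** * Euclidean norm, balls and spheres *)

Section EuclideanNorm.
Context {R : realType} {d : nat}.
Implicit Types x y z : 'rV[R]_d.

Lemma dotvC x y : dotv x y = dotv y x.
Proof. by apply: eq_bigr => i _; rewrite mulrC. Qed.

Lemma dotvDl x y z : dotv (x + y) z = dotv x z + dotv y z.
Proof. by rewrite /dotv -big_split; apply: eq_bigr => i _; rewrite mxE mulrDl. Qed.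

Lemma dotvZl c x z : dotv (c *: x) z = c * dotv x z.
Proof. by rewrite /dotv mulr_sumr; apply: eq_bigr => i _; rewrite mxE mulrA. Qed.

Lemma dotvNl x z : dotv (- x) z = - dotv x z.
Proof. by rewrite -scaleN1r dotvZl mulN1r. Qed.

Lemma dotvDr x y z : dotv x (y + z) = dotv x y + dotv x z.
Proof. by rewrite dotvC dotvDl !(dotvC x). Qed.

Lemma dotvZr c x z : dotv x (c *: z) = c * dotv x z.
Proof. by rewrite dotvC dotvZl dotvC. Qed.

Lemma dotvNr x z : dotv x (- z) = - dotv x z.
Proof. by rewrite dotvC dotvNl dotvC. Qed.

Lemma dotv_ge0 x : 0 <= dotv x x.
Proof. by apply: sumr_ge0 => i _; rewrite -expr2 sqr_ge0. Qed.

Lemma enorm_ge0 x : 0 <= enorm x.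
Proof. exact: sqrtr_ge0. Qed.

Lemma enorm_sqr x : enorm x ^+ 2 = dotv x x.
Proof. by rewrite sqr_sqrtr// dotv_ge0. Qed.

Lemma dotv_eq0 x : dotv x x = 0 -> x = 0.
Proof.
move=> /eqP; rewrite psumr_eq0; last by move=> i _; rewrite -expr2 sqr_ge0.
move=> /allP h; apply/rowP => i; have := h i (mem_index_enum i).
by rewrite mxE -expr2 sqrf_eq0 => /eqP.
Qed.

Lemma cauchy_schwarz x y : `|dotv x y| <= enorm x * enorm y.
Proof.
rewrite -ler_sqr ?nnegrE ?mulr_ge0 ?enorm_ge0// exprMn !enorm_sqr real_normK ?num_real//.
(* The square of y . y times the component of x orthogonal to y; it expands to y . y times the
   claim. *)
have h : 0 <= dotv (dotv y y *: x - dotv x y *: y) (dotv y y *: x - dotv x y *: y).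
  exact: dotv_ge0.
have := dotv_ge0 y; rewrite le_eqVlt => /predU1P[/esym y0|y0].
  by rewrite (dotv_eq0 y0) -(scale0r 0) !dotvZr !mul0r mulr0 expr2 mul0r.
rewrite -(ler_pM2l y0).
move: h; rewrite !(dotvDl, dotvDr, dotvNl, dotvNr, dotvZl, dotvZr) (dotvC y x).
by move=> h; nra.
Qed.

Lemma enormD x y : enorm (x + y) <= enorm x + enorm y.
Proof.
rewrite -ler_sqr ?nnegrE ?addr_ge0 ?enorm_ge0// sqrrD !enorm_sqr.
rewrite dotvDl !dotvDr (dotvC y x) addrA lerD2r -addrA lerD2l -mulr2n lerMn2r.
by rewrite (le_trans (ler_norm _))//= cauchy_schwarz.
Qed.

Lemma enormZ c x : enorm (c *: x) = `|c| * enorm x.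
Proof. by rewrite /enorm dotvZl dotvZr mulrA -expr2 sqrtrM ?sqr_ge0// sqrtr_sqr. Qed.

Lemma enormN x : enorm (- x) = enorm x.
Proof. by rewrite -scaleN1r enormZ normrN1 mul1r. Qed.

Lemma enorm0 : enorm (0 : 'rV[R]_d) = 0.
Proof. by rewrite -(scale0r 0) enormZ normr0 mul0r. Qed.

Lemma coord_le_enorm x i : `|x 0 i| <= enorm x.
Proof.
rewrite -ler_sqr ?nnegrE ?enorm_ge0// enorm_sqr real_normK ?num_real//.
rewrite /dotv (bigD1 i)//= -expr2 lerDl sumr_ge0// => j _.
by rewrite -expr2 sqr_ge0.
Qed.

Lemma norm_le_enorm x : `|x| <= enorm x.
Proof.
rewrite /Num.Def.normr/= mx_normrE (bigmax_le _ (enorm_ge0 x))//= => -[i j] _ /=.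
by rewrite ord1 coord_le_enorm.
Qed.

Lemma cont_dotv (T : topologicalType) (f g : T -> 'rV[R]_d) :
  continuous f -> continuous g -> continuous (fun u => dotv (f u) (g u)).
Proof.
move=> hf hg; apply: cont_sum => i; apply: contM; exact: cont_coord.
Qed.

Lemma cont_enorm (T : topologicalType) (f : T -> 'rV[R]_d) :
  continuous f -> continuous (fun u => enorm (f u)).
Proof.
move=> hf; apply: (@cont_comp T R R (fun u => dotv (f u) (f u)) Num.sqrt).
  exact: cont_dotv.
exact: sqrt_continuous.
Qed.

Definition eball (rho : R) : set 'rV[R]_d := [set y | enorm y <= rho].

Definition esphere : set 'rV[R]_d := [set w | dotv w w = 1].

Lemma eball_bounded rho : bounded_set (eball rho).
Proof.
exists rho; split; first exact: num_real.
move=> e rhoe x /= xr; apply: le_trans (norm_le_enorm x) _.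
by apply: le_trans xr _; exact: ltW.
Qed.

Lemma eball_compact rho : compact (eball rho).
Proof.
apply: bounded_closed_compact; first exact: eball_bounded.
have -> : eball rho = (@enorm R d) @^-1` [set r | r <= rho] by [].
apply: closed_comp; last exact: closed_le.
by move=> x _; apply: cont_enorm; exact: cont_id.
Qed.

Lemma esphere_enorm w : esphere w -> enorm w = 1.
Proof. by rewrite /esphere/= /enorm => ->; rewrite sqrtr1. Qed.

Lemma esphere_compact : compact esphere.
Proof.
apply: (@subclosed_compact _ _ (eball 1)); last by move=> w /esphere_enorm; rewrite /eball/= => ->.
  have -> : esphere = (fun w => dotv w w) @^-1` [set 1] by [].
  apply: closed_comp; last exact: closed_eq.
  by move=> x _; apply: cont_dotv; exact: cont_id.
exact: eball_compact.
Qed.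

End EuclideanNorm.

(** * Integrals of continuous functions over a segment *)

Section IntervalIntegral.
Context {R : realType}.
Implicit Types (a b c : R) (f g F : R -> R).

Definition itg (a b : R) f : R := \int[lebesgue_measure]_(x in `[a, b]) f x.

Lemma cont_integrable a b f : continuous f ->
  (@lebesgue_measure R).-integrable `[a, b] (EFin \o f).
Proof.
move=> hf; apply: continuous_compact_integrable; first exact: segment_compact.
exact: continuous_subspaceT.
Qed.

Lemma itg_le a b f g : continuous f -> continuous g ->
  (forall x, a <= x <= b -> f x <= g x) -> itg a b f <= itg a b g.
Proof.
move=> hf hg fg; apply: le_Rintegral => //.
- exact: cont_integrable.
- exact: cont_integrable.
Qed.

Lemma itg_cst a b c : a <= b -> itg a b (fun=> c) = c * (b - a).
Proof.
move=> ab; rewrite /itg Rintegral_cst//= lebesgue_measure_itv/= lte_fin.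
case: ifPn => //=; rewrite -leNgt => h.
by have -> : a = b by [apply/eqP; rewrite eq_le ab h]; rewrite subrr !mulr0.
Qed.

Lemma itg_lin a b c f g : continuous f -> continuous g ->
  itg a b (fun x => c * f x + g x) = c * itg a b f + itg a b g.
Proof.
move=> hf hg; rewrite /itg RintegralD//.
- by rewrite RintegralZl//; exact: cont_integrable.
- by apply: cont_integrable; apply: contM => //; exact: cont_cst.
- exact: cont_integrable.
Qed.

Lemma bfun_itg a b : a <= b -> @bfun R R `[a, b]%classic (b - a) (itg a b).
Proof.
move=> ab; split; first by move=> c F G; exact: itg_lin.
move=> F c hF Fc; rewrite mulrC ler_norml; apply/andP; split.
  rewrite -mulNr -itg_cst//; apply: itg_le => //; first exact: cont_cst.
  by move=> x xab; have := Fc x; rewrite /= in_itv/= => /(_ xab); rewrite ler_norml => /andP[].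
rewrite -itg_cst//; apply: itg_le => //; first exact: cont_cst.
by move=> x xab; have := Fc x; rewrite /= in_itv/= => /(_ xab); rewrite ler_norml => /andP[].
Qed.

Lemma is_derive_cont F f : (forall x : R, is_derive x 1 F (f x)) -> continuous F.
Proof.
move=> dF x; apply: differentiable_continuous; apply/derivable1_diffP.
exact: (dF x).(ex_derive).
Qed.

Lemma itg_FTC a b F f : a < b -> continuous f ->
  (forall x : R, a < x < b -> is_derive x 1 F (f x)) -> continuous F ->
  itg a b f = F b - F a.
Proof.
move=> ab hf dF hF; rewrite /itg /Rintegral.
rewrite (@continuous_FTC2 R f F a b)//.
- exact: continuous_subspaceT.
- split => [x|/=|/=].
  + by rewrite in_itv/= => /dF h; exact: h.(ex_derive).
  + by apply: cvg_at_right_filter; exact: hF.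
  + by apply: cvg_at_left_filter; exact: hF.
- move=> x; rewrite in_itv/= => /dF h; rewrite derive1E; exact: derive_val.
Qed.

End IntervalIntegral.

(** * The spherical mean as a positive functional of mass 1 *)

Section SphereMean.
Context {R : realType}.

(** The same expression as in [sphere_meanR], so that [meanSS] holds by computation. *)
Definition sph k (th : R) (w : 'rV[R]_k) : 'rV[R]_k.+1 :=
  (row_mx (cos th)%:M (sin th *: w) : 'rV_(1 + k)).

Lemma sph0 k th (w : 'rV[R]_k) : sph th w 0 ord0 = cos th.
Proof.
have := row_mxEl ((cos th)%:M : 'M[R]_1) (sin th *: w) 0 ord0.
rewrite [X in _ = X]mxE eqxx mulr1n => <-.
by rewrite /sph; congr (row_mx _ _ 0 _); exact: val_inj.
Qed.

Lemma sphS k th (w : 'rV[R]_k) i : sph th w 0 (lift ord0 i) = sin th * w 0 i.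
Proof.
have := row_mxEr ((cos th)%:M : 'M[R]_1) (sin th *: w) 0 i.
rewrite [X in _ = X]mxE => <-.
by rewrite /sph; congr (row_mx _ _ 0 _); exact: val_inj.
Qed.

Lemma cont_sph (T : topologicalType) k (th : T -> R) (w : T -> 'rV[R]_k) :
  continuous th -> continuous w -> continuous (fun u => sph (th u) (w u)).
Proof.
move=> hth hw; apply: cont_mx => i j; rewrite ord1.
case: (unliftP ord0 j) => [j'|] ->.
  under eq_fun do rewrite sphS.
  apply: contM; last exact: cont_coord.
  exact: (cont_comp hth (@continuous_sin R)).
under eq_fun do rewrite sph0.
exact: (cont_comp hth (@continuous_cos R)).
Qed.

Lemma esphere_sph k th (w : 'rV[R]_k) : esphere w -> esphere (sph th w).
Proof.
rewrite /esphere/= => hw; rewrite /dotv big_ord_recl sph0.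
under eq_bigr do rewrite sphS mulrACA.
rewrite -mulr_sumr -/(dotv w w) hw mulr1 -!expr2; exact: cos2Dsin2.
Qed.

Lemma cont_sinX k : continuous (fun x : R => sin x ^+ k).
Proof. by apply: contX; exact: continuous_sin. Qed.

(** Comes from the derivative of sin^(k+1) cos, which vanishes at 0 and pi. Its purpose is the
    positivity of the normalizing integrals of the sphere. *)
Lemma wallis k : (k.+2)%:R * itg 0 pi (fun x : R => sin x ^+ k.+2) =
  (k.+1)%:R * itg 0 pi (fun x : R => sin x ^+ k).
Proof.
have E : itg 0 pi (fun x : R => - k.+2%:R * sin x ^+ k.+2 + k.+1%:R * sin x ^+ k) = 0.
  have dF (x : R) : 0 < x < pi -> is_derive x 1 (fun x => sin x ^+ k.+1 * cos x)
      (- k.+2%:R * sin x ^+ k.+2 + k.+1%:R * sin x ^+ k).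
    move=> _; apply: (is_derive_eq (is_deriveMp (is_deriveXp k (is_derive_sin x)) (is_derive_cos x))).
    have := cos2Dsin2 x; rewrite !expr2 !exprS -!natr1 => h.
    rewrite [LHS](_ : _ = (k%:R + 1) * sin x ^+ k * (cos x * cos x)
                         - sin x * (sin x ^+ k * sin x)); last by ring.
    rewrite (_ : cos x * cos x = 1 - sin x * sin x); first by ring.
    by move: h; lra.
  rewrite (itg_FTC (pi_gt0 R) _ dF).
  - by rewrite sinpi sin0 !expr0n !mul0r subrr.
  - apply: contD; apply: contM; try exact: cont_cst; exact: cont_sinX.
  - by apply: contM; [exact: cont_sinX|exact: continuous_cos].
move: E; rewrite itg_lin; last 2 first.
- exact: cont_sinX.
- by apply: contM; [exact: cont_cst|exact: cont_sinX].
have := itg_lin 0 pi k.+1%:R (@cont_sinX k) (@cont_cst R R 0).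
under [X in itg _ _ X]eq_fun do rewrite addr0.
by move=> ->; rewrite itg_cst ?pi_ge0//; lra.
Qed.

Lemma itg_sinX_gt0 k : 0 < itg 0 pi (fun x : R => sin x ^+ k).
Proof.
(* The recursion moves by two, so consecutive exponents are carried together. *)
suff : 0 < itg 0 pi (fun x : R => sin x ^+ k) /\ 0 < itg 0 pi (fun x : R => sin x ^+ k.+1).
  by case.
elim: k => [|k [IH1 IH2]].
  split.
    under [X in itg _ _ X]eq_fun do rewrite expr0.
    by rewrite itg_cst ?pi_ge0// mul1r subr0 pi_gt0.
  have dF (x : R) : 0 < x < pi -> is_derive x 1 (fun x => - cos x) (sin x ^+ 1).
    by move=> _; apply: is_derive_eq; rewrite opprK expr1.
  rewrite (itg_FTC (pi_gt0 R) _ dF).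
  - by rewrite cospi cos0; lra.
  - exact: cont_sinX.
  - by apply: contN; exact: continuous_cos.
split=> //; have := wallis k => E.
rewrite -(@pmulr_rgt0 _ k.+2%:R) ?ltr0n//.
by rewrite E mulr_gt0 ?ltr0n.
Qed.

Definition positive_functional k (Lam : ('rV[R]_k -> R) -> R) :=
  forall F : 'rV[R]_k -> R, continuous F ->
    (forall w, esphere w -> 0 <= F w) -> 0 <= Lam F.

Lemma meanSS k (F : 'rV[R]_k.+2 -> R) : sphere_meanR F =
  itg 0 pi (fun th => sin th ^+ k * sphere_meanR (fun w => F (sph th w))) /
  itg 0 pi (fun th => sin th ^+ k).
Proof. by []. Qed.

(** The induction needs all three facts at once: boundedness on the compact sphere makes the inner
    mean continuous in th, hence integrable, and boundedness itself follows from positivity and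
    total mass 1. *)
Lemma sphere_mean_props k :
  [/\ bfun esphere 1 (@sphere_meanR R k.+1),
      positive_functional (@sphere_meanR R k.+1)
    & sphere_meanR (fun _ : 'rV[R]_k.+1 => 1) = 1].
Proof.
have bounded (n : nat) (Lam : ('rV[R]_n.+1 -> R) -> R) :
    (forall c (F G : 'rV[R]_n.+1 -> R), continuous F -> continuous G ->
       Lam (fun u => c * F u + G u) = c * Lam F + Lam G) ->
    positive_functional Lam -> Lam (fun=> 1) = 1 -> bfun esphere 1 Lam.
  move=> hl hp h1; split=> // F b hF Fb; rewrite mul1r.
  have c1 : continuous (fun _ : 'rV[R]_n.+1 => 1 : R) by exact: cont_cst.
  have c0 : continuous (fun _ : 'rV[R]_n.+1 => 0 : R) by exact: cont_cst.
  have l0 : Lam (fun=> 0) = 0.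
    have := hl 1 _ _ c0 c0.
    have -> : (fun _ : 'rV[R]_n.+1 => 1 * 0 + 0 : R) = fun=> 0.
      by apply/funext => u; rewrite mulr0 addr0.
    by lra.
  have lb : Lam (fun=> b) = b.
    have := hl b _ _ c1 c0; rewrite h1 l0 mulr1 addr0; apply: etrans.
    by congr Lam; apply/funext => u; rewrite mulr1 addr0.
  have cb : continuous (fun _ : 'rV[R]_n.+1 => b : R) by exact: cont_cst.
  rewrite ler_norml; apply/andP; split.
    have := hp (fun u => 1 * F u + b); rewrite hl// lb mul1r => H.
    rewrite -subr_ge0 opprK; apply: H.
      by apply: contD => //; exact: contM.
    by move=> w /Fb; rewrite ler_norml mul1r => /andP[]; lra.
  have := hp (fun u => (-1) * F u + b); rewrite hl// lb => H.
  suff: 0 <= - 1 * Lam F + b by lra.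
  apply: H; first by apply: contD => //; apply: contM => //; exact: cont_cst.
  by move=> w /Fb; rewrite ler_norml => /andP[]; lra.
elim: k => [|k [IHb IHp IH1]].
  have hp : positive_functional (@sphere_meanR R 1).
    move=> F hF F0 /=; rewrite divr_ge0// addr_ge0//; apply: F0.
      by rewrite /esphere/= /dotv big_ord1 !mxE mulr1.
    by rewrite /esphere/= /dotv big_ord1 !mxE mulrNN mulr1.
  have h1 : sphere_meanR (fun _ : 'rV[R]_1 => 1) = 1 by rewrite /=; lra.
  split=> //; apply: bounded => // c F G _ _ /=; lra.
have cF (F : 'rV[R]_k.+2 -> R) : continuous F -> continuous (fun th : R => sphere_meanR (fun w : 'rV[R]_k.+1 => F (sph th w))).
  move=> hF; apply: (bfun_cont IHb (G := fun th w => F (sph th w))).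
    exact: esphere_compact.
  apply: (cont_comp (g := F)) => //.
  by apply: cont_sph; [apply: cont_fst|apply: cont_snd]; exact: cont_id.
have cFs (F : 'rV[R]_k.+2 -> R) : continuous F -> continuous (fun th : R => sin th ^+ k * sphere_meanR (fun w : 'rV[R]_k.+1 => F (sph th w))).
  by move=> hF; apply: contM; [exact: cont_sinX|exact: cF].
have cw (F : 'rV[R]_k.+2 -> R) th : continuous F -> continuous (fun w : 'rV[R]_k.+1 => F (sph th w)).
  move=> hF; apply: (cont_comp (g := F)) => //.
  by apply: (cont_sph (th := fun=> th) (w := id)); [exact: cont_cst|exact: cont_id].
have hl : forall c (F G : 'rV[R]_k.+2 -> R), continuous F -> continuous G ->
    sphere_meanR (fun u => c * F u + G u) = c * sphere_meanR F + sphere_meanR G.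
  move=> c F G hF hG; rewrite !meanSS mulrA -mulrDl; congr (_ / _).
  rewrite -itg_lin; [|exact: cFs|exact: cFs]; congr itg; apply/funext => th.
  by rewrite IHb.1; [ring|exact: cw|exact: cw].
have hp : positive_functional (@sphere_meanR R k.+2).
  move=> F hF F0; rewrite meanSS; apply: divr_ge0; last by rewrite ltW// itg_sinX_gt0.
  rewrite -[leLHS](@mul0r _ (pi - 0)) -itg_cst ?pi_ge0//.
  apply: itg_le; [exact: cont_cst|exact: cFs|] => th th0pi.
  rewrite mulr_ge0 ?exprn_ge0 ?sin_ge0_pi// IHp//; first exact: cw.
  by move=> w hw; apply: F0; exact: esphere_sph.
have h1 : sphere_meanR (fun _ : 'rV[R]_k.+2 => 1) = 1.
  rewrite meanSS IH1; under [X in itg _ _ X / _]eq_fun do rewrite mulr1.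
  by rewrite divff// gt_eqF// itg_sinX_gt0.
by split=> //; exact: bounded.
Qed.

End SphereMean.

Ltac cont_step :=
  match goal with
  | |- continuous id => exact: cont_id
  | H : continuous ?F |- continuous ?G => constr_eq F G; exact: H
  | |- continuous (@sin _) => exact: continuous_sin
  | |- continuous (@cos _) => exact: continuous_cos
  | |- continuous (@expR _) => exact: continuous_expR
  | |- continuous ?G =>
    match G with
    | fun _ => ?c => first [exact: cont_cst | exact: cont_cstv]
    | fun x => x => exact: cont_id
    | fun x => dotv (@?f x) (@?g x) => apply: (cont_dotv (f := f) (g := g))
    | fun x => enorm (@?f x) => apply: (cont_enorm (f := f))
    | fun x => sph (@?f x) (@?g x) => apply: (cont_sph (th := f) (w := g))
    | fun x => @GRing.add _ (@?f x) (@?g x) =>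
        first [apply: (contD (f := f) (g := g)) | apply: (contDv (f := f) (g := g))]
    | fun x => @GRing.opp _ (@?f x) =>
        first [apply: (contN (f := f)) | apply: (contNv (f := f))]
    | fun x => @GRing.mul _ (@?f x) (@?g x) => apply: (contM (f := f) (g := g))
    | fun x => @GRing.exp _ (@?f x) ?n => apply: (contX (f := f) (n := n))
    | fun x => @GRing.scale _ _ (@?f x) (@?g x) =>
        first [apply: (contZv (f := f) (g := g)) | apply: (contM (f := f) (g := g))]
    | fun x => fun_of_matrix (@?f x) ?i ?j => apply: (cont_coord (f := f))
    | fun x => (@?f x).1 => apply: (cont_fst (f := f))
    | fun x => (@?f x).2 => apply: (cont_snd (f := f))
    | fun x => (@?f x, @?g x) => apply: (cont_pair (f := f) (g := g))
    | fun x => sin (@?f x) => apply: (cont_comp (f := f)); last exact: continuous_sin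
    | fun x => cos (@?f x) => apply: (cont_comp (f := f)); last exact: continuous_cos
    | fun x => expR (@?f x) => apply: (cont_comp (f := f)); last exact: continuous_expR
    | fun x => ?F (@?f x) =>
      match goal with
      | H : continuous ?F' |- _ =>
          constr_eq F F'; apply: (cont_comp (f := f) (g := F)); last exact: H
      | H : forall i, continuous (@?K i) |- _ =>
          apply: (cont_comp (f := f) (g := F)); last exact: H
      | H : forall i j, continuous (@?K i j) |- _ =>
          apply: (cont_comp (f := f) (g := F)); last exact: H
      end
    end
  | H : forall i, continuous _ |- continuous _ => solve [apply: H]
  | H : forall i j, continuous _ |- continuous _ => solve [apply: H]
  | |- continuous _ => apply: cont_sum => ?
  end.
Ltac cont := repeat cont_step.

(** * Functions with continuous partial derivatives, and the chain rule along curves *)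

Section ChainRule.
Context {R : realType} {d : nat}.
Implicit Types (F : 'rV[R]_d -> R) (G : 'I_d -> 'rV[R]_d -> R).

(** The partial derivatives are data and only coordinate directions are required; their continuity
    is what [is_derive_curve] builds on. *)
Definition C1 F G : Prop :=
  [/\ continuous F, forall i, continuous (G i)
    & forall i (x : 'rV[R]_d), is_derive x (delta_mx 0 i : 'rV[R]_d) F (G i x)].

Lemma is_derive_shift_line F (x v : 'rV[R]_d) (h df : R) :
  is_derive (h *: v + x) v F df ->
  is_derive h (1 : R) (fun r : R => F (r *: v + x)) df.
Proof.
move=> /is_derive_line H; apply/is_derive_line.
rewrite (_ : (fun r : R => _) = (fun r : R => F (r *: v + (h *: v + x)))) //.
apply/funext => r; have -> : r *: (1 : R) + h = r + h by rewrite /GRing.scale/= mulr1.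
by rewrite scalerDl addrA.
Qed.

Lemma MVT_coord F G (x : 'rV[R]_d) i (c : R) : C1 F G ->
  exists2 xi : R, `|xi| <= `|c| &
    F (c *: delta_mx 0 i + x) - F x = c * G i (xi *: delta_mx 0 i + x).
Proof.
move=> [hF hG dF].
pose f (r : R) := F (r *: delta_mx 0 i + x).
have df (r : R) : is_derive r (1 : R) f (G i (r *: delta_mx 0 i + x)).
  exact: is_derive_shift_line.
have cf : continuous f by exact: is_derive_cont df.
have -> : F x = f 0 by rewrite /f scale0r add0r.
rewrite -/(f c); case: (leP 0 c) => c0.
  have [|xi] := MVT_segment c0 (fun r _ => df r); first exact: continuous_subspaceT.
  rewrite in_itv/= => /andP[xi0 xic] ->; exists xi; last by rewrite subr0 mulrC.
  by rewrite !ger0_norm.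
have [|xi] := MVT_segment (ltW c0) (fun r _ => df r); first exact: continuous_subspaceT.
rewrite in_itv/= => /andP[xic xi0] E; exists xi.
  by rewrite ler0_norm// ltr0_norm// lerN2.
by rewrite -[LHS]opprK opprB E sub0r mulrN opprK mulrC.
Qed.

(** One coordinate is moved at a time, with [MVT_coord] on each leg. The intermediate points are
    indexed by the coordinate, hence the condition that r has no repetition. *)
Lemma MVT_path F G (x v : 'rV[R]_d) (r : seq 'I_d) : C1 F G -> uniq r ->
  exists2 y : 'I_d -> 'rV[R]_d,
    forall i, enorm (y i - x) <= \sum_(j <- r) `|v 0 j| &
    F (\sum_(j <- r) v 0 j *: delta_mx 0 j + x) - F x =
      \sum_(j <- r) v 0 j * G j (y j).
Proof.
move=> hF; elim: r => [|i r IH] /=.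
  move=> _; exists (fun=> x); first by move=> i; rewrite subrr enorm0 big_nil.
  by rewrite !big_nil add0r subrr.
case/andP => ir /IH[y yx E].
have enorm_delta (c : R) j : enorm (c *: (delta_mx 0 j : 'rV[R]_d)) = `|c|.
  rewrite enormZ /enorm /dotv (bigD1 j)//= big1.
    by rewrite !mxE !eqxx mulr1 addr0 sqrtr1 mulr1.
  by move=> k kj; rewrite !mxE (negbTE kj) mulr0.
have sum_norm : enorm (\sum_(j <- r) v 0 j *: (delta_mx 0 j : 'rV[R]_d)) <= \sum_(j <- r) `|v 0 j|.
  elim: (r) => [|j s IHs]; first by rewrite !big_nil enorm0.
  rewrite !big_cons; apply: le_trans (enormD _ _) _.
  by rewrite enorm_delta lerD2l.
have [xi xi1 xi2] := MVT_coord (\sum_(j <- r) v 0 j *: delta_mx 0 j + x) i (v 0 i) hF.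
exists (fun j => if j == i then xi *: delta_mx 0 i + (\sum_(j <- r) v 0 j *: delta_mx 0 j + x) else y j).
  move=> j; rewrite big_cons; case: ifP => _.
    rewrite addrA addrK; apply: le_trans (enormD _ _) _.
    by rewrite enorm_delta lerD.
  by apply: le_trans (yx j) _; rewrite lerDr.
rewrite !big_cons eqxx -xi2 -addrA -[LHS](subrKA (F (\sum_(j <- r) v 0 j *: delta_mx 0 j + x))).
rewrite E; congr (_ + _).
apply: eq_big_seq => j jr; case: ifPn => // /eqP ji.
by move: ir; rewrite -ji jr.
Qed.

(** By [MVT_path] the difference quotient is the sum of the coordinate quotients times partial
    derivatives at intermediate points. These points tend to [gam s], since their distance to it is
    at most the sum of the coordinate increments. *)
Lemma is_derive_curve F G (gam : R -> 'rV[R]_d) (gam' : 'I_d -> R) (s : R) :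
  C1 F G -> (forall i, is_derive s (1 : R) (fun r : R => gam r 0 i) (gam' i)) ->
  is_derive s (1 : R) (fun r : R => F (gam r)) (\sum_i gam' i * G i (gam s)).
Proof.
move=> hF dgam; have [_ hG _] := hF.
have /choice[y hy] : forall h : R, exists y : 'I_d -> 'rV[R]_d,
    (forall i, enorm (y i - gam s) <= \sum_j `|gam (h *: 1 + s) 0 j - gam s 0 j|) /\
    F (gam (h *: 1 + s)) - F (gam s) =
      \sum_j (gam (h *: 1 + s) 0 j - gam s 0 j) * G j (y j).
  move=> h; have [y y1 y2] := MVT_path (gam s) (gam (h *: 1 + s) - gam s) hF (index_enum_uniq _).
  exists y; split.
    move=> i; apply: le_trans (y1 i) _.
    by rewrite le_eqVlt; apply/orP; left; apply/eqP; apply: eq_bigr => j _; rewrite !mxE.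
  rewrite -row_sum_delta subrK in y2; rewrite y2.
  by apply: eq_bigr => j _; rewrite !mxE.
suff H : (fun h : R => h^-1 *: (F (gam (h *: 1 + s)) - F (gam s))) @ 0^' -->
    \sum_i gam' i * G i (gam s).
  apply: DeriveDef; first by apply/cvg_ex; eexists; exact: H.
  exact: (cvg_lim (@Rhausdorff R) H).
have -> : (fun h : R => h^-1 *: (F (gam (h *: 1 + s)) - F (gam s))) =
    (fun h : R => \sum_j (h^-1 *: (gam (h *: 1 + s) 0 j - gam s 0 j)) * G j (y h j)).
  apply/funext => h; rewrite (hy h).2 scaler_sumr; apply: eq_bigr => j _.
  by rewrite /GRing.scale/= mulrA.
have q j : (fun h : R => h^-1 *: (gam (h *: 1 + s) 0 j - gam s 0 j)) @ 0^' --> gam' j.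
  have [h1 <-] := dgam j; exact: h1.
apply: cvg_big => [|j _].
  exact: add_continuous.
apply: cvgM; first exact: q.
apply: (@cvg_comp _ _ _ (fun h => y h j) (G j) _ (nbhs (gam s))); last exact: hG.
apply/cvgrPdist_lt => e e0.
have S : (fun h : R => \sum_j `|gam (h *: 1 + s) 0 j - gam s 0 j|) @ 0^' --> (0 : R).
  rewrite -[X in _ --> X](_ : \sum_(j < d) 0 = 0 :> R); last by rewrite big1.
  apply: cvg_big => [|k _].
    exact: add_continuous.
  rewrite -[X in _ --> X](@normr0 _ R); apply: cvg_norm.
  have : (fun h : R => h * (h^-1 *: (gam (h *: 1 + s) 0 k - gam s 0 k))) @ 0^' --> 0 * gam' k.
    by apply: cvgM; [exact: nbhs_dnbhs|exact: q].
  rewrite mul0r; apply: cvg_trans; apply: near_eq_cvg; near=> h.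
  rewrite /GRing.scale/= mulrA divff ?mul1r//.
  by near: h; exact: nbhs_dnbhs_neq.
move/cvgrPdist_lt : S => /(_ _ e0) S; near=> h.
rewrite distrC; apply: le_lt_trans (norm_le_enorm _) _.
apply: le_lt_trans ((hy h).1 j) _.
have : `|0 - \sum_j0 `|gam (h *: 1 + s) 0 j0 - gam s 0 j0| | < e by near: h.
by rewrite sub0r normrN; apply: le_lt_trans; exact: ler_norm.
Unshelve. all: by end_near. Qed.

End ChainRule.

(** * Rotation invariance of the spherical mean *)

Section Invariance.
Context {R : realType}.

Lemma is_derive_coord d (x v : 'rV[R]_d) i :
  is_derive x v (fun w : 'rV[R]_d => w 0 i) (v 0 i).
Proof.
apply/is_derive_line.
rewrite (_ : (fun _ => _) = (fun h : R => h * v 0 i + x 0 i)).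
  apply: (is_derive_eq (is_deriveDp (is_deriveMp (is_derive_id _ _) (is_derive_cst _ _ _)) (is_derive_cst _ _ _))).
  by rewrite mul1r mulr0 !addr0.
by apply/funext => h; rewrite !mxE.
Qed.

Lemma C1_coord d i : C1 (fun w : 'rV[R]_d => w 0 i) (fun j _ => (j == i)%:R).
Proof.
split; [by cont|by move=> j; cont|].
move=> j x; apply: is_derive_eq; first exact: is_derive_coord.
by rewrite mxE eqxx eq_sym.
Qed.

Lemma C1_mul d (F F' : 'rV[R]_d -> R) G G' : C1 F G -> C1 F' G' ->
  C1 (fun w => F w * F' w) (fun i w => G i w * F' w + F w * G' i w).
Proof.
move=> [hF hG dF] [hF' hG' dF']; split; [by cont|by move=> j; cont|].
by move=> i x; exact: is_deriveMp.
Qed.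

Lemma C1_sph k th (F : 'rV[R]_k.+1 -> R) G : C1 F G ->
  C1 (fun w => F (sph th w)) (fun j w => sin th * G (lift ord0 j) (sph th w)).
Proof.
move=> hFG; have [hF hG dF] := hFG; split; [by cont|by move=> j; cont|].
move=> j x; apply/is_derive_line.
apply: (is_derive_eq (is_derive_curve (gam := fun h => sph th (h *: delta_mx 0 j + x))
   (gam' := fun i => oapp (fun i' => sin th * (i' == j)%:R) 0 (unlift ord0 i)) hFG _)).
  move=> i; case: (unliftP ord0 i) => [i'|] ->.
    rewrite /=; under eq_fun do rewrite sphS.
    apply: is_deriveZp.
    rewrite (_ : (fun _ => _) = (fun h : R => h * (i' == j)%:R + x 0 i')).
      apply: (is_derive_eq (is_deriveDp (is_deriveMp (is_derive_id _ _) (is_derive_cst _ _ _)) (is_derive_cst _ _ _))).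
      by rewrite mul1r mulr0 !addr0.
    by apply/funext => h; rewrite !mxE eqxx.
  rewrite /=; under eq_fun do rewrite sph0.
  exact: is_derive_cst.
rewrite big_ord_recl unlift_none mul0r add0r (bigD1 j)//= big1 ?addr0.
  by rewrite liftK /= eqxx mulr1 scale0r add0r.
by move=> i ij; rewrite liftK /= (negbTE ij) mulr0 mul0r.
Qed.

(** Infinitesimal rotation invariance: w_i d_j - w_j d_i generates the rotations of the (i, j)
    plane. *)
Definition skew_invariant k := forall (F : 'rV[R]_k.+1 -> R) G i j, C1 F G ->
  sphere_meanR (fun w => w 0 i * G j w - w 0 j * G i w) = 0.

(** Skew invariance for w_i F, summed over i. On the sphere w . w = 1 leaves the tangential part of
    the gradient; the factor k counts k + 1 terms w_j F minus the one from i = j. *)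
Lemma sphere_divergence k : skew_invariant k -> forall (F : 'rV[R]_k.+1 -> R) G j, C1 F G ->
  sphere_meanR (fun w => G j w - w 0 j * \sum_i w 0 i * G i w) =
  k%:R * sphere_meanR (fun w => w 0 j * F w).
Proof.
move=> hs F G j hFG; have [hF hG dF] := hFG.
have [hm _ _] := @sphere_mean_props R k.
have E i := hs _ _ i j (C1_mul (C1_coord i) hFG).
have : \sum_(i < k.+1) sphere_meanR (fun w => w 0 i * ((j == i)%:R * F w + w 0 i * G j w)
   - w 0 j * ((i == i)%:R * F w + w 0 i * G i w)) = 0 by rewrite big1.
rewrite -(bfun_sum hm); last by move=> i; cont.
move=> {}E; apply/eqP; rewrite -subr_eq0 -(bfunZ hm); last by cont.
rewrite -(bfunB hm); [|by cont|by cont].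
apply/eqP; apply: etrans E; apply: (bfun_eq hm); [by cont|by cont|].
move=> w hw.
rewrite big_split/= sumrN.
have -> : \sum_(i < k.+1) w 0 i * ((j == i)%:R * F w + w 0 i * G j w) = w 0 j * F w + G j w.
  under eq_bigr do rewrite mulrDr [X in _ + X]mulrA.
  rewrite big_split/= -mulr_suml -/(dotv w w) hw mul1r; congr (_ + _).
  rewrite (bigD1 j)//= eqxx mul1r big1 ?addr0// => i ij.
  by rewrite eq_sym (negbTE ij) mul0r mulr0.
have -> : \sum_(i < k.+1) w 0 j * ((i == i)%:R * F w + w 0 i * G i w) =
    k.+1%:R * (w 0 j * F w) + w 0 j * \sum_i w 0 i * G i w.
  under eq_bigr do rewrite eqxx mul1r mulrDr.
  by rewrite big_split/= sumr_const card_ord -mulr_sumr mulr_natl.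
by rewrite -natr1; ring.
Qed.

Lemma mean_derive_sph k (F : 'rV[R]_k.+2 -> R) G (p : 'rV[R]_k.+1 -> R) : C1 F G ->
  continuous p -> forall th : R,
  is_derive th (1 : R) (fun th => sphere_meanR (fun w => p w * F (sph th w)))
    (sphere_meanR (fun w => p w * (cos th * \sum_i w 0 i * G (lift ord0 i) (sph th w)
                                   - sin th * G ord0 (sph th w)))).
Proof.
move=> hFG hp; have [hF hG dF] := hFG; have [hm _ _] := @sphere_mean_props R k.
apply: (bfun_derive hm (G := fun th w => p w * F (sph th w))
  (G' := fun th w => p w * (cos th * \sum_i w 0 i * G (lift ord0 i) (sph th w)
                                   - sin th * G ord0 (sph th w)))).
- exact: esphere_compact.
- by cont.
- by cont.
move=> th w; apply: is_deriveZp.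
apply: (is_derive_eq (is_derive_curve (gam := fun r => sph r w)
   (gam' := fun i => oapp (fun i' => cos th * w 0 i') (- sin th) (unlift ord0 i)) hFG _)).
  move=> i; case: (unliftP ord0 i) => [i'|] ->.
    rewrite /=; under eq_fun do rewrite sphS.
    apply: (is_derive_eq (is_deriveMp (is_derive_sin th) (is_derive_cst _ _ _))).
    by rewrite mulr0 addr0.
  by rewrite /=; under eq_fun do rewrite sph0; exact: is_derive_cos.
rewrite big_ord_recl unlift_none /= mulNr addrC; congr (_ - _).
by rewrite mulr_sumr; apply: eq_bigr => i _; rewrite liftK /= mulrA.
Qed.

(** Induction on the dimension. A rotation fixing the polar axis acts inside each slice of constant
    th. For a rotation that moves the axis, the integrand is the th-derivative of [Phi]: on each
    slice, [sphere_divergence] from the induction hypothesis converts the tangential derivative.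
    Finally [Phi] vanishes at both poles. *)
Theorem sphere_skew_invariant k : skew_invariant k.
Proof.
elim: k => [|k IH] F G i j hFG; have [hF hG dF] := hFG.
  have [hm _ _] := @sphere_mean_props R 0.
  rewrite (ord1 i) (ord1 j) -[RHS](bfun0 hm); congr sphere_meanR.
  by apply/funext => w; rewrite subrr.
have [hm _ _] := @sphere_mean_props R k; have [hm2 _ _] := @sphere_mean_props R k.+1.
have cGs j' th : continuous (fun w : 'rV[R]_k.+1 => G j' (sph th w)) by cont.
have zero0 (j' : 'I_k.+1) :
    sphere_meanR (fun w => w 0 ord0 * G (lift ord0 j') w - w 0 (lift ord0 j') * G ord0 w) = 0.
  rewrite meanSS.
  pose Phi (th : R) := sin th ^+ k * sphere_meanR (fun w => w 0 j' * F (sph th w)).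
  pose A th := sphere_meanR (fun w : 'rV[R]_k.+1 => G (lift ord0 j') (sph th w)).
  pose B th := sphere_meanR (fun w : 'rV[R]_k.+1 => w 0 j' * \sum_i w 0 i * G (lift ord0 i) (sph th w)).
  pose C th := sphere_meanR (fun w : 'rV[R]_k.+1 => w 0 j' * G ord0 (sph th w)).
  have int th : sphere_meanR (fun w : 'rV[R]_k.+1 => sph th w 0 ord0 * G (lift ord0 j') (sph th w)
       - sph th w 0 (lift ord0 j') * G ord0 (sph th w)) = cos th * A th - sin th * C th.
    rewrite -(bfunZ hm); last by cont.
    rewrite -(bfunZ hm); last by cont.
    rewrite -(bfunB hm); [|by cont|by cont].
    by congr sphere_meanR; apply/funext => w; rewrite sph0 sphS mulrA.
  have div th : sin th * (A th - B th) =
      k%:R * sphere_meanR (fun w : 'rV[R]_k.+1 => w 0 j' * F (sph th w)).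
    rewrite -(sphere_divergence IH j' (C1_sph th hFG)).
    rewrite -(bfunB hm); [|by cont|by cont].
    rewrite -(bfunZ hm); last by cont.
    congr sphere_meanR; apply/funext => w; rewrite mulrBr; congr (_ - _).
    rewrite mulrCA; congr (_ * _); rewrite mulr_sumr; apply: eq_bigr => l _.
    by rewrite mulrCA.
  (* The relation [div] carries a factor sin th, which sin^k absorbs only for k > 0. For k = 0 the
     slice is S^0, where w^2 = 1 gives the equality directly. *)
  have div0 th : k = 0%N -> A th = B th.
    move=> k0; apply: (bfun_eq hm); [by cont|by cont|].
    subst k => w; rewrite /esphere/= /dotv !big_ord1 !(ord1 j') => ww.
    by rewrite mulrA ww mul1r.
  have dM th : is_derive th (1 : R) (fun th => sphere_meanR (fun w : 'rV[R]_k.+1 => w 0 j' * F (sph th w)))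
      (cos th * B th - sin th * C th).
    apply: (is_derive_eq (@mean_derive_sph k F G (fun w => w 0 j') hFG _ th)); first by cont.
    rewrite -(bfunZ hm); last by cont.
    rewrite -(bfunZ hm); last by cont.
    rewrite -(bfunB hm); [|by cont|by cont].
    by congr sphere_meanR; apply/funext => w; ring.
  have dPhi th : is_derive th (1 : R) Phi (sin th ^+ k * (cos th * A th - sin th * C th)).
    rewrite /Phi; case: (posnP k) => [k0|k0].
      have X1 (x : R) : x ^+ k = 1 by rewrite k0.
      rewrite div0// X1 mul1r.
      by under eq_fun do rewrite X1 mul1r; exact: dM.
    have Xk (x : R) : x ^+ k = x ^+ k.-1.+1 by rewrite prednK.
    under eq_fun do rewrite Xk.
    apply: (is_derive_eq (is_deriveMp (is_deriveXp k.-1 (is_derive_sin th)) (dM th))).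
    rewrite prednK// [LHS](_ : _ = sin th ^+ k.-1 * cos th *
      (k%:R * sphere_meanR (fun w => w 0 j' * F (sph th w))) +
      sin th ^+ k * (cos th * B th - sin th * C th)); last by ring.
    by rewrite -div !Xk !exprS; ring.
  have cA : continuous A by apply: (bfun_cont hm (G := fun th w => G (lift ord0 j') (sph th w)));
    [exact: esphere_compact|cont].
  have cC : continuous C by apply: (bfun_cont hm (G := fun th w => w 0 j' * G ord0 (sph th w)));
    [exact: esphere_compact|cont].
  have -> : itg 0 pi (fun th => sin th ^+ k * sphere_meanR (fun w => sph th w 0 ord0 * G (lift ord0 j') (sph th w)
       - sph th w 0 (lift ord0 j') * G ord0 (sph th w))) = Phi pi - Phi 0.
    rewrite -(itg_FTC (pi_gt0 R) _ (fun th _ => dPhi th)).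
    - by congr itg; apply/funext => th; rewrite int.
    - by cont.
    - exact: is_derive_cont dPhi.
  suff Phi0 th : sin th = 0 -> Phi th = 0 by rewrite !Phi0 ?sin0 ?sinpi// subrr mul0r.
  rewrite /Phi => th0; case: (posnP k) => [k0|k0]; last by rewrite th0 expr0n gtn_eqF// mul0r.
  (* For k = 0 the weight sin^k is 1; at a pole the two points of S^0 give the same point of the
     circle, with opposite factors w. *)
  subst k; rewrite expr0 mul1r /= (ord1 j') !mxE.
  have -> : sph th (const_mx (- 1)) = sph th (const_mx 1 : 'rV[R]_1).
    by apply/rowP => l; case: (unliftP ord0 l) => [l'|] ->; rewrite ?sph0// !sphS th0 !mul0r.
  by rewrite mulN1r mul1r subrr mul0r.
case: (unliftP ord0 i) => [i'|] ->; case: (unliftP ord0 j) => [j'|] ->.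
- rewrite meanSS (_ : (fun th => _) = fun=> 0) ?itg_cst ?pi_ge0 ?mul0r//.
  apply/funext => th; rewrite -[RHS](mulr0 (sin th ^+ k)); congr (_ * _).
  rewrite -[RHS](IH _ _ i' j' (C1_sph th hFG)); congr sphere_meanR.
  by apply/funext => w; rewrite !sphS; ring.
- rewrite -[RHS]oppr0 -(zero0 i') -(bfunN hm2); last by cont.
  by congr sphere_meanR; apply/funext => w; rewrite opprB.
- exact: zero0.
- rewrite -[RHS](bfun0 hm2); congr sphere_meanR.
  by apply/funext => w; rewrite subrr.
Qed.

End Invariance.

(** * Spherical means as functions of the radius, and the Darboux equation *)

Section Darboux.
Context {R : realType} (k : nat) (a : R).
Notation V := 'rV[R]_k.+2.
Notation mean := (@sphere_meanR R k.+2).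
Implicit Types (g : V -> R) (x w : V) (s : R).

Definition C2 g (G1 : 'I_k.+2 -> V -> R) (G2 : 'I_k.+2 -> 'I_k.+2 -> V -> R) :=
  C1 g G1 /\ forall i, C1 (G1 i) (G2 i).

Definition smean g x s : R := mean (fun w => g (x - s *: w)).

Lemma bfun_mean : bfun esphere 1 mean.
Proof. by have [] := @sphere_mean_props R k.+1. Qed.

Lemma cont_smean g x : continuous g -> continuous (smean g x).
Proof.
move=> hg; apply: (bfun_cont bfun_mean (G := fun s w => g (x - s *: w))).
  exact: esphere_compact.
by cont.
Qed.

Lemma smean_derive g G (p : V -> R) x : C1 g G -> continuous p -> forall s : R,
  is_derive s (1 : R) (fun s => mean (fun w => p w * g (x - s *: w)))
    (mean (fun w => p w * - (\sum_i w 0 i * G i (x - s *: w)))).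
Proof.
move=> hgG hp; have [hg hG dg] := hgG.
apply: (bfun_derive bfun_mean (G := fun s w => p w * g (x - s *: w))
  (G' := fun s w => p w * - (\sum_i w 0 i * G i (x - s *: w)))).
- exact: esphere_compact.
- by cont.
- by cont.
move=> s w; apply: is_deriveZp.
apply: (is_derive_eq (is_derive_curve (gam := fun r => x - r *: w)
  (gam' := fun i => - w 0 i) hgG _)).
  move=> i; rewrite (_ : (fun _ => _) = (fun r : R => x 0 i + r * (- w 0 i))).
    apply: (is_derive_eq (is_deriveDp (is_derive_cst _ _ _) (is_deriveMp (is_derive_id _ _) (is_derive_cst _ _ _)))).
    by rewrite mul1r mulr0 addr0 add0r.
  by apply/funext => r; rewrite !mxE mulrN.
by rewrite -sumrN; apply: eq_bigr => i _; rewrite mulNr.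
Qed.

Definition smean1 (G1 : 'I_k.+2 -> V -> R) x s :=
  - \sum_i mean (fun w => w 0 i * G1 i (x - s *: w)).

Definition smean2 (G2 : 'I_k.+2 -> 'I_k.+2 -> V -> R) x s :=
  \sum_i mean (fun w => w 0 i * \sum_j w 0 j * G2 i j (x - s *: w)).

Lemma smean_derive1 g G1 x s : C1 g G1 ->
  is_derive s (1 : R) (smean g x) (smean1 G1 x s).
Proof.
move=> hg; have [hg0 hG dg] := hg.
rewrite (_ : smean g x = fun s => mean (fun w => 1 * g (x - s *: w))); last first.
  by apply/funext => r; congr mean; apply/funext => w; rewrite mul1r.
apply: (is_derive_eq (smean_derive x hg (p := fun=> 1) _ s)); first by cont.
rewrite /smean1 -(bfun_sum bfun_mean); last by move=> i; cont.
rewrite -(bfunN bfun_mean); last by cont.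
by congr mean; apply/funext => w; rewrite mul1r.
Qed.

Lemma smean_derive2 g G1 G2 x s : C2 g G1 G2 ->
  is_derive s (1 : R) (smean1 G1 x) (smean2 G2 x s).
Proof.
move=> [hg hG]; rewrite -[smean2 _ _ _]opprK; apply: is_deriveNp.
rewrite /smean2 -sumrN; apply: is_derive_sump => i; have [hG1 hG2 _] := hG i.
apply: (is_derive_eq (smean_derive x (hG i) (p := fun w => w 0 i) _ s)); first by cont.
rewrite -(bfunN bfun_mean); last by cont.
by congr mean; apply/funext => w; rewrite mulrN.
Qed.

(** The Euler-Poisson-Darboux equation in dimension k + 2, multiplied by s so as to include s = 0.
    It is [sphere_divergence] for the functions w -> G1_i(x - s w), summed over i. *)
Lemma darboux g G1 G2 x s : C2 g G1 G2 ->
  s * smean (fun y => \sum_i G2 i i y) x s = s * smean2 G2 x s + k.+1%:R * smean1 G1 x s.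
Proof.
move=> [hg hG].
have div i : s * mean (fun w => G2 i i (x - s *: w)) =
   s * mean (fun w => w 0 i * \sum_j w 0 j * G2 i j (x - s *: w))
   - k.+1%:R * mean (fun w => w 0 i * G1 i (x - s *: w)).
  have [hG1 hG2 dG] := hG i.
  have H : C1 (fun w => G1 i (x - s *: w)) (fun j w => - (s * G2 i j (x - s *: w))).
    split; [by cont|by move=> j; cont|].
    move=> j w; apply/is_derive_line.
    apply: (is_derive_eq (is_derive_curve (gam := fun h => x - s *: (h *: delta_mx 0 j + w))
      (gam' := fun l => - (s * (l == j)%:R)) (hG i) _)).
      move=> l; rewrite (_ : (fun _ => _) = (fun r : R => (x 0 l - s * w 0 l) + r * (- (s * (l == j)%:R)))).
        apply: (is_derive_eq (is_deriveDp (is_derive_cst _ _ _) (is_deriveMp (is_derive_id _ _) (is_derive_cst _ _ _)))).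
        by rewrite mul1r mulr0 addr0 add0r.
      by apply/funext => r; rewrite !mxE eqxx; ring.
    rewrite (bigD1 j)//= eqxx mulr1 scale0r add0r big1 ?addr0 ?mulNr//.
    by move=> l /negbTE ->; rewrite mulr0 oppr0 mul0r.
  rewrite -(sphere_divergence (@sphere_skew_invariant R k.+1) i H).
  rewrite -!(bfunZ bfun_mean) -?(bfunB bfun_mean); try by cont.
  congr mean; apply/funext => w.
  under [X in _ = _ - (_ - _ * X)]eq_bigr do rewrite mulrN mulrCA.
  by rewrite sumrN -mulr_sumr; ring.
rewrite /smean (bfun_sum bfun_mean); last first.
  by move=> i; have [_ hG2 _] := hG i; cont.
rewrite mulr_sumr (eq_bigr _ (fun i _ => div i)) big_split/= sumrN -!mulr_sumr.
by rewrite /smean1 mulrN.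
Qed.

Definition expz (z : V) : V -> R := fun x => expR (dotv z x).

Lemma C1_expz z c : C1 (fun x => c * expz z x) (fun i x => c * z 0 i * expz z x).
Proof.
split; [by rewrite /expz; cont|by move=> i; rewrite /expz; cont|].
move=> i x; rewrite -mulrA; apply: is_deriveZp; rewrite mulrC.
have dz : is_derive x (delta_mx 0 i : V) (dotv z) (z 0 i).
  rewrite [X in is_derive _ _ _ X](_ : _ = \sum_j z 0 j * (j == i)%:R).
    apply: (is_derive_sump _ _ (F := fun j (x : V) => z 0 j * x 0 j)) => j.
    apply: is_deriveZp; apply: (is_derive_eq (is_derive_coord _ _ _)).
    by rewrite mxE eqxx.
  rewrite (bigD1 i)//= eqxx mulr1 big1 ?addr0// => j /negbTE ->.
  by rewrite mulr0.
exact: (is_derive_comp dz (is_derive_expR _)).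
Qed.

Lemma C2_expz z : C2 (expz z) (fun i x => z 0 i * expz z x)
  (fun i j x => z 0 i * z 0 j * expz z x).
Proof.
split; last by move=> i; exact: C1_expz.
rewrite (_ : expz z = fun x => 1 * expz z x); last by apply/funext => x; rewrite mul1r.
rewrite (_ : (fun i x => _) = fun i x => 1 * z 0 i * (expz z x)) ; first exact: C1_expz.
by apply/funext => i; apply/funext => x; rewrite !mul1r.
Qed.

Definition lapC (G2 : 'I_k.+2 -> 'I_k.+2 -> V -> R) g : V -> R :=
  fun x => - \sum_i G2 i i x + a ^+ 2 * g x.

Lemma C2_cont2 g G1 G2 : C2 g G1 G2 -> forall i j, continuous (G2 i j).
Proof. by move=> [_ hG] i; case: (hG i). Qed.

Lemma cont_lapC g G1 G2 : C2 g G1 G2 -> continuous (lapC G2 g).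
Proof.
by move=> hC; have hG2 := C2_cont2 hC; have [[hg _ _] _] := hC; rewrite /lapC; cont.
Qed.

Lemma smean_lapC g G1 G2 x s : C2 g G1 G2 ->
  smean (fun y => \sum_i G2 i i y) x s = a ^+ 2 * smean g x s - smean (lapC G2 g) x s.
Proof.
move=> hC; have [[hg _ _] _] := hC; have hL := cont_lapC hC; have hG2 := C2_cont2 hC.
rewrite /smean -(bfunZ bfun_mean); last by cont.
rewrite -(bfunB bfun_mean); [|by cont|by cont].
by congr mean; apply/funext => w; rewrite /lapC; ring.
Qed.

Lemma lapC_expz z : dotv z z = a ^+ 2 ->
  lapC (fun i j x => z 0 i * z 0 j * expz z x) (expz z) = fun=> 0.
Proof.
move=> zz; apply/funext => x; rewrite /lapC -mulr_suml -/(dotv z z) zz.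
by rewrite addrC subrr.
Qed.

(* Locked, like rpart and pairB below: conversion would otherwise unfold the iterated
   integrals defining sphere_meanR. *)
Fact phiR_key : unit. Proof. exact: tt. Qed.

Definition phiR : R -> R := locked_with phiR_key (smean (expz (a *: e1 k.+2)) 0).

Lemma phiRE : phiR = smean (expz (a *: e1 k.+2)) 0.
Proof. by rewrite /phiR unlock. Qed.

Lemma dotv_ae1 : dotv (a *: e1 k.+2) (a *: e1 k.+2) = a ^+ 2 :> R.
Proof.
rewrite dotvZl dotvZr mulrA -expr2 /dotv big_ord_recl big1.
  by rewrite !mxE /= mulr1 addr0 mulr1.
by move=> i _; rewrite !mxE /= mul0r.
Qed.

End Darboux.

(** * Expansion of the spherical mean in powers of L *)

Section Expansion.
Context {R : realType} (k : nat) (a : R).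
Hypothesis a0 : 0 <= a.
Notation V := 'rV[R]_k.+2.
Notation mean := (@sphere_meanR R k.+2).
Notation phi_ := (phiR k a).
Implicit Types (g : V -> R) (x w : V) (s : R) (h : R -> R).

Lemma mean_ge (F G : V -> R) : continuous F -> continuous G ->
  (forall w, esphere w -> F w <= G w) -> mean F <= mean G.
Proof.
move=> hF hG FG; have [hm hp _] := @sphere_mean_props R k.+1.
rewrite -subr_ge0 -(bfunB hm)//; apply: hp; first by cont.
by move=> w /FG; rewrite subr_ge0.
Qed.

Lemma mean_cst c : mean (fun=> c) = c.
Proof.
have [hm _ h1] := @sphere_mean_props R k.+1.
have := bfunZ hm c (@cont_cst R V 1); rewrite h1 mulr1; apply: etrans.
by congr mean; apply/funext => w; rewrite mulr1.
Qed.

Lemma cont_phiR : continuous phi_.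
Proof. by rewrite phiRE; apply: cont_smean; rewrite /expz; cont. Qed.

Lemma expz_bounds z s w : dotv z z = a ^+ 2 -> esphere w ->
  expR (- (a * `|s|)) <= expz z (s *: w) <= expR (a * `|s|).
Proof.
move=> zz ww; rewrite /expz !ler_expR -ler_norml dotvZr normrM mulrC.
apply: ler_pM => //; have := cauchy_schwarz z w.
by rewrite (esphere_enorm ww) mulr1 /enorm zz sqrtr_sqr (ger0_norm a0).
Qed.

Lemma phiR_bounds s : expR (- (a * `|s|)) <= phi_ s <= expR (a * `|s|).
Proof.
rewrite phiRE /smean; apply/andP; split.
  rewrite -[leLHS]mean_cst; apply: mean_ge; try by rewrite /expz; cont.
  move=> w ww; rewrite (_ : 0 - s *: w = (- s) *: w) -?(normrN s); last by rewrite sub0r scaleNr.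
  by case/andP: (expz_bounds (- s) (dotv_ae1 k a) ww).
rewrite -[leRHS]mean_cst; apply: mean_ge; try by rewrite /expz; cont.
move=> w ww; rewrite (_ : 0 - s *: w = (- s) *: w) -?(normrN s); last by rewrite sub0r scaleNr.
by case/andP: (expz_bounds (- s) (dotv_ae1 k a) ww).
Qed.

Lemma phiR_gt0 s : 0 < phi_ s.
Proof. by case/andP: (phiR_bounds s) => h _; apply: lt_le_trans h; exact: expR_gt0. Qed.

(* Solving (s^(k+1) Wr)' = - s^(k+1) phi h and then (u / phi)' = Wr / phi^2, with both
   integrals over [0, s] rescaled to [0, 1] so that they make sense at s = 0. *)
Definition Nop h s := s * itg 0 1 (fun r => r ^+ k.+1 * (phi_ (r * s) * h (r * s))).

Definition Kop h s := phi_ s * (s * itg 0 1 (fun r => Nop h (r * s) / phi_ (r * s) ^+ 2)).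

Lemma cont_Nop h : continuous h -> continuous (Nop h).
Proof.
move=> hh; have hp := cont_phiR; apply: contM; first by cont.
apply: (bfun_cont (bfun_itg (@ler01 R)) (G := fun s r => r ^+ k.+1 * (phi_ (r * s) * h (r * s)))).
  exact: segment_compact.
by cont.
Qed.

Lemma contVphi (T : topologicalType) (f : T -> R) : continuous f ->
  continuous (fun u => (phi_ (f u) ^+ 2)^-1).
Proof.
move=> hf; have hp := cont_phiR; apply: contV; last by cont.
by move=> u; rewrite sqrf_eq0 gt_eqF// phiR_gt0.
Qed.

Lemma cont_Kop h : continuous h -> continuous (Kop h).
Proof.
move=> hh; have hp := cont_phiR; have hN := cont_Nop hh.
apply: contM; first by cont.
apply: contM; first by cont.
apply: (bfun_cont (bfun_itg (@ler01 R)) (G := fun s r => Nop h (r * s) / phi_ (r * s) ^+ 2)).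
  exact: segment_compact.
by apply: contM; [cont|apply: contVphi; cont].
Qed.

Lemma Nop_lin c h h' s : continuous h -> continuous h' ->
  Nop (fun r => c * h r + h' r) s = c * Nop h s + Nop h' s.
Proof.
move=> hh hh'; have hp := cont_phiR.
rewrite /Nop; have -> : itg 0 1 (fun r => r ^+ k.+1 * (phi_ (r * s) * (c * h (r * s) + h' (r * s)))) =
    c * itg 0 1 (fun r => r ^+ k.+1 * (phi_ (r * s) * h (r * s))) +
    itg 0 1 (fun r => r ^+ k.+1 * (phi_ (r * s) * h' (r * s))).
  rewrite -itg_lin; [|by cont|by cont].
  by congr itg; apply/funext => r; ring.
by rewrite mulrDr mulrCA.
Qed.

Lemma Kop_lin c h h' s : continuous h -> continuous h' ->
  Kop (fun r => c * h r + h' r) s = c * Kop h s + Kop h' s.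
Proof.
move=> hh hh'; have hN := cont_Nop hh; have hN' := cont_Nop hh'.
rewrite /Kop; have -> : itg 0 1 (fun r => Nop (fun r => c * h r + h' r) (r * s) / phi_ (r * s) ^+ 2) =
    c * itg 0 1 (fun r => Nop h (r * s) / phi_ (r * s) ^+ 2) +
    itg 0 1 (fun r => Nop h' (r * s) / phi_ (r * s) ^+ 2).
  rewrite -itg_lin; first by congr itg; apply/funext => r; rewrite Nop_lin//; ring.
  - by apply: contM; [cont|apply: contVphi; cont].
  - by apply: contM; [cont|apply: contVphi; cont].
by rewrite mulrDr (mulrCA s) mulrDr (mulrCA (phi_ s)).
Qed.

Lemma itgX n : itg 0 1 (fun r : R => r ^+ n) = n.+1%:R^-1.
Proof.
have dF (r : R) : 0 < r < 1 -> is_derive r (1 : R) (fun r : R => n.+1%:R^-1 * r ^+ n.+1) (r ^+ n).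
  move=> _; apply: (is_derive_eq (is_deriveZp _ (is_deriveXp n (is_derive_id _ _)))).
  by rewrite mulr1 mulKf// pnatr_eq0.
rewrite (itg_FTC (@ltr01 R) _ dF); [|by cont|by cont].
by rewrite expr1n expr0n/= mulr1 mulr0 subr0.
Qed.

Lemma Nop_bound h t b s : continuous h -> 0 <= s <= t ->
  (forall r, 0 <= r <= t -> `|h r| <= b) -> `|Nop h s| <= t * (expR (a * t) * b).
Proof.
move=> hh /andP[s0 st] hb; have t0 := le_trans s0 st; have hp := cont_phiR.
have b0 : 0 <= b by apply: le_trans (hb 0 _); rewrite ?lexx.
rewrite /Nop normrM; apply: ler_pM => //; first by rewrite ger0_norm.
have := (bfun_itg (@ler01 R)).2 (fun r => r ^+ k.+1 * (phi_ (r * s) * h (r * s))) (expR (a * t) * b).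
rewrite subr0 mul1r; apply; first by cont.
move=> r /=; rewrite in_itv/= => /andP[r0 r1].
have rs0 : 0 <= r * s by rewrite mulr_ge0.
have rst : r * s <= t by apply: le_trans st; rewrite ler_piMl.
rewrite normrM -[leRHS]mul1r normrX ger0_norm//; apply: ler_pM; rewrite ?exprn_ge0 ?exprn_ile1//.
rewrite normrM; apply: ler_pM => //; last by apply: hb; rewrite rs0.
rewrite (ger0_norm (ltW (phiR_gt0 _))); apply: le_trans (andP (phiR_bounds (r * s))).2 _.
by rewrite ler_expR ger0_norm// ler_wpM2l.
Qed.

Lemma Kop_bound h t b s : continuous h -> 0 <= s <= t ->
  (forall r, 0 <= r <= t -> `|h r| <= b) ->
  `|Kop h s| <= expR (a * t) * (t * (t * expR (a * t) * expR (2 * (a * t)))) * b.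
Proof.
move=> hh /andP[s0 st] hb; have t0 := le_trans s0 st; have hN := cont_Nop hh.
have b0 : 0 <= b by apply: le_trans (hb 0 _); rewrite ?lexx.
rewrite /Kop -!mulrA normrM; apply: ler_pM => //.
  rewrite (ger0_norm (ltW (phiR_gt0 _))); apply: le_trans (andP (phiR_bounds s)).2 _.
  by rewrite ler_expR ger0_norm// ler_wpM2l.
rewrite normrM; apply: ler_pM => //; first by rewrite ger0_norm.
have := (bfun_itg (@ler01 R)).2 (fun r => Nop h (r * s) / phi_ (r * s) ^+ 2)
  (t * (expR (a * t) * (expR (2 * (a * t)) * b))).
rewrite subr0 mul1r; apply; first by apply: contM; [cont|apply: contVphi; cont].
move=> r /=; rewrite in_itv/= => /andP[r0 r1].
have rs0 : 0 <= r * s by rewrite mulr_ge0.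
have rst : r * s <= t by apply: le_trans st; rewrite ler_piMl.
rewrite normrM [leRHS](_ : _ = t * (expR (a * t) * b) * expR (2 * (a * t))); last by ring.
apply: ler_pM => //; first by apply: Nop_bound => //; rewrite rs0.
rewrite normfV ger0_norm ?sqr_ge0// invf_ple ?posrE ?expR_gt0 ?exprn_gt0 ?phiR_gt0//.
rewrite -expRN.
case/andP: (phiR_bounds (r * s)) => + _; rewrite ger0_norm// => h1.
rewrite (_ : - (2 * (a * t)) = - (a * t) + - (a * t)); last by ring.
rewrite expRD expr2; apply: ler_pM; rewrite ?expR_ge0//.
  by apply: le_trans h1; rewrite ler_expR lerN2 ler_wpM2l.
by apply: le_trans h1; rewrite ler_expR lerN2 ler_wpM2l.
Qed.

Lemma Kop0 s : Kop (fun=> 0) s = 0.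
Proof.
have c0 : continuous (fun _ : R => 0 : R) by exact: cont_cst.
have := Kop_lin 1 s c0 c0.
have -> : (fun _ : R => 1 * 0 + 0 : R) = fun=> 0.
  by apply/funext => r; rewrite mulr0 addr0.
by rewrite mul1r => /eqP; rewrite -subr_eq0 opprD addrA subrr sub0r oppr_eq0 => /eqP.
Qed.

(** This is the coefficient psi of L u in the expansion. Its positivity says that phi_lambda(s e_1)
    minus its value at lambda = ia has a simple zero there in the variable lambda^2 + a^2, which is
    what lets the power of L be lowered to 1. *)
Lemma Kop_phi_gt0 s : 0 < s -> 0 < Kop phi_ s.
Proof.
move=> s0; have hp := cont_phiR; have hN := cont_Nop hp.
have lb r : 0 <= r <= s -> expR (- (a * s)) <= phi_ r.
  move=> /andP[r0 rs]; case/andP: (phiR_bounds r) => + _; apply: le_trans.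
  by rewrite ler_expR lerN2 ger0_norm// ler_wpM2l.
have ub r : 0 <= r <= s -> phi_ r <= expR (a * s).
  move=> /andP[r0 rs]; apply: le_trans (andP (phiR_bounds r)).2 _.
  by rewrite ler_expR ger0_norm// ler_wpM2l.
pose e := expR (- (a * s)); have e0 : 0 < e by exact: expR_gt0.
(* Both nested integrals are compared with monomials c r^n, for n = k + 1 and n = 1. *)
have itg_lb (F : R -> R) c n : continuous F ->
    (forall r, 0 <= r <= 1 -> c * r ^+ n <= F r) -> c / n.+1%:R <= itg 0 1 F.
  move=> hF h; have := itg_lin 0 1 c (@contX _ _ id n (@cont_id R)) (@cont_cst R R 0).
  rewrite itgX itg_cst// mul0r addr0 => <-; apply: itg_le => //; first by cont.
  by move=> r /h; rewrite addr0.
have N_lb r : 0 <= r <= s -> r * (e ^+ 2 / k.+2%:R) <= Nop phi_ r.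
  move=> /andP[r0 rs]; apply: ler_wpM2l => //; apply: itg_lb; first by cont.
  move=> q /andP[q0 q1]; rewrite mulrC; apply: ler_wpM2l; first exact: exprn_ge0.
  have qr : 0 <= q * r <= s by rewrite mulr_ge0//= (le_trans _ rs)// ler_piMl.
  by rewrite expr2; apply: ler_pM; rewrite ?(ltW e0)// lb.
apply: mulr_gt0; first exact: phiR_gt0.
apply: mulr_gt0 => //.
pose c := s * (e ^+ 2 / k.+2%:R) * (expR (a * s) ^+ 2)^-1.
have c0 : 0 < c by rewrite !mulr_gt0 ?invr_gt0 ?exprn_gt0 ?expR_gt0 ?ltr0n.
apply: (@lt_le_trans _ _ (c / 2%:R)); first by rewrite divr_gt0.
apply: itg_lb; first by apply: contM; [cont|apply: contVphi; cont].
move=> r /andP[r0 r1].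
have rs : 0 <= r * s <= s by rewrite mulr_ge0 ?(ltW s0)//= ler_piMl// ltW.
rewrite expr1 /c [leLHS](_ : _ = (r * s * (e ^+ 2 / k.+2%:R)) * (expR (a * s) ^+ 2)^-1); last by ring.
apply: ler_pM; last 1 first.
- rewrite lef_pV2 ?posrE ?exprn_gt0 ?phiR_gt0 ?expR_gt0//.
  by rewrite lerXn2r ?nnegrE ?expR_ge0 ?(ltW (phiR_gt0 _))// ub.
- by rewrite mulr_ge0 ?divr_ge0 ?sqr_ge0//; case/andP: rs.
- by rewrite invr_ge0 sqr_ge0.
- exact: N_lb.
Qed.

Section Wronskian.
Variables (g : V -> R) (G1 : 'I_k.+2 -> V -> R) (G2 : 'I_k.+2 -> 'I_k.+2 -> V -> R).
Hypothesis hC : C2 g G1 G2.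
Variable x : V.

Let u := smean g x.
Let u1 := smean1 G1 x.
Let u2 := smean2 G2 x.
Let mL := smean (lapC a G2 g) x.
Let Z := a *: e1 k.+2 : V.
Let p1 := smean1 (fun i y => Z 0 i * expz Z y) 0.
Let p2 := smean2 (fun i j y => Z 0 i * Z 0 j * expz Z y) 0.
Let Wr s := phi_ s * u1 s - u s * p1 s.

Let darboux_u s : s * u2 s + k.+1%:R * u1 s = s * (a ^+ 2 * u s - mL s).
Proof. by rewrite -(darboux x s hC) (smean_lapC a x s hC). Qed.

Let darboux_p s : s * p2 s + k.+1%:R * p1 s = s * (a ^+ 2 * phi_ s).
Proof.
rewrite -(darboux 0 s (C2_expz Z)) (smean_lapC a 0 s (C2_expz Z)).
rewrite (lapC_expz (dotv_ae1 k a)) phiRE /smean (bfun0 (bfun_mean k)) subr0.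
by [].
Qed.

Let cont_mL : continuous mL.
Proof. by apply: cont_smean; exact: cont_lapC hC. Qed.

Let cont_u : continuous u.
Proof. by apply: cont_smean; case: hC => -[]. Qed.

Let du s : is_derive s (1 : R) u (u1 s).
Proof. by apply: smean_derive1; case: hC. Qed.

Let dp s : is_derive s (1 : R) phi_ (p1 s).
Proof. by rewrite phiRE; apply: smean_derive1; case: (C2_expz Z). Qed.

Let dWr s : is_derive s (1 : R) Wr (phi_ s * u2 s - u s * p2 s).
Proof.
apply: (is_derive_eq (is_deriveDp (is_deriveMp (dp s) (smean_derive2 x s hC))
  (is_deriveNp (is_deriveMp (du s) (smean_derive2 0 s (C2_expz Z)))))).
by rewrite -/p1 -/u1 -/u2 -/p2; ring.
Qed.

Let cont_Wr : continuous Wr.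
Proof. exact: is_derive_cont dWr. Qed.

(** The Darboux equations of u and phi are multiplied by phi and u and subtracted: the terms a^2 phi
    u cancel, and the first-order terms make s^(k+1) an integrating factor. *)
Lemma wronskian s : s != 0 -> Wr s = - Nop mL s.
Proof.
move=> s0; have hp := cont_phiR.
have dP r : is_derive r (1 : R) (fun r : R => r ^+ k.+1 * Wr r) (- (r ^+ k.+1 * (phi_ r * mL r))).
  apply: (is_derive_eq (is_deriveMp (is_deriveXp k (is_derive_id _ _)) (dWr r))).
  rewrite mulr1 [LHS](_ : _ = r ^+ k * (phi_ r * (r * u2 r + k.+1%:R * u1 r) -
     u r * (r * p2 r + k.+1%:R * p1 r))); last by rewrite /Wr exprS; ring.
  by rewrite darboux_u darboux_p (exprS r k); ring.
have dQ (r : R) : 0 < r < 1 -> is_derive r (1 : R) (fun r : R => (r * s) ^+ k.+1 * Wr (r * s))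
    (- s ^+ k.+2 * (r ^+ k.+1 * (phi_ (r * s) * mL (r * s)))).
  move=> _; apply: (is_derive_eq (is_derive_comp1
    (is_deriveMp (is_derive_id _ _) (is_derive_cst s _ _)) (dP (r * s)))).
  rewrite /= mul1r mulr0 addr0 exprMn (exprS s k.+1).
  by ring.
have := itg_FTC (@ltr01 R) _ dQ; rewrite !mul1r !mul0r expr0n mul0r subr0 => H.
have {H} : - s ^+ k.+2 * itg 0 1 (fun r => r ^+ k.+1 * (phi_ (r * s) * mL (r * s))) =
   s ^+ k.+1 * Wr s.
  rewrite -H; [|by cont|by cont].
  have := itg_lin 0 1 (- s ^+ k.+2) (f := fun r => r ^+ k.+1 * (phi_ (r * s) * mL (r * s))) _ (@cont_cst R R 0).
  rewrite itg_cst// mul0r addr0 => <-; last by cont.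
  by congr itg; apply/funext => r; rewrite addr0.
move=> E; have sk : s ^+ k.+1 != 0 by rewrite expf_neq0.
apply: (mulfI sk); rewrite -E /Nop (exprS s k.+1) mulrN mulrA -mulNr.
by rewrite [s ^+ k.+1 * s]mulrC mulNr.
Qed.

Lemma smean_expansion s : smean g x s = phi_ s * g x - Kop mL s.
Proof.
have [s0|s0] := eqVneq s 0.
  rewrite s0 /Kop mul0r mulr0 subr0 phiRE /smean.
  under [in LHS]eq_fun do rewrite scale0r subr0.
  under [in RHS]eq_fun do rewrite scale0r subr0.
  by rewrite !mean_cst /expz -(scale0r 0) dotvZr mul0r expR0 mul1r.
have hp := cont_phiR; have p0 r := lt0r_neq0 (phiR_gt0 r).
have hN := cont_Nop cont_mL.
pose v r := u r / phi_ r.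
have dv r : is_derive r (1 : R) v (Wr r / phi_ r ^+ 2).
  have di : is_derive r (1 : R) (fun r => (phi_ r)^-1) (- (phi_ r ^+ 2)^-1 * p1 r).
    have dinv : is_derive (phi_ r) (1 : R) (fun y : R => y^-1) (- (phi_ r ^+ 2)^-1).
      by apply: (is_derive_eq (is_deriveV _ (is_derive_id _ _))); rewrite // scaler1.
    exact: (is_derive_comp1 (dp r) dinv).
  apply: (is_derive_eq (is_deriveMp (du r) di)).
  by rewrite /Wr; field; exact: p0.
have dq (r : R) : 0 < r < 1 -> is_derive r (1 : R) (fun r : R => v (r * s))
    (- s * (Nop mL (r * s) / phi_ (r * s) ^+ 2)).
  move=> /andP[r0 _]; apply: (is_derive_eq (is_derive_comp1
    (is_deriveMp (is_derive_id _ _) (is_derive_cst s _ _)) (dv (r * s)))).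
  rewrite wronskian; last by rewrite mulf_neq0// gt_eqF.
  by rewrite /= mul1r mulr0 addr0; ring.
have cNp : continuous (fun r : R => Nop mL (r * s) / phi_ (r * s) ^+ 2).
  by apply: contM; [cont|apply: contVphi; cont].
have cv : continuous v by exact: is_derive_cont dv.
have := itg_FTC (@ltr01 R) _ dq; rewrite !mul1r !mul0r => H.
have {H} : - s * itg 0 1 (fun r => Nop mL (r * s) / phi_ (r * s) ^+ 2) = v s - v 0.
  rewrite -H; [|by cont|by cont].
  have := itg_lin 0 1 (- s) cNp (@cont_cst R R 0).
  rewrite itg_cst// mul0r addr0 => <-.
  by congr itg; apply/funext => r; rewrite addr0.
have -> : v 0 = g x.
  rewrite /v /u phiRE /smean.
  under [in X in X / _]eq_fun do rewrite scale0r subr0.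
  under [in X in _ / X]eq_fun do rewrite scale0r subr0.
  by rewrite !mean_cst /expz -(scale0r 0) dotvZr mul0r expR0 divr1.
move=> E; rewrite /Kop -/u (_ : u s = phi_ s * v s); last by rewrite /v; field; exact: p0.
have -> : v s = g x + (v s - g x) by ring.
by rewrite -E; ring.
Qed.

End Wronskian.

(** L annihilates the exponential, so the remainder of [smean_expansion] vanishes. This replaces a
    rotation of z onto the first axis. *)
Lemma smean_expz z x s : dotv z z = a ^+ 2 -> smean (expz z) x s = phi_ s * expz z x.
Proof.
move=> zz; rewrite (smean_expansion (C2_expz z)) (lapC_expz zz).
rewrite (_ : smean _ _ = fun=> 0) ?Kop0 ?subr0//.
by apply/funext => r; rewrite /smean (bfun0 (bfun_mean k)).
Qed.

(** [smean_expansion] is used for g and then for L g under the outer [Kop], whose value on the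
    leading term phi(r) L g(x) gives the coefficient psi. *)
Lemma smean_expansion2 g G1 G2 H1 H2 x s : C2 g G1 G2 -> C2 (lapC a G2 g) H1 H2 ->
  smean g x s = phi_ s * g x - Kop phi_ s * lapC a G2 g x +
    Kop (Kop (smean (lapC a H2 (lapC a G2 g)) x)) s.
Proof.
move=> hg hL; rewrite (smean_expansion hg).
have cL : continuous (smean (lapC a H2 (lapC a G2 g)) x).
  by apply: cont_smean; exact: cont_lapC hL.
have cK := cont_Kop cL; have hp := cont_phiR.
rewrite (_ : smean (lapC a G2 g) x = fun r => lapC a G2 g x * phi_ r +
    (-1 * Kop (smean (lapC a H2 (lapC a G2 g)) x) r + 0)); last first.
  by apply/funext => r; rewrite (smean_expansion hL); ring.
rewrite Kop_lin; [|by cont|by cont].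
rewrite Kop_lin; [|by cont|by cont].
rewrite Kop0; move: (Kop phi_ s) (Kop (Kop _) s) => A B.
by ring.
Qed.

End Expansion.

(** * Iterated partial derivatives and their symmetry *)

Section Schwarz.
Context {R : realType} {d : nat}.
Implicit Types (g : 'rV[R]_d -> R) (x : 'rV[R]_d) (i j : 'I_d) (s : seq 'I_d).

Fact rpart_key : unit. Proof. exact: tt. Qed.

Definition rpart : 'I_d -> ('rV[R]_d -> R) -> 'rV[R]_d -> R :=
  locked_with rpart_key (fun i g x => 'D_(delta_mx 0 i) g x).

Lemma rpartE i g x : rpart i g x = 'D_(delta_mx 0 i) g x.
Proof. by rewrite /rpart unlock. Qed.

Definition rps s g : 'rV[R]_d -> R := foldr rpart g s.

Definition rsmooth g := forall s, continuous (rps s g) /\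
  forall i x, derivable (rps s g) x (delta_mx 0 i : 'rV[R]_d).

Lemma C1_rsmooth g : rsmooth g -> C1 g (rpart^~ g).
Proof.
move=> h; split; first by case: (h [::]).
- by move=> i; case: (h [:: i]).
- by move=> i x; rewrite rpartE; apply: derivableP; case: (h [::]) => _; apply.
Qed.

Lemma rps_cat s s' g : rps (s ++ s') g = rps s (rps s' g).
Proof. exact: foldr_cat. Qed.

Lemma rsmooth_rps s g : rsmooth g -> rsmooth (rps s g).
Proof. by move=> h s'; rewrite -rps_cat; exact: h. Qed.

Lemma C1_unique g G i : C1 g G -> rpart i g = G i.
Proof. by case=> _ _ dG; apply/funext => x; rewrite rpartE; exact: derive_val. Qed.

Lemma C1_translate g G v : C1 g G -> C1 (fun x => g (v + x)) (fun i x => G i (v + x)).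
Proof.
move=> [hg hG dg]; split; [by cont|by move=> i; cont|].
move=> i x; apply/is_derive_line.
have /is_derive_line := dg i (v + x).
by under eq_fun do rewrite addrCA.
Qed.

Lemma C1_sub g G g' G' : C1 g G -> C1 g' G' ->
  C1 (fun x => g x - g' x) (fun i x => G i x - G' i x).
Proof.
move=> [hg hG dg] [hg' hG' dg']; split; [by cont|by move=> i; cont|].
by move=> i x; exact: (is_deriveDp (dg _ _) (is_deriveNp (dg' _ _))).
Qed.

(** Mean value theorem in direction j for y -> g(h e_i + y) - g(y), then in direction i for d_j
    g. *)
Lemma double_difference g x i j (h : R) : rsmooth g ->
  exists2 y, enorm (y - x) <= 2 * `|h| &
    g (h *: delta_mx 0 i + (h *: delta_mx 0 j + x)) - g (h *: delta_mx 0 j + x)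
    - (g (h *: delta_mx 0 i + x) - g x) = h * (h * rpart i (rpart j g) y).
Proof.
move=> hg; have hg1 := C1_rsmooth hg.
have hgj := C1_rsmooth (rsmooth_rps [:: j] hg).
have hd := C1_sub (C1_translate (h *: delta_mx 0 i) hg1) hg1.
have [xi hxi ->] := MVT_coord x j h hd.
have [eta heta ->] := MVT_coord (xi *: delta_mx 0 j + x) i h hgj.
exists (eta *: delta_mx 0 i + (xi *: delta_mx 0 j + x)) => //.
have nd (c : R) l : enorm (c *: (delta_mx 0 l : 'rV[R]_d)) = `|c|.
  rewrite enormZ /enorm /dotv (bigD1 l)//= big1.
    by rewrite !mxE !eqxx mulr1 addr0 sqrtr1 mulr1.
  by move=> q ql; rewrite !mxE (negbTE ql) mulr0.
rewrite addrA addrK; apply: le_trans (enormD _ _) _.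
by rewrite !nd mulr_natl mulr2n lerD.
Qed.

Lemma continuous_enorm_near g x (e : R) : continuous g -> 0 < e ->
  exists2 del : R, 0 < del & forall y, enorm (y - x) < del -> `|g y - g x| < e.
Proof.
move=> hg e0; have := hg x => /cvgrPdist_lt /(_ _ e0) /nbhs_ballP[del /= del0 H].
exists del => // y hy; rewrite distrC; apply: H.
rewrite -ball_normE /ball_/= distrC.
exact: le_lt_trans (norm_le_enorm _) hy.
Qed.

(** The second difference is symmetric in i and j, and it is h^2 times either mixed derivative at
    some point near x; continuity at x concludes. *)
Lemma schwarz g i j : rsmooth g -> rpart i (rpart j g) = rpart j (rpart i g).
Proof.
move=> hg; apply/funext => x; apply/eqP; rewrite -subr_eq0 -normr_le0.
apply/ler_addgt0Pl => e e0; rewrite addr0.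
have e2 : 0 < e / 2 by rewrite divr_gt0.
have [d1 d10 H1] := continuous_enorm_near x (hg [:: i; j]).1 e2.
have [d2 d20 H2] := continuous_enorm_near x (hg [:: j; i]).1 e2.
pose h := Num.min d1 d2 / 4.
have m0 : 0 < Num.min d1 d2 by rewrite lt_min d10.
have h0 : 0 < h by rewrite divr_gt0.
have hm : 2 * `|h| < Num.min d1 d2.
  by rewrite gtr0_norm// /h mulrA ltr_pdivrMr// mulrC ltr_pM2l// ltr_nat.
have [y hy Ey] := double_difference x i j h hg.
have [z hz Ez] := double_difference x j i h hg.
have yz : rpart i (rpart j g) y = rpart j (rpart i g) z.
  apply: (mulfI (lt0r_neq0 h0)); apply: (mulfI (lt0r_neq0 h0)).
  have swap (A B C D : R) : A - B - (C - D) = A - C - (B - D) by ring.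
  apply: etrans (esym Ey) _; apply: etrans _ Ez.
  by rewrite [X in g X - _ - _]addrCA; exact: swap.
have hy1 : enorm (y - x) < d1.
  by apply: le_lt_trans hy (lt_le_trans hm _); rewrite ge_min lexx.
have hz2 : enorm (z - x) < d2.
  by apply: le_lt_trans hz (lt_le_trans hm _); rewrite ge_min lexx orbT.
have := H1 y hy1; have := H2 z hz2; rewrite /= yz => A B.
move: A B; move: (rpart j (rpart i g) z) (rpart i (rpart j g) x) (rpart j (rpart i g) x).
move=> p q r A B; rewrite (splitr e) (_ : q - r = (p - r) - (p - q)); last by ring.
by apply: le_trans (ler_normB _ _) _; apply: lerD; exact: ltW.
Qed.

Lemma rps_rem i s g : rsmooth g -> i \in s -> rps s g = rps (i :: rem i s) g.
Proof.
move=> hg; elim: s => [//|j s IH]; rewrite inE /=.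
have [->|ij] := eqVneq j i; first by rewrite ?eqxx.
rewrite ?(eq_sym i j) ?(negbTE ij) /= => /IH ->; rewrite /=.
by apply: schwarz; exact: rsmooth_rps.
Qed.

Lemma rps_perm s s' g : rsmooth g -> perm_eq s s' -> rps s g = rps s' g.
Proof.
move=> hg; elim: s' s => [|i s' IH] s.
  by move=> /perm_nilP ->.
move=> ss'; have is_ : i \in s by rewrite (perm_mem ss') mem_head.
rewrite (rps_rem hg is_) /= (IH (rem i s))//.
by rewrite -(perm_cons i) perm_sym; apply: perm_trans (perm_to_rem is_); rewrite perm_sym.
Qed.

Lemma rps_rcons i s g : rsmooth g -> rps s (rpart i g) = rpart i (rps s g).
Proof.
move=> hg; rewrite -[rpart i g]/(rps [:: i] g) -rps_cat.
rewrite -[RHS]/(rps (i :: s) g); apply: rps_perm => //.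
by rewrite cats1 perm_rcons.
Qed.

End Schwarz.

(** * Convolution with a compactly carried functional, and the real form of S^a *)

Section Convolution.
Context {R : realType} {d : nat}.
Implicit Types (g : 'rV[R]_d -> R) (x : 'rV[R]_d) (i j : 'I_d) (s : seq 'I_d).

Definition fconv (Lam : ('rV[R]_d -> R) -> R) g : 'rV[R]_d -> R :=
  fun x => Lam (fun y => g (x - y)).

Variables (rho C : R) (Lam : ('rV[R]_d -> R) -> R).
Hypothesis hL : bfun (eball rho) C Lam.

Lemma fconv_cont g : continuous g -> continuous (fconv Lam g).
Proof.
move=> hg; apply: (bfun_cont hL (G := fun x y => g (x - y))).
  exact: eball_compact.
by cont.
Qed.

Lemma fconv_C1 g G : C1 g G -> C1 (fconv Lam g) (fun i => fconv Lam (G i)).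
Proof.
move=> [hg hG dg]; split; [exact: fconv_cont|by move=> i; exact: fconv_cont|].
move=> i x; apply/is_derive_line.
have H := bfun_derive hL (G := fun h y => g (h *: delta_mx 0 i + (x - y)))
  (G' := fun h y => G i (h *: delta_mx 0 i + (x - y))) (@eball_compact _ _ _).
rewrite (_ : (fun h : R => _) = fun h => Lam (fun y => g (h *: delta_mx 0 i + (x - y)))); last first.
  by apply/funext => h; rewrite /fconv; congr Lam; apply/funext => y; rewrite addrA.
rewrite (_ : fconv Lam (G i) x = Lam (fun y => G i (0 *: delta_mx 0 i + (x - y)))); last first.
  by congr Lam; apply/funext => y; rewrite scale0r add0r.
apply: H; [by cont|by cont|].
by move=> h y; exact: is_derive_shift_line.
Qed.

Lemma rps_fconv s g : rsmooth g -> rps s (fconv Lam g) = fconv Lam (rps s g).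
Proof.
move=> hg; elim: s => [//|i s IH] /=.
by rewrite IH; exact: C1_unique (fconv_C1 (C1_rsmooth (rsmooth_rps s hg))).
Qed.

Lemma rsmooth_fconv g : rsmooth g -> rsmooth (fconv Lam g).
Proof.
move=> hg s; rewrite rps_fconv//.
have [h1 h2 h3] := fconv_C1 (C1_rsmooth (rsmooth_rps s hg)).
by split=> // i x; apply: ex_derive.
Qed.

Lemma fconv_lin c g g' : continuous g -> continuous g' ->
  fconv Lam (fun x => c * g x + g' x) = fun x => c * fconv Lam g x + fconv Lam g' x.
Proof. by move=> hg hg'; apply/funext => x; rewrite /fconv hL.1//; cont. Qed.

(** Real-valued S^a with words of partial derivatives in place of multi-indices; [Sa_RSa] compares
    the two. *)
Definition RSa (a : R) g := rsmooth g /\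
  forall m s, exists B : R, forall x,
    expR (a * enorm x) * (1 + enorm x) ^+ m * `|rps s g x| <= B.

Lemma weight_shift (a : R) m (x y : 'rV[R]_d) (r : R) : 0 <= a -> enorm y <= r ->
  expR (a * enorm x) * (1 + enorm x) ^+ m <=
  expR (a * r) * (1 + r) ^+ m * (expR (a * enorm (x - y)) * (1 + enorm (x - y)) ^+ m).
Proof.
move=> a0 yr; have r0 : 0 <= r by apply: le_trans yr; exact: enorm_ge0.
have n0 := enorm_ge0 (x - y).
have tri : enorm x <= r + enorm (x - y).
  rewrite -[in leLHS](subrK y x) addrC; apply: le_trans (enormD _ _) _.
  by rewrite lerD2r.
rewrite mulrACA -expRD -mulrDr -exprMn; apply: ler_pM.
- exact: expR_ge0.
- by rewrite exprn_ge0// addr_ge0// enorm_ge0.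
- by rewrite ler_expR ler_wpM2l.
- rewrite lerXn2r ?nnegrE ?mulr_ge0 ?addr_ge0 ?enorm_ge0//.
  by nra.
Qed.

Lemma RSa_fconv a g : 0 <= a -> 0 <= C -> RSa a g -> RSa a (fconv Lam g).
Proof.
move=> a0 C0 [hg bg]; split; first exact: rsmooth_fconv.
move=> m s; have [B hB] := bg m s.
exists (C * (expR (a * rho) * (1 + rho) ^+ m * B)) => x.
have [hs _] := hg s.
rewrite rps_fconv// /fconv.
have w0 (z : 'rV[R]_d) : 0 < expR (a * enorm z) * (1 + enorm z) ^+ m.
  by rewrite mulr_gt0 ?expR_gt0// exprn_gt0// ltr_wpDr// enorm_ge0.
rewrite mulrC -ler_pdivlMr// -[leRHS]mulrA; apply: hL.2; first by cont.
move=> y /= yr; rewrite ler_pdivlMr//.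
have r0 : 0 <= rho by apply: le_trans yr; exact: enorm_ge0.
apply: (@le_trans _ _ (`|rps s g (x - y)| * (expR (a * rho) * (1 + rho) ^+ m *
   (expR (a * enorm (x - y)) * (1 + enorm (x - y)) ^+ m)))).
  by apply: ler_wpM2l => //; exact: weight_shift.
rewrite mulrCA; apply: ler_wpM2l; last by rewrite mulrC.
by rewrite mulr_ge0 ?expR_ge0// exprn_ge0// addr_ge0.
Qed.

End Convolution.

(** * Pairs of points of the sphere and integration by parts along rotations *)

Section PairFunctional.
Context {R : realType} (k : nat).
Notation V := 'rV[R]_k.+2.
Notation mean := (@sphere_meanR R k.+2).
Implicit Types (F G p : V -> V -> R).

Definition cont2 F := continuous (fun z : V * V => F z.1 z.2).

Fact pairB_key : unit. Proof. exact: tt. Qed.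

Definition pairB : (V -> V -> R) -> R :=
  locked_with pairB_key (fun F => mean (fun w => mean (fun v => F w v))).

Lemma pairBE F : pairB F = mean (fun w => mean (fun v => F w v)).
Proof. by rewrite /pairB unlock. Qed.

Lemma cont2_r F w : cont2 F -> continuous (F w).
Proof.
move=> hF; apply: (cont_comp (f := fun v : V => (w, v)) (g := fun z : V * V => F z.1 z.2)) => //.
by cont.
Qed.

Lemma cont2_mean F : cont2 F -> continuous (fun w => mean (F w)).
Proof.
move=> hF; apply: (bfun_cont (bfun_mean k) (G := F)) => //.
exact: esphere_compact.
Qed.

Lemma pairB_lin c F G : cont2 F -> cont2 G ->
  pairB (fun w v => c * F w v + G w v) = c * pairB F + pairB G.
Proof.
move=> hF hG; rewrite !pairBE -(bfun_mean k).1; [|exact: cont2_mean|exact: cont2_mean].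
by congr mean; apply/funext => w; rewrite (bfun_mean k).1//; exact: cont2_r.
Qed.

Lemma cont2_cst c : cont2 (fun _ _ => c).
Proof. exact: cont_cst. Qed.

Lemma pairB_cst c : pairB (fun _ _ => c) = c.
Proof. by rewrite pairBE; under eq_fun do rewrite mean_cst; exact: mean_cst. Qed.

Lemma pairBZ c F : cont2 F -> pairB (fun w v => c * F w v) = c * pairB F.
Proof.
move=> hF; have := pairB_lin c hF (@cont2_cst 0); rewrite pairB_cst addr0 => <-.
by congr pairB; apply/funext => w; apply/funext => v; rewrite addr0.
Qed.

Lemma pairBD F G : cont2 F -> cont2 G ->
  pairB (fun w v => F w v + G w v) = pairB F + pairB G.
Proof.
move=> hF hG; have := pairB_lin 1 hF hG; rewrite mul1r => <-.
by congr pairB; apply/funext => w; apply/funext => v; rewrite mul1r.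
Qed.

Lemma pairB_le F G : cont2 F -> cont2 G ->
  (forall w v, esphere w -> esphere v -> F w v <= G w v) -> pairB F <= pairB G.
Proof.
move=> hF hG FG; rewrite !pairBE; apply: mean_ge; [exact: cont2_mean|exact: cont2_mean|].
move=> w ww; apply: mean_ge; [exact: cont2_r|exact: cont2_r|].
by move=> v vv; exact: FG.
Qed.

Lemma pairB_norm F G : cont2 F -> cont2 G ->
  (forall w v, esphere w -> esphere v -> `|F w v| <= G w v) -> `|pairB F| <= pairB G.
Proof.
move=> hF hG FG; rewrite ler_norml; apply/andP; split; last first.
  by apply: pairB_le => // w v ww vv; apply: le_trans (FG w v ww vv); exact: ler_norm.
have E : pairB (fun w v => -1 * F w v) = - pairB F by rewrite pairBZ// mulN1r.
rewrite lerNl -E; apply: pairB_le => //.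
  by rewrite /cont2; apply: contM => //; exact: cont_cst.
by move=> w v ww vv; have := FG w v ww vv; rewrite ler_norml mulN1r => /andP[]; rewrite lerNl.
Qed.

Lemma pairB_skew_l F (Fw : 'I_k.+2 -> V -> V -> R) i j : cont2 F ->
  (forall l, cont2 (Fw l)) ->
  (forall v l w, is_derive w (delta_mx 0 l : V) (F ^~ v) (Fw l w v)) ->
  pairB (fun w v => w 0 i * Fw j w v - w 0 j * Fw i w v) = 0.
Proof.
move=> hF hFw dF.
have H : C1 (fun w => mean (F w)) (fun l w => mean (Fw l w)).
  split; [exact: cont2_mean|by move=> l; exact: cont2_mean|].
  move=> l w; apply/is_derive_line.
  have D := bfun_derive (bfun_mean k) (G := fun h v => F (h *: delta_mx 0 l + w) v)
    (G' := fun h v => Fw l (h *: delta_mx 0 l + w) v) (@esphere_compact _ _).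
  rewrite -[X in mean (Fw l X)]add0r -(scale0r (delta_mx 0 l)).
  apply: D.
  - apply: (cont_comp (f := fun z : R * V => (z.1 *: delta_mx 0 l + w, z.2))
      (g := fun z : V * V => F z.1 z.2)) => //.
    by cont.
  - apply: (cont_comp (f := fun z : R * V => (z.1 *: delta_mx 0 l + w, z.2))
      (g := fun z : V * V => Fw l z.1 z.2)) => //; last exact: hFw.
    by cont.
  - move=> h v; exact: (is_derive_shift_line (dF v l _)).
have := sphere_skew_invariant i j H; apply: etrans; rewrite pairBE; congr mean.
apply/funext => w; have hj := cont2_r (w := w) (hFw j); have hi := cont2_r (w := w) (hFw i).
rewrite -!(bfunZ (bfun_mean k))// -(bfunB (bfun_mean k))//.
- by apply: contM => //; exact: cont_cst.
- by apply: contM => //; exact: cont_cst.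
Qed.

Lemma pairB_skew_r F (Fv : 'I_k.+2 -> V -> V -> R) i j : cont2 F ->
  (forall l, cont2 (Fv l)) ->
  (forall w l v, is_derive v (delta_mx 0 l : V) (F w) (Fv l w v)) ->
  pairB (fun w v => v 0 i * Fv j w v - v 0 j * Fv i w v) = 0.
Proof.
move=> hF hFv dF; rewrite pairBE -[RHS](mean_cst k 0); congr mean; apply/funext => w.
apply: (sphere_skew_invariant i j (F := F w) (G := fun l => Fv l w)).
by split; [exact: cont2_r|move=> l; exact: cont2_r|move=> l v; exact: dF].
Qed.

(** The rotation fields of w and v combine as v_j (w_i d_j - w_j d_i) - w_j (v_i d_j - v_j d_i) =
    minor d_j. Since this factor changes sign, [pairB_ibp] multiplies by it once more; [inner]
    appears because the derivatives of [minor] along the two rotations are -[inner] and [inner]. *)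
Definition minor i j (w v : V) := w 0 i * v 0 j - w 0 j * v 0 i.
Definition inner i j (w v : V) := w 0 i * v 0 i + w 0 j * v 0 j.

(* Skew invariance in w, applied to minor * v_j * g, and in v, applied to
   minor * w_j * g; the sum is the stated identity. *)
Lemma pairB_ibp (g : V -> R) (G' : 'I_k.+2 -> V -> R) (x : V) (t : R) i j : C1 g G' -> i != j ->
  t * pairB (fun w v => minor i j w v ^+ 2 * G' j (x - t *: (w + v))) =
  - pairB (fun w v => inner i j w v * (w 0 j + v 0 j) * g (x - t *: (w + v))).
Proof.
move=> hg ij; have [hg0 hG dg] := hg.
have dline (y : V) l u : is_derive u (delta_mx 0 l : V)
    (fun u => g (x - t *: (u + y))) (- t * G' l (x - t *: (u + y))).
  apply/is_derive_line.
  apply: (is_derive_eq (is_derive_curve (gam := fun h => x - t *: (h *: delta_mx 0 l + u + y))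
      (gam' := fun m => - (t * (m == l)%:R)) hg _)).
    move=> m; rewrite (_ : (fun _ => _) = (fun r : R => (x 0 m - t * (u 0 m + y 0 m)) + r * (- (t * (m == l)%:R)))).
      apply: (is_derive_eq (is_deriveDp (is_derive_cst _ _ _) (is_deriveMp (is_derive_id _ _) (is_derive_cst _ _ _)))).
      by rewrite mul1r mulr0 addr0 add0r.
    by apply/funext => r; rewrite !mxE eqxx; ring.
  rewrite (bigD1 l)//= eqxx mulr1 scale0r add0r big1 ?addr0 ?mulNr//.
  by move=> m /negbTE ->; rewrite mulr0 oppr0 mul0r.
have dc (u : V) l m : is_derive u (delta_mx 0 l : V) (fun u : V => u 0 m) ((m == l)%:R : R).
  by apply: (is_derive_eq (is_derive_coord _ _ _)); rewrite mxE eqxx.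
have ji : (j == i) = false by rewrite eq_sym; exact: negbTE.
have cg : cont2 (fun w v => g (x - t *: (w + v))) by rewrite /cont2; cont.
have cG l : cont2 (fun w v => G' l (x - t *: (w + v))) by rewrite /cont2; cont.
have L := @pairB_skew_l (fun w v => minor i j w v * (v 0 j * g (x - t *: (w + v))))
  (fun l w v => ((i == l)%:R * v 0 j - (j == l)%:R * v 0 i) * (v 0 j * g (x - t *: (w + v)))
     + minor i j w v * (v 0 j * (- t * G' l (x - t *: (w + v))))) i j.
have Rr := @pairB_skew_r (fun w v => minor i j w v * (w 0 j * g (x - t *: (w + v))))
  (fun l w v => ((j == l)%:R * w 0 i - (i == l)%:R * w 0 j) * (w 0 j * g (x - t *: (w + v)))
     + minor i j w v * (w 0 j * (- t * G' l (x - t *: (w + v))))) i j.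
have {}L := L _ _ _; have {}Rr := Rr _ _ _.
have EL : pairB (fun w v => - (inner i j w v * (v 0 j * g (x - t *: (w + v)))) -
   t * (minor i j w v * (v 0 j * (w 0 i * G' j (x - t *: (w + v)) - w 0 j * G' i (x - t *: (w + v)))))) = 0.
  rewrite -[RHS]L.
  - congr pairB; apply/funext => w; apply/funext => v.
    by rewrite !eqxx (negbTE ij) ji /inner /= mulr1n mulr0n; ring.
  - by rewrite /cont2 /minor; cont.
  - by move=> l; rewrite /cont2 /minor; cont.
  - move=> v l w.
    have dm : is_derive w (delta_mx 0 l : V) (fun w => minor i j w v)
        ((i == l)%:R * v 0 j - (j == l)%:R * v 0 i).
      rewrite /minor; apply: (is_derive_eq (is_deriveDp (is_deriveMp (dc _ _ _) (is_derive_cst _ _ _))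
        (is_deriveNp (is_deriveMp (dc _ _ _) (is_derive_cst _ _ _))))).
      by rewrite /= !mulr0 !addr0.
    exact: (is_deriveMp dm (is_deriveZp (v 0 j) (dline v l w))).
have ER : pairB (fun w v => inner i j w v * (w 0 j * g (x - t *: (w + v))) -
   t * (minor i j w v * (w 0 j * (v 0 i * G' j (x - t *: (w + v)) - v 0 j * G' i (x - t *: (w + v)))))) = 0.
  rewrite -[RHS]Rr.
  - congr pairB; apply/funext => w; apply/funext => v.
    by rewrite !eqxx (negbTE ij) ji /inner /= mulr1n mulr0n; ring.
  - by rewrite /cont2 /minor; cont.
  - by move=> l; rewrite /cont2 /minor; cont.
  - move=> w l v.
    have dm : is_derive v (delta_mx 0 l : V) (minor i j w)
        ((j == l)%:R * w 0 i - (i == l)%:R * w 0 j).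
      rewrite /minor; apply: (is_derive_eq (is_deriveDp (is_deriveMp (is_derive_cst _ _ _) (dc _ _ _))
        (is_deriveNp (is_deriveMp (is_derive_cst _ _ _) (dc _ _ _))))).
      by rewrite /= !mul0r !add0r ![w 0 _ * _]mulrC.
    have dl : is_derive v (delta_mx 0 l : V) (fun v => g (x - t *: (w + v))) (- t * G' l (x - t *: (w + v))).
      have -> : (fun v => g (x - t *: (w + v))) = fun v => g (x - t *: (v + w)).
        by apply/funext => u; rewrite [w + u]addrC.
      by rewrite [w + v]addrC; exact: dline.
    exact: (is_deriveMp dm (is_deriveZp (w 0 j) dl)).
apply/eqP; rewrite -subr_eq0 opprK; apply/eqP.
rewrite -pairBZ; last by rewrite /cont2 /minor; cont.
rewrite -pairBD; [|by rewrite /cont2 /minor; cont|by rewrite /cont2 /inner; cont].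
have := pairB_lin (-1) (F := fun w v => - (inner i j w v * (v 0 j * g (x - t *: (w + v)))) -
   t * (minor i j w v * (v 0 j * (w 0 i * G' j (x - t *: (w + v)) - w 0 j * G' i (x - t *: (w + v))))))
  (G := fun w v => inner i j w v * (w 0 j * g (x - t *: (w + v))) -
   t * (minor i j w v * (w 0 j * (v 0 i * G' j (x - t *: (w + v)) - v 0 j * G' i (x - t *: (w + v)))))).
rewrite EL ER mulr0 addr0 => <-.
- by congr pairB; apply/funext => w; apply/funext => v; rewrite /minor; ring.
- by rewrite /cont2 /minor /inner; cont.
- by rewrite /cont2 /minor /inner; cont.
Qed.

End PairFunctional.

(** * Second moments of the sphere *)

Section Moments.
Context {R : realType} (k : nat).
Notation V := 'rV[R]_k.+2.
Notation mean := (@sphere_meanR R k.+2).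

Lemma mean_coord_ortho (i j : 'I_k.+2) : i != j -> mean (fun w => w 0 i * w 0 j) = 0.
Proof.
move=> ij; have hm := bfun_mean (R := R) k.
have := sphere_skew_invariant i j (C1_mul (C1_coord i) (@C1_coord R _ i)).
rewrite (_ : (fun w : V => _) = fun w => (-2) * (w 0 i * w 0 j)); last first.
  apply/funext => w; rewrite eqxx (eq_sym j i) (negbTE ij) /= mulr1n mulr0n; ring.
by rewrite (bfunZ hm); [lra|cont].
Qed.

(** Skew invariance for w_i w_j makes all these moments equal, and they sum to 1. *)
Lemma mean_coord_sqr (i : 'I_k.+2) : mean (fun w => w 0 i * w 0 i) = k.+2%:R^-1.
Proof.
have hm := bfun_mean (R := R) k.
have E j : mean (fun w => w 0 i * w 0 i) = mean (fun w => w 0 j * w 0 j).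
  have [->//|ij] := eqVneq i j.
  have := sphere_skew_invariant i j (C1_mul (C1_coord i) (@C1_coord R _ j)).
  rewrite (_ : (fun w : V => _) = fun w => w 0 i * w 0 i - w 0 j * w 0 j); last first.
    apply/funext => w; rewrite !eqxx (eq_sym j i) (negbTE ij) /= mulr1n mulr0n; ring.
  by rewrite (bfunB hm); [lra|cont|cont].
have S : \sum_(j < k.+2) mean (fun w => w 0 j * w 0 j) = 1.
  rewrite -(bfun_sum hm); last by move=> j; cont.
  rewrite -[RHS](mean_cst k 1); apply: (bfun_eq hm); [by cont|by cont|].
  by move=> w.
apply: (mulfI (_ : k.+2%:R != 0 :> R)); first by rewrite pnatr_eq0.
rewrite mulfV ?pnatr_eq0//; apply: etrans _ S.
by rewrite (eq_bigr _ (fun j _ => esym (E j))) sumr_const card_ord mulr_natl.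
Qed.

(** The source of the ellipticity constant [ellip]: it measures the share of A on which integration
    by parts is effective. *)
Lemma pairB_minor_sqr (i j : 'I_k.+2) : i != j ->
  pairB (fun w v : V => minor i j w v ^+ 2) = 2 / k.+2%:R ^+ 2.
Proof.
move=> ij; have hm := bfun_mean (R := R) k.
have -> : pairB (fun w v : V => minor i j w v ^+ 2) =
    mean (fun w => k.+2%:R^-1 * (w 0 i * w 0 i) + k.+2%:R^-1 * (w 0 j * w 0 j)).
  rewrite pairBE; congr mean; apply/funext => w.
  rewrite (_ : (fun v : V => _) = fun v => (w 0 i * w 0 i) * (v 0 j * v 0 j) +
      ((- 2 * w 0 i * w 0 j) * (v 0 i * v 0 j) + (w 0 j * w 0 j) * (v 0 i * v 0 i))); last first.
    by apply/funext => v; rewrite /minor; ring.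
  rewrite (bfunD hm); [|by cont|by cont].
  rewrite (bfunD hm); [|by cont|by cont].
  rewrite !(bfunZ hm); [|by cont|by cont|by cont].
  by rewrite !mean_coord_sqr mean_coord_ortho//; ring.
rewrite (bfunD hm); [|by cont|by cont].
rewrite !(bfunZ hm); [|by cont|by cont].
by rewrite !mean_coord_sqr expr2 invfM; ring.
Qed.

End Moments.

(** * Weighted forms of A and their action on local exponential bounds *)

Section Estimates.
Context {R : realType} (k : nat) (a t : R).
Hypotheses (a0 : 0 <= a) (t0 : 0 < t).
Notation V := 'rV[R]_k.+2.
Notation mean := (@sphere_meanR R k.+2).
Notation c := (phiR k a t).
Implicit Types (g : V -> R) (p : V -> V -> R) (x z : V).

(** The kernel p = 1 gives A; other kernels are pieces of A or carry a derivative. *)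
Definition swop p g x := (c ^+ 2)^-1 * pairB (fun w v => p w v * g (x - t *: (w + v))).

Lemma c2_gt0 : 0 < c ^+ 2.
Proof. by rewrite exprn_gt0// phiR_gt0. Qed.

Lemma cont2_op p g x : cont2 p -> continuous g ->
  cont2 (fun w v => p w v * g (x - t *: (w + v))).
Proof.
move=> hp hg; apply: contM; first exact: hp.
by cont.
Qed.

Lemma op_linp (r : R) p q g x : cont2 p -> cont2 q -> continuous g ->
  swop (fun w v => r * p w v + q w v) g x = r * swop p g x + swop q g x.
Proof.
move=> hp hq hg; rewrite /swop mulrCA -mulrDr; congr (_ * _).
rewrite -pairB_lin; [|exact: cont2_op|exact: cont2_op].
by congr pairB; apply/funext => w; apply/funext => v; rewrite mulrDl mulrA.
Qed.

Definition opfun p (F : V -> R) := (c ^+ 2)^-1 * pairB (fun w v => p w v * F (t *: (w + v))).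

Lemma bfun_op p (b : R) : cont2 p -> (forall w v, esphere w -> esphere v -> `|p w v| <= b) ->
  bfun (eball (2 * t)) ((c ^+ 2)^-1 * b) (opfun p).
Proof.
move=> hp pb; have cF (F : V -> R) : continuous F -> cont2 (fun w v => p w v * F (t *: (w + v))).
  by move=> hF; apply: contM; [exact: hp|cont].
split=> [r F G hF hG|F b' hF Fb].
  rewrite /opfun mulrCA -mulrDr; congr (_ * _).
  rewrite -pairB_lin; [|exact: cF|exact: cF].
  by congr pairB; apply/funext => w; apply/funext => v; ring.
rewrite /opfun normrM ger0_norm ?invr_ge0 ?sqr_ge0// -mulrA.
rewrite ler_pM2l ?invr_gt0 ?c2_gt0// -[leRHS](pairB_cst k).
apply: pairB_norm; [exact: cF|exact: cont2_cst|].
move=> w v ww vv; rewrite normrM; apply: ler_pM => //; first exact: pb.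
apply: Fb; rewrite /eball/= enormZ gtr0_norm// mulrC ler_pM2r//.
by apply: le_trans (enormD _ _) _; rewrite !esphere_enorm//.
Qed.

(* After conjugation by exp(z . y), [Loc] is a sup bound on a ball, [mass] is the total
   mass of the kernel p and [twist] is the partial derivative d_j. *)
Definition Loc (z x : V) (rho b : R) g :=
  forall y, enorm (y - x) <= rho -> `|g y| <= b * expz (- z) y.

Definition mass z p := swop p (expz (- z)) 0.

Lemma cont_expz z : continuous (@expz R k z).
Proof. by rewrite /expz; cont. Qed.

Lemma expzD z x y : expz z (x + y) = expz z x * expz z y :> R.
Proof. by rewrite /expz dotvDr expRD. Qed.

(** By multiplicativity exp(-z . y) is an eigenfunction of [swop p] with eigenvalue [mass z p], and
    positivity of p carries the bound through. The steps t (w + v) have length at most 2 t. *)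
Lemma op_Loc z p x rho b g : 0 <= b -> cont2 p -> continuous g ->
  (forall w v, esphere w -> esphere v -> 0 <= p w v) ->
  Loc z x (rho + 2 * t) b g -> Loc z x rho (mass z p * b) (swop p g).
Proof.
move=> b0 hp hg p0 hL y yx; rewrite /swop normrM ger0_norm ?invr_ge0 ?sqr_ge0//.
rewrite /mass /swop -!mulrA ler_pM2l ?invr_gt0 ?c2_gt0// mulrC.
have ce := @cont_expz (- z).
rewrite -pairBZ; last exact: cont2_op.
apply: pairB_norm; first exact: cont2_op.
  by apply: contM; [exact: cont_cst|exact: cont2_op].
move=> w v ww vv; rewrite normrM (ger0_norm (p0 _ _ ww vv)).
rewrite mulrCA; apply: ler_wpM2l; first exact: p0.
rewrite -mulrA -expzD sub0r; apply: hL.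
rewrite addrAC; apply: le_trans (enormD _ _) _; rewrite lerD//.
rewrite enormN enormZ gtr0_norm// mulrC ler_pM2r//.
by apply: le_trans (enormD _ _) _; rewrite !esphere_enorm//.
Qed.

(** exp(-z . y) is an eigenfunction of M_t with eigenvalue c; this is used for v and then for w. *)
Lemma mass1 z : dotv z z = a ^+ 2 -> mass z (fun _ _ => 1) = 1.
Proof.
move=> zz; rewrite /mass /swop.
have zz' : dotv (- z) (- z) = a ^+ 2 by rewrite dotvNl dotvNr opprK.
rewrite (_ : pairB _ = c ^+ 2) ?mulVf ?lt0r_neq0 ?c2_gt0//.
rewrite pairBE (_ : (fun w => mean _) = fun w : V => c * expz (- z) (0 - t *: w)).
  rewrite (bfunZ (bfun_mean k)).
    have := smean_expz a0 0 t zz'; rewrite /smean => ->.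
    by rewrite /expz -(scale0r 0) dotvZr mul0r expR0 mulr1 expr2.
  by rewrite /expz; cont.
apply/funext => w.
rewrite (_ : (fun v => _) = fun v : V => expz (- z) (- (t *: w) - t *: v)).
  by have := smean_expz a0 (- (t *: w)) t zz'; rewrite /smean => ->; rewrite sub0r.
by apply/funext => v; rewrite mul1r sub0r scalerDr opprD.
Qed.

Lemma op_C1 p b g G : cont2 p -> (forall w v, esphere w -> esphere v -> `|p w v| <= b) ->
  C1 g G -> C1 (swop p g) (fun i => swop p (G i)).
Proof. by move=> hp pb hg; exact: (fconv_C1 (bfun_op hp pb)). Qed.

End Estimates.

(** * Decay of A^N (d_j + z_j) u through a lazy random walk *)

Section Iteration.
Context {R : realType} (k : nat) (a t : R).
Hypotheses (a0 : 0 <= a) (t0 : 0 < t).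
Notation V := 'rV[R]_k.+2.
Notation c := (phiR k a t).
Implicit Types (g : V -> R) (p : V -> V -> R) (x z : V).
Notation op := (@swop R k a t).
Notation mass := (@mass R k a t).

Lemma cont2_bounded p : cont2 p ->
  exists b : R, forall w v, esphere w -> esphere v -> `|p w v| <= b.
Proof.
move=> hp; have K : compact ((@esphere R k.+2) `*` (@esphere R k.+2)).
  by apply: compact_setX; exact: esphere_compact.
have := continuous_compact (continuous_subspaceT hp) K => /compact_bounded[M [_ hM]].
exists (M + 1) => w v ww vv; apply: (hM (M + 1)); first by rewrite ltrDl.
by exists (w, v).
Qed.

Lemma op_cont p g : cont2 p -> continuous g -> continuous (op p g).
Proof.
move=> hp hg; have [b hb] := cont2_bounded hp.
exact: (fconv_cont (bfun_op a0 t0 hp hb)).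
Qed.

Lemma C1_op p g G : cont2 p -> C1 g G -> C1 (op p g) (fun i => op p (G i)).
Proof.
move=> hp hg; have [b hb] := cont2_bounded hp.
exact: (op_C1 a0 t0 hp hb hg).
Qed.

Lemma op_linf p (r : R) g g' : cont2 p -> continuous g -> continuous g' ->
  op p (fun x => r * g x + g' x) = fun x => r * op p g x + op p g' x.
Proof.
move=> hp hg hg'; have [b hb] := cont2_bounded hp.
exact: (fconv_lin (bfun_op a0 t0 hp hb)).
Qed.

Lemma op_Zf p (r : R) g x : cont2 p -> continuous g ->
  op p (fun y => r * g y) x = r * op p g x.
Proof.
move=> hp hg; have [b hb] := cont2_bounded hp.
by apply: (bfunZ (bfun_op a0 t0 hp hb) r (F := fun y => g (x - y))); cont.
Qed.

Lemma op_Df p g g' x : cont2 p -> continuous g -> continuous g' ->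
  op p (fun y => g y + g' y) x = op p g x + op p g' x.
Proof.
move=> hp hg hg'; have [b hb] := cont2_bounded hp.
by apply: (bfunD (bfun_op a0 t0 hp hb) (F := fun y => g (x - y)) (G := fun y => g' (x - y))); cont.
Qed.

Definition opA := op (fun _ _ => 1).

Lemma opA_cont g : continuous g -> continuous (opA g).
Proof. by move=> hg; apply: op_cont => //; exact: cont2_cst. Qed.

Lemma iterA_cont N g : continuous g -> continuous (iter N opA g).
Proof. by move=> hg; elim: N => //= N; exact: opA_cont. Qed.

Lemma iterA_C1 N g G : C1 g G -> C1 (iter N opA g) (fun i => iter N opA (G i)).
Proof. by move=> hg; elim: N => //= N IH; apply: C1_op => //; exact: cont2_cst. Qed.

Lemma iterA_lin N (r : R) g g' : continuous g -> continuous g' ->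
  iter N opA (fun x => r * g x + g' x) = fun x => r * iter N opA g x + iter N opA g' x.
Proof.
move=> hg hg'; elim: N => //= N ->.
by apply: op_linf; [exact: cont2_cst|exact: iterA_cont|exact: iterA_cont].
Qed.

Variables (z : V) (i j : 'I_k.+2).
Hypotheses (zz : dotv z z = a ^+ 2) (ij : i != j).

(* The kernel h represents minor^2 (d_j + z_j), see [op_h]; Kh bounds |h|, so that
   1 = pP + pM + pW splits A into positive pieces of mass 1/4, 1/4 and 1/2 with
   pP - pM = h / (2 Kh), while pE + pY = 1 splits off the elliptic part. *)
Let h (w v : V) := z 0 j * minor i j w v ^+ 2 - t^-1 * (inner i j w v * (w 0 j + v 0 j)).
Let Kh : R := 4 * a + 4 / t.
Let pE (w v : V) := 4^-1 * minor i j w v ^+ 2 + 0.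
Let pY (w v : V) := (-1) * pE w v + 1.
Let pP (w v : V) := (4 * Kh)^-1 * h w v + 4^-1.
Let pM (w v : V) := - (4 * Kh)^-1 * h w v + 4^-1.
Let pW (w v : V) : R := 2^-1.

Let Kh_gt0 : 0 < Kh.
Proof. by rewrite /Kh ltr_wpDl ?mulr_ge0 ?divr_gt0. Qed.

Let ch : cont2 h.
Proof. by rewrite /cont2 /h /minor /inner; cont. Qed.

Let cE : cont2 pE.
Proof. by rewrite /cont2 /pE /minor; cont. Qed.

Let cY : cont2 pY.
Proof. by rewrite /cont2 /pY /pE /minor; cont. Qed.

Let cP : cont2 pP.
Proof. by rewrite /cont2 /pP /h /minor /inner; cont. Qed.

Let cM : cont2 pM.
Proof. by rewrite /cont2 /pM /h /minor /inner; cont. Qed.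

Let cW : cont2 pW.
Proof. exact: cont2_cst. Qed.

Lemma coord_esphere (w : V) l : esphere w -> `|w 0 l| <= 1.
Proof. by move=> ww; have := coord_le_enorm w l; rewrite esphere_enorm. Qed.

Lemma minor_le2 (w v : V) : esphere w -> esphere v -> `|minor i j w v| <= 2.
Proof.
move=> ww vv; rewrite /minor; apply: le_trans (ler_normB _ _) _; rewrite !normrM.
rewrite (_ : 2 = 1 * 1 + 1 * 1 :> R); last by rewrite mulr1.
by rewrite lerD// ler_pM// coord_esphere.
Qed.

Lemma minor2_le4 (w v : V) : esphere w -> esphere v -> minor i j w v ^+ 2 <= 4.
Proof.
move=> ww vv; rewrite -real_normK ?num_real// (_ : 4 = 2 ^+ 2 :> R); last by rewrite -natrX.
by rewrite lerXn2r ?nnegrE//; exact: minor_le2.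
Qed.

(** |z_j| <= a and minor^2 <= 4 give 4 a; |inner| <= 2 and |w_j + v_j| <= 2 give 4 / t. *)
Let h_le w v : esphere w -> esphere v -> `|h w v| <= Kh.
Proof.
move=> ww vv; rewrite /h /Kh; apply: le_trans (ler_normB _ _) _; apply: lerD.
  rewrite normrM [leRHS]mulrC (ger0_norm (sqr_ge0 _)); apply: ler_pM => //.
  - exact: sqr_ge0.
  - apply: le_trans (coord_le_enorm _ _) _.
    by rewrite /enorm zz sqrtr_sqr ger0_norm.
  - exact: minor2_le4.
rewrite normrM gtr0_norm ?invr_gt0// mulrC ler_pM2r ?invr_gt0//.
rewrite normrM (_ : 4 = 2 * 2 :> R); last by rewrite -natrM.
apply: ler_pM => //.
  rewrite /inner; apply: le_trans (ler_normD _ _) _; rewrite !normrM.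
  rewrite (_ : 2 = 1 * 1 + 1 * 1 :> R); last by rewrite mulr1.
  by rewrite lerD// ler_pM// coord_esphere.
by apply: le_trans (ler_normD _ _) _; rewrite (_ : 2 = 1 + 1 :> R)// lerD// coord_esphere.
Qed.

Let h_div w v : esphere w -> esphere v -> `|(4 * Kh)^-1 * h w v| <= 4^-1.
Proof.
move=> ww vv; rewrite normrM gtr0_norm ?invr_gt0 ?mulr_gt0// invfM -mulrA ger_pMr ?invr_gt0//.
by rewrite mulrC ler_pdivrMr// mul1r h_le.
Qed.

Let Y_ge0 w v : esphere w -> esphere v -> 0 <= pY w v.
Proof. by move=> ww vv; have := minor2_le4 ww vv; rewrite /pY /pE; lra. Qed.

Let P_ge0 w v : esphere w -> esphere v -> 0 <= pP w v.
Proof. by move=> ww vv; have := h_div ww vv; rewrite ler_norml /pP => /andP[]; lra. Qed.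

Let M_ge0 w v : esphere w -> esphere v -> 0 <= pM w v.
Proof. by move=> ww vv; have := h_div ww vv; rewrite ler_norml /pM mulNr => /andP[]; lra. Qed.

Let W_ge0 w v : esphere w -> esphere v -> 0 <= pW w v.
Proof. by move=> _ _; rewrite /pW invr_ge0. Qed.

Definition twist (u : V -> R) (G : 'I_k.+2 -> V -> R) : V -> R :=
  fun x => z 0 j * u x + G j x.

(** [pairB_ibp] moves the derivative of u onto the kernel, so the right-hand side involves u
    alone. *)
Let op_h u G x : C1 u G -> op (fun w v => minor i j w v ^+ 2) (twist u G) x = op h u x.
Proof.
move=> hu; have [cu cG _] := hu.
have cm : cont2 (fun w v : V => minor i j w v ^+ 2) by rewrite /cont2 /minor; cont.
rewrite op_linf//.
rewrite (_ : h = fun w v => z 0 j * minor i j w v ^+ 2 + (- t^-1) * (inner i j w v * (w 0 j + v 0 j))); last first.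
  by apply/funext => w; apply/funext => v; rewrite mulNr.
have ci : cont2 (fun w v : V => inner i j w v * (w 0 j + v 0 j)) by rewrite /cont2 /inner; cont.
have ci' : cont2 (fun w v : V => - t^-1 * (inner i j w v * (w 0 j + v 0 j))) by rewrite /cont2 /inner; cont.
rewrite (op_linp _ _ _ _ cm ci' cu); congr (_ + _).
rewrite /swop; congr (_ * _).
have I := pairB_ibp x t hu ij.
apply: (mulfI (lt0r_neq0 t0)); rewrite I -pairBZ; last exact: cont2_op.
rewrite -mulN1r -pairBZ; last exact: cont2_op.
congr pairB; apply/funext => w; apply/funext => v.
by rewrite !mulrA mulrN mulfV ?lt0r_neq0.
Qed.

Let C1_expzN : C1 (expz (- z)) (fun i x => (- z) 0 i * expz (- z) x).
Proof. by case: (C2_expz (- z)). Qed.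

(** d_j + z_j annihilates exp(-z . y). Hence P and M have the same mass, and the walk has no
    drift. *)
Let mass_h : mass z h = 0.
Proof.
rewrite /mass -(op_h _ C1_expzN) (_ : twist _ _ = fun=> 0).
  have cm : cont2 (fun w v : V => minor i j w v ^+ 2) by rewrite /cont2 /minor; cont.
  rewrite /swop (_ : pairB _ = 0) ?mulr0// -[RHS](pairB_cst k 0).
  by congr pairB; apply/funext => w; apply/funext => v; rewrite mulr0.
by apply/funext => x; rewrite /twist mxE mulNr subrr.
Qed.

Let ce : continuous (expz (- z)) := @cont_expz R k (- z).

Let mass_cst (r : R) : mass z (fun _ _ => r) = r.
Proof.
have c1 : cont2 (fun _ _ : V => 1 : R) by exact: cont2_cst.
have c00 : cont2 (fun _ _ : V => 0 : R) by exact: cont2_cst.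
have := op_linp a t r 0 c1 c00 ce.
rewrite (_ : (fun w v => r * 1 + 0) = fun _ _ => r); last first.
  by apply/funext => w; apply/funext => v; rewrite mulr1 addr0.
rewrite /mass => ->; have := mass1 t a0 zz; rewrite /mass => ->.
rewrite /swop (_ : pairB _ = 0) ?mulr0 ?mulr1 ?addr0// -[RHS](pairB_cst k 0).
by congr pairB; apply/funext => w; apply/funext => v; rewrite mul0r.
Qed.

Let mass_P : mass z pP = 4^-1.
Proof.
have := op_linp a t (4 * Kh)^-1 0 ch (@cont2_cst R k 4^-1) ce.
rewrite -/(mass z pP) -/(mass z h) mass_h mulr0 add0r => ->.
exact: mass_cst.
Qed.

Let mass_M : mass z pM = 4^-1.
Proof.
have := op_linp a t (- (4 * Kh)^-1) 0 ch (@cont2_cst R k 4^-1) ce.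
rewrite -/(mass z pM) -/(mass z h) mass_h mulr0 add0r => ->.
exact: mass_cst.
Qed.

Let mass_Y : mass z pY = 1 - mass z pE.
Proof.
have := op_linp a t (-1) 0 cE (@cont2_cst R k 1) ce.
rewrite -/(mass z pY) -/(mass z pE) => ->.
by rewrite -/(mass z (fun _ _ => 1)) mass_cst mulN1r addrC.
Qed.

(** A lower bound for [mass z pE]: one factor exp(-2 a t) comes from c <= exp(a t), another from the
    exponential on the ball of radius 2 t, and 1 / (2 d^2) with d = k + 2 is a quarter of the mean
    of minor^2. It is the same for all z with |z| = a. *)
Definition ellip : R := expR (- (4 * (a * t))) * (2 * (k.+2%:R ^+ 2))^-1.

Lemma ellip_gt0 : 0 < ellip.
Proof. by rewrite mulr_gt0 ?expR_gt0// invr_gt0 mulr_gt0// exprn_gt0// ltr0n. Qed.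

Let mass_E : ellip <= mass z pE.
Proof.
rewrite /mass /swop.
have c2le : expR (- (2 * (a * t))) <= (c ^+ 2)^-1.
  rewrite expRN lef_pV2 ?posrE ?expR_gt0 ?c2_gt0//.
  have /andP[_] := phiR_bounds k a0 t; rewrite gtr0_norm// => cle.
  rewrite (_ : 2 * (a * t) = a * t + a * t); last by ring.
  by rewrite expRD expr2; apply: ler_pM => //; rewrite ltW// phiR_gt0.
have -> : ellip = expR (- (2 * (a * t))) * pairB (fun w v : V => expR (- (2 * (a * t))) / 4 * minor i j w v ^+ 2).
  rewrite pairBZ; last by rewrite /cont2 /minor; cont.
  rewrite pairB_minor_sqr// /ellip (_ : - (4 * (a * t)) = - (2 * (a * t)) + - (2 * (a * t))); last by ring.
  have : (k.+2%:R : R) != 0 by rewrite pnatr_eq0.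
  by rewrite expRD; move: (k.+2%:R : R) => n n0; field.
apply: ler_pM => //.
  rewrite -[leLHS](pairB_cst k 0); apply: pairB_le; first exact: cont2_cst.
    by rewrite /cont2 /minor; cont.
  by move=> w v _ _; rewrite mulr_ge0 ?sqr_ge0// divr_ge0 ?expR_ge0.
apply: pairB_le; [by rewrite /cont2 /minor; cont|exact: cont2_op|].
move=> w v ww vv; rewrite /pE addr0 -mulrA mulrC.
apply: ler_wpM2l; first by rewrite mulr_ge0 ?sqr_ge0// invr_ge0.
rewrite /expz ler_expR dotvNl sub0r dotvNr opprK dotvZr.
have : `|dotv z (w + v)| <= 2 * a.
  apply: le_trans (cauchy_schwarz _ _) _; rewrite /enorm zz sqrtr_sqr ger0_norm// mulrC.
  by apply: ler_wpM2r => //; have := enormD w v; rewrite (esphere_enorm ww) (esphere_enorm vv) => e2.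
rewrite ler_norml => /andP[+ _] => le.
by have := ler_wpM2l (ltW t0) le => le2; lra.
Qed.

(* Expansion of A^N = (P + M + W)^N, each word weighted by cc at the final position of
   the walk on Z for which P steps by 1, M by -1 and W by 0. *)
Fixpoint walk N (cc : int -> R) g : V -> R :=
  if N is N'.+1 then
    fun x => op pP (walk N' (fun l => cc (l + 1)) g) x +
             (op pM (walk N' (fun l => cc (l - 1)) g) x + op pW (walk N' cc g) x)
  else fun x => cc 0 * g x.

Let walkE N cc g : walk N.+1 cc g = fun x =>
  op pP (walk N (fun l => cc (l + 1)) g) x +
  (op pM (walk N (fun l => cc (l - 1)) g) x + op pW (walk N cc g) x).
Proof. by []. Qed.

Let walk_cont N cc g : continuous g -> continuous (walk N cc g).
Proof.
move=> hg; elim: N cc => [|N IH] cc /=; first by cont.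
by apply: contD; [|apply: contD]; apply: op_cont => //.
Qed.

Lemma Loc_D x rho b b' g g' : Loc z x rho b g -> Loc z x rho b' g' ->
  Loc z x rho (b + b') (fun y => g y + g' y).
Proof.
move=> H H' y yx; apply: le_trans (ler_normD _ _) _; rewrite mulrDl.
by apply: lerD; [exact: H|exact: H'].
Qed.

Lemma Loc_Z x rho b r g : Loc z x rho b g -> Loc z x rho (`|r| * b) (fun y => r * g y).
Proof. by move=> H y yx; rewrite normrM -mulrA ler_wpM2l// H. Qed.

Lemma Loc_le x rho rho' b b' g : rho' <= rho -> b <= b' -> Loc z x rho b g -> Loc z x rho' b' g.
Proof.
move=> rr bb H y yx; apply: (@le_trans _ _ (b * expz (- z) y)).
  by apply: H; apply: le_trans rr.
by rewrite ler_wpM2r// /expz expR_ge0.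
Qed.

(** A quadratic majorant is propagated, s being the current position: with weights 1/4, 1/4, 1/2 the
    mean of (s + 1)^2, (s - 1)^2, s^2 is s^2 + 1/2, so each step adds be / 2. *)
Lemma walk_Loc N cc (al be s b : R) g x rho : 0 <= al -> 0 <= be -> 0 <= b -> continuous g ->
  (forall l, `|cc l| <= al + be * (l%:~R + s) ^+ 2) ->
  Loc z x (rho + N%:R * (2 * t)) b g ->
  Loc z x rho ((al + be * (s ^+ 2 + N%:R / 2)) * b) (walk N cc g).
Proof.
move=> al0 be0 b0 hg; elim: N cc s rho => [|N IH] cc s rho hc hL /=.
  have := Loc_Z (cc 0) hL; apply: Loc_le; first by rewrite mul0r addr0.
  by rewrite mul0r addr0 ler_wpM2r//; have := hc 0; rewrite add0r.
have q0 s' : 0 <= (al + be * (s' ^+ 2 + N%:R / 2)) * b.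
  by rewrite mulr_ge0// addr_ge0// mulr_ge0// addr_ge0 ?sqr_ge0// divr_ge0.
have hL' : Loc z x (rho + 2 * t + N%:R * (2 * t)) b g.
  by apply: Loc_le hL => //; rewrite -natr1; lra.
have LP : Loc z x rho (4^-1 * ((al + be * ((s + 1) ^+ 2 + N%:R / 2)) * b))
    (op pP (walk N (fun l => cc (l + 1)) g)).
  rewrite -mass_P; apply: op_Loc => //; first exact: walk_cont.
  by apply: IH => // l; have := hc (l + 1); rewrite intrD addrAC addrA.
have LM : Loc z x rho (4^-1 * ((al + be * ((s - 1) ^+ 2 + N%:R / 2)) * b))
    (op pM (walk N (fun l => cc (l - 1)) g)).
  rewrite -mass_M; apply: op_Loc => //; first exact: walk_cont.
  by apply: IH => // l; have := hc (l - 1); rewrite intrB addrAC addrA.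
have LW : Loc z x rho (2^-1 * ((al + be * (s ^+ 2 + N%:R / 2)) * b)) (op pW (walk N cc g)).
  rewrite -[X in X * _](mass_cst 2^-1); apply: op_Loc => //; first exact: walk_cont.
  exact: IH.
have := Loc_D LP (Loc_D LM LW); apply: Loc_le => //.
by rewrite le_eqVlt -natr1; apply/orP; left; apply/eqP; field.
Qed.

Let walk_lin N (r : R) cc cc' g : continuous g ->
  walk N (fun l => r * cc l + cc' l) g = fun x => r * walk N cc g x + walk N cc' g x.
Proof.
move=> hg; elim: N cc cc' => [|N IH] cc cc' /=.
  by apply/funext => x; rewrite mulrDl mulrA.
have wc N' cc0 := @walk_cont N' cc0 g hg.
by apply/funext => x; rewrite !IH !op_linf//; ring.
Qed.

Let op_split f x : continuous f -> op pP f x + (op pM f x + op pW f x) = opA f x.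
Proof.
move=> hf; rewrite -[op pM f x]mul1r -(op_linp a t 1 x cM cW hf) -[op pP f x]mul1r.
have cMW : cont2 (fun w v => 1 * pM w v + pW w v).
  by rewrite /cont2 /pM /pW /h /minor /inner; cont.
rewrite -(op_linp a t 1 x cP cMW hf) /opA; congr (op _ _ _).
apply/funext => w; apply/funext => v; rewrite /pP /pM /pW.
by rewrite !mul1r mulNr; move: ((4 * Kh)^-1 * h w v) => X; lra.
Qed.

Let walk1 N g : continuous g -> walk N (fun=> 1) g = iter N opA g.
Proof.
move=> hg; elim: N => [|N IH] /=; first by apply/funext => x; rewrite mul1r.
by apply/funext => x; rewrite IH op_split//; exact: iterA_cont.
Qed.

(** The weight is the final position: a P step adds one copy of A^N g and an M step removes one. *)
Let walkS N g x : continuous g -> walk N.+1 intr g x =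
  opA (walk N intr g) x + (op pP (iter N opA g) x - op pM (iter N opA g) x).
Proof.
move=> hg; have wc := @walk_cont N intr g hg; have ic := iterA_cont (N := N) hg.
have sh (r : R) : walk N (fun l => l%:~R + r) g = fun x => r * iter N opA g x + walk N intr g x.
  rewrite -walk1// -walk_lin//; congr (walk _ _ _); apply/funext => l.
  by rewrite mulr1 addrC.
rewrite walkE -(op_split x wc).
rewrite (_ : (fun l : int => (l + 1)%:~R : R) = fun l : int => l%:~R + 1 :> R); last first.
  by apply/funext => l; rewrite intrD.
rewrite (_ : (fun l : int => (l - 1)%:~R : R) = fun l : int => l%:~R + (-1) :> R); last first.
  by apply/funext => l; rewrite intrB.
by rewrite !sh !op_linf//; ring.
Qed.

Let op_E u G x : C1 u G -> op pE (twist u G) x = Kh / 2 * (op pP u x - op pM u x).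
Proof.
move=> hu; have [cu cG _] := hu.
have ct : continuous (twist u G) by rewrite /twist; cont.
have cm : cont2 (fun w v : V => minor i j w v ^+ 2) by rewrite /cont2 /minor; cont.
have c00 : cont2 (fun _ _ : V => 0 : R) by exact: cont2_cst.
have c4 : cont2 (fun _ _ : V => 4^-1 : R) by exact: cont2_cst.
(* The summand 0 in [pE] gives it the shape r p + q of [op_linp]. *)
rewrite (op_linp a t 4^-1 x cm c00 ct) op_h//.
rewrite (op_linp a t _ x ch c4 cu) (op_linp a t _ x ch c4 cu).
rewrite (_ : op (fun _ _ => 0) _ x = 0); last first.
  rewrite /swop (_ : pairB _ = 0) ?mulr0// -[RHS](pairB_cst k 0).
  by congr pairB; apply/funext => w; apply/funext => v; rewrite mul0r.
have K0 := lt0r_neq0 Kh_gt0.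
move: (op h u x) (op (fun _ _ => 4^-1) u x) => A B.
by field; move: K0; rewrite /Kh.
Qed.

(* [hitE N] and [hitY N] are the sums over l < N of A^(N-1-l) E A^l and
   A^(N-1-l) Y A^l, which add up to N A^N. *)
Fixpoint hitE N f : V -> R :=
  if N is N'.+1 then fun x => opA (hitE N' f) x + op pE (iter N' opA f) x else fun=> 0.

Fixpoint hitY N f : V -> R :=
  if N is N'.+1 then fun x => opA (hitY N' f) x + op pY (iter N' opA f) x else fun=> 0.

Let hitE_cont N f : continuous f -> continuous (hitE N f).
Proof.
move=> hf; elim: N => [|N IH] /=; first by cont.
by apply: contD; [exact: opA_cont|apply: op_cont => //; exact: iterA_cont].
Qed.

Let hitY_cont N f : continuous f -> continuous (hitY N f).
Proof.
move=> hf; elim: N => [|N IH] /=; first by cont.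
by apply: contD; [exact: opA_cont|apply: op_cont => //; exact: iterA_cont].
Qed.

Let hitEY N f x : continuous f -> N%:R * iter N opA f x = hitE N f x + hitY N f x.
Proof.
move=> hf; elim: N x => [|N IH] x; first by rewrite mul0r addr0.
have ic := iterA_cont (N := N) hf; have eC := hitE_cont (N := N) hf; have yC := hitY_cont (N := N) hf.
have c1 : cont2 (fun _ _ : V => 1 : R) by exact: cont2_cst.
rewrite /= (op_linp a t (-1) x cE c1 ic) -natr1 mulrDl mul1r.
have -> : N%:R * opA (iter N opA f) x = opA (hitE N f) x + opA (hitY N f) x.
  rewrite -(op_Zf N%:R x c1 ic) -(op_Df x c1 eC yC); congr (op _ _ _).
  by apply/funext => y; rewrite IH.
by rewrite /opA; ring.
Qed.

Let iterA_twist N u G : C1 u G ->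
  iter N opA (twist u G) = twist (iter N opA u) (fun l => iter N opA (G l)).
Proof. by move=> [cu cG _]; rewrite /twist iterA_lin. Qed.

(** By [op_E] each elliptic hit is a multiple of P - M, and the sum of the A^(N-1-l) (P - M) A^l is
    the expansion of A^N weighted by the final position: both sides obey the recursion of
    [walkS]. *)
Let hitE_twist N u G x : C1 u G -> hitE N (twist u G) x = Kh / 2 * walk N intr u x.
Proof.
move=> hu; have [cu cG _] := hu; elim: N x => [|N IH] x.
  by rewrite /= mulr0z mul0r mulr0.
rewrite walkS// [LHS]/= iterA_twist// (op_E _ (iterA_C1 N hu)) [RHS]mulrDr; congr (_ + _).
have wc := @walk_cont N intr u cu; have c1 : cont2 (fun _ _ : V => 1 : R) by exact: cont2_cst.
rewrite -(op_Zf (Kh / 2) x c1 wc); congr (op _ _ _).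
by apply/funext => y; rewrite IH.
Qed.

Lemma opA_Loc x rho b f : 0 <= b -> continuous f ->
  Loc z x (rho + 2 * t) b f -> Loc z x rho b (opA f).
Proof.
move=> b0 hf hL; have c1 : cont2 (fun _ _ : V => 1 : R) by exact: cont2_cst.
have h1 (w v : V) : esphere w -> esphere v -> 0 <= 1 :> R by [].
by have := op_Loc a0 t0 b0 c1 hf h1 hL; rewrite (mass1 t a0 zz) mul1r.
Qed.

Lemma iterA_Loc N x rho b f : 0 <= b -> continuous f ->
  Loc z x (rho + N%:R * (2 * t)) b f -> Loc z x rho b (iter N opA f).
Proof.
move=> b0 hf; elim: N rho => [|N IH] rho hL.
  by apply: Loc_le hL => //; rewrite mul0r addr0.
rewrite /=; apply: opA_Loc => //; first exact: iterA_cont.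
by apply: IH; apply: Loc_le hL => //; rewrite -natr1; lra.
Qed.

Let hitY_Loc N x rho b f : 0 <= b -> continuous f -> ellip <= 1 ->
  Loc z x (rho + N%:R * (2 * t)) b f -> Loc z x rho (N%:R * ((1 - ellip) * b)) (hitY N f).
Proof.
move=> b0 hf e1; elim: N rho => [|N IH] rho hL.
  by move=> y _ /=; rewrite normr0 mul0r mul0r.
have q0 : 0 <= (1 - ellip) * b by rewrite mulr_ge0// subr_ge0.
have hL' : Loc z x (rho + 2 * t + N%:R * (2 * t)) b f.
  by apply: Loc_le hL => //; rewrite -natr1; lra.
have L1 : Loc z x rho (N%:R * ((1 - ellip) * b)) (opA (hitY N f)).
  by apply: opA_Loc; [rewrite mulr_ge0|exact: hitY_cont|exact: IH].
have L2 : Loc z x rho ((1 - ellip) * b) (op pY (iter N opA f)).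
  have := op_Loc a0 t0 b0 cY (iterA_cont (N := N) hf) Y_ge0
    (iterA_Loc b0 hf hL').
  apply: Loc_le => //; rewrite mass_Y; apply: ler_wpM2r => //.
  by rewrite lerD2l lerN2.
have := Loc_D L1 L2; apply: Loc_le => //.
by rewrite le_eqVlt -natr1; apply/orP; left; apply/eqP; ring.
Qed.

Lemma ellip_le1 : ellip <= 1.
Proof.
rewrite /ellip -[leRHS]mulr1; apply: ler_pM; rewrite ?expR_ge0//.
- by rewrite -[leRHS]expR0 ler_expR oppr_le0 !mulr_ge0// ltW.
- rewrite invf_le1; last by rewrite mulr_gt0// exprn_gt0// ltr0n.
  by rewrite -natrX -natrM ler1n.
Qed.

Definition lamK : R := Kh / 2.

Lemma lamK_ge0 : 0 <= lamK.
Proof. by rewrite divr_ge0// ltW. Qed.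

(* Over n^2 steps the walk moves by about n, so hitE contributes n / n^2 = 1/n and
   hitY contracts by the factor 1 - ellip. *)
Lemma renewal_Loc n M x rho b u G : (0 < n)%N -> 0 <= b -> C1 u G ->
  Loc z x (rho + (M * (n * n))%:R * (2 * t)) b u ->
  Loc z x (rho + (M * (n * n))%:R * (2 * t)) b (twist u G) ->
  Loc z x rho (((1 - ellip) ^+ M + lamK / (n%:R * ellip)) * b)
    (iter (M * (n * n)) opA (twist u G)).
Proof.
move=> n0 b0 hu; have [cu cG _] := hu; have e0 := ellip_gt0; have e1 := ellip_le1.
have l0 := lamK_ge0.
have ct : continuous (twist u G) by rewrite /twist; cont.
have nR : 0 < n%:R :> R by rewrite ltr0n.
have q0 M' : 0 <= (1 - ellip) ^+ M' + lamK / (n%:R * ellip).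
  by rewrite addr_ge0// ?exprn_ge0 ?subr_ge0// divr_ge0// mulr_ge0// ltW.
elim: M rho => [|M IH] rho hLu hLt.
  rewrite mul0n /=; apply: Loc_le hLt; first by rewrite mul0n mul0r addr0.
  by rewrite -[leLHS]mul1r ler_wpM2r// expr0 lerDl divr_ge0// mulr_ge0// ltW.
set N := (n * n)%N in IH hLu hLt *.
have NR : N%:R = n%:R * n%:R :> R by rewrite natrM.
have radE : rho + (M.+1 * N)%:R * (2 * t) = rho + N%:R * (2 * t) + (M * N)%:R * (2 * t).
  by rewrite mulSn natrD; ring.
rewrite radE in hLu hLt.
rewrite mulSn iterD.
have Lu := iterA_Loc b0 cu hLu.
have Lt := IH _ hLu hLt.
set f := iter (M * N) opA (twist u G) in Lt *.
have cf : continuous f by exact: iterA_cont.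
have fE : f = twist (iter (M * N) opA u) (fun l => iter (M * N) opA (G l)) by exact: iterA_twist.
have LY := hitY_Loc (mulr_ge0 (q0 M) b0) cf e1 Lt.
have LW : Loc z x rho (n%:R * b) (walk N intr (iter (M * N) opA u)).
  (* |l| <= n / 2 + l^2 / (2 n) is the majorant for [walk_Loc]; after n^2 steps it gives 3 n / 4. *)
  have al0 : 0 <= n%:R / 2 :> R by rewrite divr_ge0.
  have be0 : 0 <= (2 * n%:R)^-1 :> R by rewrite invr_ge0 mulr_ge0// ltW.
  have hc (l : int) : `|l%:~R| <= n%:R / 2 + (2 * n%:R)^-1 * (l%:~R + 0) ^+ 2 :> R.
    rewrite addr0 -[X in _ <= _ + _ * X](real_normK (num_real _)) -subr_ge0.
    rewrite (_ : _ - _ = (`|l%:~R| - n%:R) ^+ 2 / (2 * n%:R)).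
      by rewrite divr_ge0 ?sqr_ge0// mulr_ge0// ltW.
    by field; rewrite lt0r_neq0.
  have := walk_Loc al0 be0 b0 (iterA_cont cu) hc Lu; apply: Loc_le => //.
  apply: ler_wpM2r => //; rewrite expr0n/= add0r NR.
  rewrite (_ : _ + _ = n%:R * (3 / 4)); last by field; rewrite lt0r_neq0.
  by rewrite ler_piMr ?ltW//; lra.
(* N A^N f is [hitE] plus [hitY]: the first is bounded through A^(M N) u, the second through the
   induction hypothesis on f. *)
have := Loc_Z N%:R^-1 (Loc_D (Loc_Z lamK LW) LY).
rewrite (_ : (fun y => _) = iter N opA f); last first.
  apply/funext => y; have := hitEY N y cf.
  rewrite [in hitE N f y]fE hitE_twist; last exact: iterA_C1.
  move=> H; rewrite -/lamK in H; rewrite -H mulKf//.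
  by rewrite NR mulf_neq0// lt0r_neq0.
apply: Loc_le => //.
rewrite (ger0_norm l0) ger0_norm ?invr_ge0 ?ler0n// NR exprS.
rewrite le_eqVlt; apply/orP; left; apply/eqP; field.
by rewrite !lt0r_neq0.
Qed.

(** From (1 - e)^m (1 + m e) <= 1 by induction. Taking M = n blocks of n^2 steps makes both terms of
    [renewal_Loc] of order 1 / n, whence the n^3 steps. *)
Lemma bernoulli_decay n : (0 < n)%N -> (1 - ellip) ^+ n <= (n%:R * ellip)^-1.
Proof.
move=> n0; have e0 := ellip_gt0; have e1 := ellip_le1.
have nR : 0 < n%:R :> R by rewrite ltr0n.
have H m : (1 - ellip) ^+ m * (1 + m%:R * ellip) <= 1.
  elim: m => [|m IH]; first by rewrite expr0 mul0r addr0 mulr1.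
  apply: le_trans IH; rewrite exprSr -mulrA; apply: ler_wpM2l.
    by rewrite exprn_ge0// subr_ge0.
  have m0 : 0 <= m%:R :> R by rewrite ler0n.
  by rewrite -natr1; nra.
rewrite -[leRHS]mul1r ler_pdivlMr ?(mulr_gt0 nR e0)//.
apply: le_trans (H n); apply: ler_wpM2l; first by rewrite exprn_ge0// subr_ge0.
by rewrite lerDr.
Qed.

Definition decayC : R := (1 + lamK) / ellip.

Lemma twist_decay n x rho b u G : (0 < n)%N -> 0 <= b -> C1 u G ->
  Loc z x (rho + (n * (n * n))%:R * (2 * t)) b u ->
  Loc z x (rho + (n * (n * n))%:R * (2 * t)) b (twist u G) ->
  Loc z x rho (decayC / n%:R * b) (iter (n * (n * n)) opA (twist u G)).
Proof.
move=> n0 b0 hu hL1 hL2; have := renewal_Loc n0 b0 hu hL1 hL2.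
have e0 := ellip_gt0; have nR : 0 < n%:R :> R by rewrite ltr0n.
apply: Loc_le => //; apply: ler_wpM2r => //.
apply: (@le_trans _ _ ((n%:R * ellip)^-1 + lamK / (n%:R * ellip))).
  by rewrite lerD2r bernoulli_decay.
rewrite le_eqVlt; apply/orP; left; apply/eqP; rewrite /decayC; field.
by rewrite !lt0r_neq0.
Qed.

End Iteration.

(** * Decay of the powers of L A^(n^3) in local exponential bounds *)

Section Decay.
Context {R : realType} (k : nat) (a t : R).
Hypotheses (a0 : 0 <= a) (t0 : 0 < t).
Notation V := 'rV[R]_k.+2.
Notation A := (@opA R k a t).
Implicit Types (u g : V -> R) (x z : V).

Definition lapR g : V -> R := fun x => - \sum_i rpart i (rpart i g) x + a ^+ 2 * g x.

Lemma rsmooth_iter P N u : (forall v, rsmooth v -> rsmooth (P v)) -> rsmooth u ->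
  rsmooth (iter N P u : V -> R).
Proof. by move=> hP hu; elim: N => [|N IH]; [exact: hu|exact: hP IH]. Qed.

Lemma rsmooth_A N u : rsmooth u -> rsmooth (iter N A u).
Proof.
move=> hu; elim: N => [//|N IH] /=.
have b1 (w v : V) : esphere w -> esphere v -> `|1| <= 1 :> R by rewrite normr1.
exact: (rsmooth_fconv (bfun_op a0 t0 (@cont2_cst R k 1) b1) IH).
Qed.

Lemma rps_A N s u : rsmooth u -> rps s (iter N A u) = iter N A (rps s u).
Proof.
move=> hu; elim: N => [//|N IH] /=; rewrite -IH.
have b1 (w v : V) : esphere w -> esphere v -> `|1| <= 1 :> R by rewrite normr1.
exact: (rps_fconv (bfun_op a0 t0 (@cont2_cst R k 1) b1) s (rsmooth_A N hu)).
Qed.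

Lemma rpart_A N i u : rsmooth u -> rpart i (iter N A u) = iter N A (rpart i u).
Proof. by move=> hu; exact: (rps_A N [:: i] hu). Qed.

Lemma rsmooth_rpart i u : rsmooth u -> rsmooth (rpart i u).
Proof. by move=> hu; exact: (rsmooth_rps [:: i] hu). Qed.

Lemma rsmooth_cont u : rsmooth u -> continuous u.
Proof. by move=> hu; case: (hu [::]). Qed.

Lemma rpart_lin (r : R) i u g : rsmooth u -> rsmooth g ->
  rpart i (fun x => r * u x + g x) = fun x => r * rpart i u x + rpart i g x.
Proof.
move=> hu hg; have [cu cu' du] := C1_rsmooth hu; have [cg cg' dg] := C1_rsmooth hg.
apply: (@C1_unique _ _ _ (fun i x => r * rpart i u x + rpart i g x)); split.
- by cont.
- by move=> l; apply: contD; [apply: contM; [exact: cont_cst|exact: cu']|exact: cg'].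
- by move=> l x; exact: (is_deriveDp (is_deriveZp r (du l x)) (dg l x)).
Qed.

Lemma rps_lin (r : R) s u g : rsmooth u -> rsmooth g ->
  rps s (fun x => r * u x + g x) = fun x => r * rps s u x + rps s g x.
Proof.
move=> hu hg; elim: s => [//|i s IH] /=; rewrite IH.
by apply: rpart_lin; exact: rsmooth_rps.
Qed.

Lemma rsmooth_lin (r : R) u g : rsmooth u -> rsmooth g ->
  rsmooth (fun x => r * u x + g x).
Proof.
move=> hu hg s; rewrite rps_lin//.
have [cu du] := hu s; have [cg dg] := hg s; split; first by cont.
move=> i x; have hd := is_deriveDp (is_deriveZp r (derivableP (du i x))) (derivableP (dg i x)).
exact: hd.(ex_derive).
Qed.

Lemma rps0 s : rps s (fun _ : V => 0 : R) = fun=> 0.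
Proof.
elim: s => [//|i s IH] /=; rewrite IH; apply/funext => x.
by rewrite rpartE derive_cst.
Qed.

Lemma rsmooth0 : rsmooth (fun _ : V => 0 : R).
Proof.
move=> s; rewrite rps0; split; first exact: cont_cst.
by move=> i x; exact: derivable_cst.
Qed.

(** An iterated form r u + g, so that linearity statements apply by induction on the list of
    coordinates. *)
Lemma lapR_fold g : lapR g = foldr (fun i h x => -1 * rpart i (rpart i g) x + h x)
   (fun x => a ^+ 2 * g x + 0) (enum 'I_k.+2).
Proof.
rewrite /lapR; apply/funext => x; rewrite -big_enum /=.
elim: (enum _) => [|i s IH] /=; first by rewrite big_nil oppr0 add0r addr0.
by rewrite big_cons opprD -addrA IH mulN1r.
Qed.

Lemma lapR_rps_smooth s g : rsmooth g -> rsmooth (lapR g) /\ rps s (lapR g) = lapR (rps s g).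
Proof.
move=> hg; rewrite !lapR_fold; elim: (enum _) => [|i e [IH1 IH2]] /=.
  split; first exact: (rsmooth_lin _ hg rsmooth0).
  by rewrite (rps_lin _ s hg rsmooth0) rps0.
have h1 := rsmooth_rpart i hg; have h2 := rsmooth_rpart i h1.
split; first exact: (rsmooth_lin _ h2 IH1).
by rewrite (rps_lin _ s h2 IH1) IH2 (rps_rcons i s h1) (rps_rcons i s hg).
Qed.

Lemma rsmooth_lapR g : rsmooth g -> rsmooth (lapR g).
Proof. by move=> hg; case: (lapR_rps_smooth [::] hg). Qed.

Lemma rps_lapR s g : rsmooth g -> rps s (lapR g) = lapR (rps s g).
Proof. by move=> hg; case: (lapR_rps_smooth s hg). Qed.

Lemma lapR_fconv rho C Lam g : bfun (eball rho) C Lam -> rsmooth g ->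
  lapR (fconv Lam g) = fconv Lam (lapR g).
Proof.
move=> hL hg; have cg := rsmooth_cont hg.
have c2 i : continuous (rpart i (rpart i g)).
  by apply: rsmooth_cont; do 2 apply: rsmooth_rpart.
have E i : rpart i (rpart i (fconv Lam g)) = fconv Lam (rpart i (rpart i g)).
  exact: (rps_fconv hL [:: i; i] hg).
apply/funext => x; rewrite /lapR /fconv.
under eq_bigr do rewrite E.
have cgx : continuous (fun y : V => g (x - y)) by cont.
have c2x i : continuous (fun y : V => rpart i (rpart i g) (x - y)).
  by apply: (cont_comp (g := rpart i (rpart i g))); [cont|exact: c2].
rewrite (bfunD hL); [|by apply: contN; exact: cont_sum|by cont].
by rewrite (bfunN hL) ?(bfun_sum hL) ?(bfunZ hL)//; exact: cont_sum.
Qed.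

Lemma bfun_A : bfun (eball (2 * t)) ((phiR k a t ^+ 2)^-1 * 1) (@opfun R k a t (fun _ _ => 1)).
Proof.
by apply: bfun_op => // [|w v _ _]; [exact: cont2_cst|rewrite normr1].
Qed.

Lemma lapR_A N g : rsmooth g -> lapR (iter N A g) = iter N A (lapR g).
Proof.
move=> hg; elim: N => [//|N IH] /=; rewrite -IH.
exact: (lapR_fconv bfun_A (rsmooth_A N hg)).
Qed.

Variable z : V.
Hypothesis zz : dotv z z = a ^+ 2.

Definition tw j u : V -> R := twist z j u (rpart^~ u).

Lemma tw_A N j u : rsmooth u -> tw j (iter N A u) = iter N A (tw j u).
Proof.
move=> hu; have hj : rsmooth (rpart j u) by exact: rsmooth_rpart.
rewrite /tw /twist iterA_lin//; [|exact: rsmooth_cont|exact: rsmooth_cont].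
by rewrite rpart_A.
Qed.

Lemma lapR_tw u x : rsmooth u ->
  lapR u x = \sum_j (-1 * tw j (rpart j u) x + z 0 j * tw j u x).
Proof.
move=> hu; rewrite /lapR -zz /dotv mulr_suml -sumrN -big_split/=.
by apply: eq_bigr => j _; rewrite /tw /twist; ring.
Qed.

Lemma Loc_sum x rho b (F : 'I_k.+2 -> V -> R) :
  (forall j, Loc z x rho b (F j)) ->
  Loc z x rho (k.+2%:R * b) (fun y => \sum_j F j y).
Proof.
move=> h y yx; apply: le_trans (ler_norm_sum _ _ _) _.
apply: (@le_trans _ _ (\sum_(j < k.+2) b * expz (- z) y)).
  by apply: ler_sum => j _; exact: h.
by rewrite sumr_const card_ord -mulrA mulr_natl.
Qed.

Definition WordLoc K x rho b u := forall s : seq 'I_k.+2, (size s <= K)%N ->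
  Loc z x rho b (rps s u).

(** One factor 1 + a bounds d_j v + z_j v, the other comes from the outer operator z_j - d_j, and k
    + 2 counts the coordinates. *)
Definition stepC : R := k.+2%:R * (1 + a) ^+ 2 * decayC k a t.

Lemma decayC_ge0 : 0 <= decayC k a t.
Proof.
by rewrite /decayC divr_ge0 ?ltW ?ellip_gt0// ltr_wpDr// lamK_ge0.
Qed.

Lemma stepC_ge0 : 0 <= stepC.
Proof. by rewrite /stepC; apply: mulr_ge0 decayC_ge0; rewrite mulr_ge0 ?sqr_ge0. Qed.

(** Derivatives commute with A, so the outer factor z_j - d_j acts on the function before A does,
    and [twist_decay] is applied to the inner factor d_j + z_j. Each step thus consumes two
    derivatives. *)
Lemma lapR_step K n x rho b u : (0 < n)%N -> 0 <= b -> rsmooth u ->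
  WordLoc K.+2 x (rho + (n * (n * n))%:R * (2 * t)) b u ->
  WordLoc K x rho (stepC / n%:R * b) (lapR (iter (n * (n * n)) A u)).
Proof.
move=> n0 b0 hu hW s sK; set N := (n * (n * n))%N in hW *.
rewrite rps_lapR; last exact: rsmooth_A.
rewrite rps_A//; set w := rps s u.
have hw : rsmooth w by exact: rsmooth_rps.
have D0 := decayC_ge0; have nR : 0 < n%:R :> R by rewrite ltr0n.
have zj j : `|z 0 j| <= a.
  by apply: le_trans (coord_le_enorm _ _) _; rewrite /enorm zz sqrtr_sqr ger0_norm.
(* The integration by parts rotates j with a second coordinate, which exists in dimension k + 2. *)
have other (j : 'I_k.+2) : exists i, i != j.
  have [->|j0] := eqVneq j ord0; last by exists ord0; rewrite eq_sym.
  by exists ord_max.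
have dec j v : rsmooth v -> Loc z x (rho + N%:R * (2 * t)) b v ->
    Loc z x (rho + N%:R * (2 * t)) b (rpart j v) ->
    Loc z x rho (decayC k a t / n%:R * ((1 + a) * b)) (iter N A (tw j v)).
  move=> hv L1 L2; have [i ij] := other j.
  apply: (twist_decay a0 t0 zz ij n0 _ (C1_rsmooth hv)).
  - by rewrite mulr_ge0// addr_ge0.
  - by apply: Loc_le L1 => //; rewrite ler_peMl// lerDl.
  - have := Loc_D (Loc_Z (z 0 j) L1) L2; apply: Loc_le => //.
    by rewrite [leRHS]mulrDl mul1r addrC lerD2l ler_wpM2r.
rewrite (_ : lapR _ = fun y => \sum_j (-1 * iter N A (tw j (rpart j w)) y + z 0 j * iter N A (tw j w) y)); last first.
  apply/funext => y; rewrite lapR_tw; last exact: rsmooth_A.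
  apply: eq_bigr => j _; rewrite tw_A// rpart_A//.
  by rewrite (tw_A N j (rsmooth_rpart j hw)).
have LS j : Loc z x rho (decayC k a t / n%:R * ((1 + a) * b) * (1 + a))
    (fun y => -1 * iter N A (tw j (rpart j w)) y + z 0 j * iter N A (tw j w) y).
  have W0 : Loc z x (rho + N%:R * (2 * t)) b w by apply: hW; rewrite (leq_trans sK)// -addn2 leq_addr.
  have W1 : Loc z x (rho + N%:R * (2 * t)) b (rpart j w).
    by apply: (hW (j :: s)); rewrite /= ltnS (leq_trans sK)// leqnSn.
  have W2 : Loc z x (rho + N%:R * (2 * t)) b (rpart j (rpart j w)).
    by apply: (hW (j :: j :: s)); rewrite /= !ltnS.
  have h1 : rsmooth (rpart j w) by exact: rsmooth_rpart.
  have := Loc_D (Loc_Z (-1) (dec j _ h1 W1 W2)) (Loc_Z (z 0 j) (dec j _ hw W0 W1)).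
  apply: Loc_le => //; rewrite normrN1 mul1r [leRHS]mulrDr mulr1 lerD2l mulrC.
  apply: ler_wpM2l; last exact: zj.
  apply: mulr_ge0; first by rewrite divr_ge0// ltW.
  by rewrite mulr_ge0// addr_ge0.
have := Loc_sum LS; apply: Loc_le => //.
rewrite le_eqVlt; apply/orP; left; apply/eqP; rewrite /stepC expr2.
by move: (decayC k a t) (k.+2%:R : R) (n%:R : R) nR => D d nn nn0; field; rewrite lt0r_neq0.
Qed.

Definition stepH n u := lapR (iter (n * (n * n)) A u).

Lemma rsmooth_stepH n u : rsmooth u -> rsmooth (stepH n u).
Proof. by move=> hu; apply: rsmooth_lapR; exact: rsmooth_A. Qed.

Lemma iter_step_Loc q K n x rho b u : (0 < n)%N -> 0 <= b -> rsmooth u ->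
  WordLoc (K + q.*2) x (rho + q%:R * ((n * (n * n))%:R * (2 * t))) b u ->
  WordLoc K x rho ((stepC / n%:R) ^+ q * b) (iter q (stepH n) u).
Proof.
move=> n0 b0; have C0 : 0 <= stepC / n%:R.
  exact: divr_ge0 stepC_ge0 _.
elim: q K rho u => [|q IH] K rho u hu hW.
  move=> s sK; have := hW s; rewrite addn0 mul0r addr0 => /(_ sK).
  by apply: Loc_le => //; rewrite expr0 mul1r.
have hs : rsmooth (iter q (stepH n) u).
  by apply: rsmooth_iter hu => v; exact: rsmooth_stepH.
rewrite exprS -mulrA; apply: lapR_step => //.
  by rewrite mulr_ge0// exprn_ge0.
apply: IH => // s sK; have := hW s; rewrite doubleS -addSnnS -addSnnS => /(_ sK).
by apply: Loc_le => //; rewrite -natr1; lra.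
Qed.

End Decay.

(** * From local exponential bounds to the seminorms of S^a *)

Section SeminormDecay.
Context {R : realType} (k : nat) (a t : R).
Hypotheses (a0 : 0 <= a) (t0 : 0 < t).
Notation V := 'rV[R]_k.+2.
Implicit Types (u g : V -> R) (x z : V).

Definition weight m x : R := expR (a * enorm x) * (1 + enorm x) ^+ m.

Lemma RSa_rpart i u : RSa a u -> RSa a (rpart i u).
Proof.
move=> [hu bu]; split; first exact: rsmooth_rpart.
by move=> m s; have := bu m (s ++ [:: i]); rewrite rps_cat.
Qed.

Lemma RSa_uniform m K u : RSa a u -> exists2 B : R, 0 <= B &
  forall s, (size s <= K)%N -> forall x, weight m x * `|rps s u x| <= B.
Proof.
have nil u' : RSa a u' -> exists2 B : R, 0 <= B & forall x, weight m x * `|u' x| <= B.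
  move=> [_ bu]; have [B hB] := bu m [::]; exists `|B| => // x.
  by apply: le_trans (hB x) _; exact: ler_norm.
elim: K u => [|K IH] u hu.
  have [B B0 hB] := nil u hu; exists B => // s.
  by rewrite leqn0 size_eq0 => /eqP ->.
have [B0 B00 hB0] := nil u hu.
have /choice[B hB] : forall i, exists B : R, 0 <= B /\
    forall s, (size s <= K)%N -> forall x, weight m x * `|rps s (rpart i u) x| <= B.
  by move=> i; have [B ? ?] := IH _ (RSa_rpart i hu); exists B.
have SB : 0 <= \sum_i B i by apply: sumr_ge0 => i _; case: (hB i).
exists (B0 + \sum_i B i); first exact: addr_ge0.
move=> s; case: (lastP s) => [_ x|s' i]; first by apply: le_trans (hB0 x) _; rewrite lerDl.
rewrite size_rcons ltnS => sK x; rewrite -cats1 rps_cat /=.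
apply: le_trans ((hB i).2 s' sK x) _; rewrite (bigD1 i)//= addrCA lerDl.
by rewrite addr_ge0// sumr_ge0// => j _; case: (hB j).
Qed.

(** With z along x the local bound at x is a multiple of exp(-a |x|), the exact weight of S^a. At x
    = 0 any z of length a serves. *)
Lemma direction x : exists2 z : V, dotv z z = a ^+ 2 & dotv z x = a * enorm x.
Proof.
have [x0|x0] := eqVneq (enorm x) 0.
  exists (a *: e1 k.+2); first exact: dotv_ae1.
  have -> : x = 0 by apply: dotv_eq0; rewrite -enorm_sqr x0 expr0n.
  by rewrite -(scale0r 0) dotvZr mul0r enormZ normr0 mul0r mulr0.
exists ((a / enorm x) *: x).
  by rewrite dotvZl dotvZr -enorm_sqr; field.
by rewrite dotvZl -enorm_sqr; field.
Qed.

(** On the ball exp(-a |y|) <= exp(-z . y), and 1 + |x| <= (1 + rho) (1 + |y|) transfers the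
    polynomial weight from y to the centre at the cost (1 + rho)^m. *)
Lemma WordLoc_RSa m K u B z x rho : dotv z z = a ^+ 2 -> 0 <= rho -> 0 <= B ->
  (forall s, (size s <= K)%N -> forall y, weight m y * `|rps s u y| <= B) ->
  WordLoc z K x rho (B * (1 + rho) ^+ m / (1 + enorm x) ^+ m) u.
Proof.
move=> zz r0 B0 hB s sK y yx; have := hB s sK y; rewrite /weight => H.
have x0 := enorm_ge0 x; have y0 := enorm_ge0 y.
have x1 : 0 < (1 + enorm x) ^+ m by rewrite exprn_gt0// ltr_wpDr.
rewrite mulrAC ler_pdivlMr//.
have tri : 1 + enorm x <= (1 + rho) * (1 + enorm y).
  have : enorm x <= enorm y + rho.
    rewrite -[in leLHS](subrK y x) addrC; apply: le_trans (enormD _ _) _.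
    by rewrite lerD2l -enormN opprB.
  by move=> h; nra.
have tri' : (1 + enorm x) ^+ m <= (1 + rho) ^+ m * (1 + enorm y) ^+ m.
  by rewrite -exprMn lerXn2r ?nnegrE ?mulr_ge0 ?addr_ge0.
have ez : expR (- (a * enorm y)) <= expz (- z) y.
  rewrite /expz ler_expR dotvNl lerN2; apply: le_trans (ler_norm _) _.
  by apply: le_trans (cauchy_schwarz _ _) _; rewrite /enorm zz sqrtr_sqr ger0_norm.
apply: (@le_trans _ _ (`|rps s u y| * ((1 + rho) ^+ m * (1 + enorm y) ^+ m))).
  exact: ler_wpM2l.
apply: (@le_trans _ _ (B * (1 + rho) ^+ m * expR (- (a * enorm y)))); last first.
  by apply: ler_wpM2l => //; rewrite mulr_ge0// exprn_ge0// addr_ge0.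
rewrite expRN ler_pdivlMr ?expR_gt0//.
rewrite [leLHS](_ : _ = expR (a * enorm y) * (1 + enorm y) ^+ m * `|rps s u y| * (1 + rho) ^+ m); last by ring.
by apply: ler_wpM2r => //; rewrite exprn_ge0// addr_ge0.
Qed.

(* The bound propagates from balls of radius O(n^3), which costs n^(3 m) through the
   polynomial weight, and each of the 3 m + 1 steps gains 1 / n. *)
Lemma RSa_decay m S u : RSa a u -> exists D : R, forall n, (0 < n)%N ->
  forall s, (size s <= S)%N -> forall x,
    weight m x * `|rps s (iter (3 * m).+1 (stepH a t n) u) x| <= D / n%:R.
Proof.
move=> hu; set q := (3 * m).+1; have [hs _] := hu.
have [B B0 hB] := RSa_uniform m (S + q.*2) hu.
pose C := stepC k a t; have C0 : 0 <= C by exact: stepC_ge0.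
exists (C ^+ q * B * (1 + q%:R * (2 * t)) ^+ m) => n n0 s sS x.
have nR : 1 <= n%:R :> R by rewrite ler1n.
have nR0 : 0 < n%:R :> R by rewrite ltr0n.
pose r : R := q%:R * ((n * (n * n))%:R * (2 * t)).
have t2 : 0 <= 2 * t by rewrite mulr_ge0// ltW.
have r0 : 0 <= r by rewrite /r mulr_ge0// mulr_ge0.
have [z zz zx] := direction x.
have x1 : 0 < (1 + enorm x) ^+ m by rewrite exprn_gt0// ltr_wpDr// enorm_ge0.
have W := WordLoc_RSa (x := x) zz r0 B0 hB.
have b0 : 0 <= B * (1 + r) ^+ m / (1 + enorm x) ^+ m.
  by rewrite divr_ge0 ?(ltW x1)// mulr_ge0// exprn_ge0// addr_ge0.
have := @iter_step_Loc _ k a t a0 t0 z zz q S n x 0 _ u n0 b0 hs; rewrite add0r.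
move=> /(_ W s sS x); rewrite subrr enorm0 => /(_ (lexx _)) H.
have -> : (C ^+ q * B * (1 + q%:R * (2 * t)) ^+ m) / n%:R =
    (C / n%:R) ^+ q * (B * ((1 + q%:R * (2 * t)) * n%:R ^+ 3) ^+ m).
  rewrite [(C / n%:R) ^+ q]exprMn exprVn [(_ * n%:R ^+ 3) ^+ m]exprMn -exprM /q [n%:R ^+ _.+1]exprS.
  have : (n%:R ^+ (3 * m) : R) != 0 by rewrite expf_neq0// lt0r_neq0.
  move: (n%:R ^+ (3 * m) : R) (C ^+ _) (_ ^+ m : R) => N X Y N0; field.
  by rewrite N0 lt0r_neq0.
rewrite /weight; set P := rps s _ x in H *.
(* The bound is evaluated at the centre x, along which z points, so the exponential weight cancels
   exactly. *)
have E : expR (a * enorm x) * expz (- z) x = 1.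
  by rewrite /expz -expRD dotvNl zx subrr expR0.
apply: (@le_trans _ _ (expR (a * enorm x) * (1 + enorm x) ^+ m *
   ((C / n%:R) ^+ q * (B * (1 + r) ^+ m / (1 + enorm x) ^+ m) * expz (- z) x))).
  by apply: ler_wpM2l => //; rewrite mulr_ge0 ?expR_ge0 ?ltW.
rewrite [leLHS](_ : _ = (expR (a * enorm x) * expz (- z) x) * ((C / n%:R) ^+ q * (B * (1 + r) ^+ m))); last first.
  by field; rewrite lt0r_neq0.
rewrite E mul1r; apply: ler_wpM2l; first by rewrite exprn_ge0// divr_ge0// ltW.
have r1 : 0 <= 1 + r by rewrite addr_ge0.
have r2 : 0 <= (1 + q%:R * (2 * t)) * n%:R ^+ 3.
  by apply: mulr_ge0; [rewrite addr_ge0// mulr_ge0|rewrite exprn_ge0].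
apply: ler_wpM2l => //; rewrite lerXn2r ?nnegrE//.
rewrite [leRHS]mulrDl mul1r; apply: lerD; first by rewrite exprn_ege1.
by rewrite /r !natrM le_eqVlt; apply/orP; left; apply/eqP; ring.
Qed.

End SeminormDecay.

Local Open Scope complex_scope.

(** * Complex test functions through real and imaginary parts *)

Section ComplexLift.
Context {R : realType} {d : nat} (a : R).
Implicit Types (f : 'rV[R]_d -> R[i]) (u g : 'rV[R]_d -> R).

Definition clift (P : ('rV[R]_d -> R) -> 'rV[R]_d -> R) f : 'rV[R]_d -> R[i] :=
  fun x => P (ReF f) x +i* P (ImF f) x.

Lemma ReF_clift P f : ReF (clift P f) = P (ReF f). Proof. by []. Qed.

Lemma ImF_clift P f : ImF (clift P f) = P (ImF f). Proof. by []. Qed.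

Lemma ReF_partials s f : ReF (partials s f) = rps s (ReF f).
Proof.
elim: s => [//|i s IH]; apply/funext => x.
by rewrite -[RHS]/(rpart i (rps s (ReF f)) x) rpartE -IH.
Qed.

Lemma ImF_partials s f : ImF (partials s f) = rps s (ImF f).
Proof.
elim: s => [//|i s IH]; apply/funext => x.
by rewrite -[RHS]/(rpart i (rps s (ImF f)) x) rpartE -IH.
Qed.

Lemma smooth_rsmooth f : smooth f <-> rsmooth (ReF f) /\ rsmooth (ImF f).
Proof.
split=> [hf|[hr hi] s].
  by split=> s; have [] := hf s; rewrite ReF_partials ImF_partials => h1 h2 h3; split=> // i x;
    case: (h3 i x).
by rewrite ReF_partials ImF_partials; have [? ?] := hr s; have [? ?] := hi s; split.
Qed.

Lemma cmod_le (w : R[i]) : cmod w <= `|complex.Re w| + `|complex.Im w|.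
Proof.
rewrite /cmod -[leRHS](ger0_norm (addr_ge0 (normr_ge0 _) (normr_ge0 _))) -sqrtr_sqr.
rewrite ler_wsqrtr// sqrrD !real_normK ?num_real// lerD2r lerDl.
by rewrite mulrn_wge0// mulr_ge0.
Qed.

Lemma Re_le_cmod (w : R[i]) : `|complex.Re w| <= cmod w.
Proof. by rewrite /cmod -sqrtr_sqr ler_wsqrtr// lerDl sqr_ge0. Qed.

Lemma Im_le_cmod (w : R[i]) : `|complex.Im w| <= cmod w.
Proof. by rewrite /cmod -sqrtr_sqr ler_wsqrtr// lerDr sqr_ge0. Qed.

Definition word (alpha : {ffun 'I_d -> nat}) : seq 'I_d :=
  flatten [seq nseq (alpha i) i | i <- enum 'I_d].

Lemma perm_word (s : seq 'I_d) : perm_eq s (word [ffun i => count_mem i s]).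
Proof.
apply/allP => j _ /=; apply/eqP; rewrite count_flatten -map_comp sumnE big_map big_enum /=.
rewrite (bigD1 j)//= count_nseq /= eqxx mul1n ffunE big1 ?addn0// => i ij.
by rewrite count_nseq /= (negbTE ij).
Qed.

Lemma gamma_le m alpha f (B : R) :
  (forall x, expR (a * enorm x) * (1 + enorm x) ^+ m * cmod (Dmulti alpha f x) <= B) ->
  (gamma a m alpha f <= B%:E)%E.
Proof. by move=> H; apply: ge_ereal_sup => _ [x _ <-]; rewrite lee_fin. Qed.

Lemma gamma_ge m alpha f (B : R) x : (gamma a m alpha f < B%:E)%E ->
  expR (a * enorm x) * (1 + enorm x) ^+ m * cmod (Dmulti alpha f x) <= B.
Proof.
move=> H; rewrite -lee_fin; apply/ltW; apply: le_lt_trans H.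
by apply: ereal_sup_ubound; exists x.
Qed.

(** Every word of derivatives is a permutation of the word of its multi-index, so by symmetry of
    mixed derivatives the seminorms [gamma] control all words. *)
Lemma Sa_RSa f : Sa a f <-> RSa a (ReF f) /\ RSa a (ImF f).
Proof.
split=> [[hs hg]|[[hr br] [hi bi]]]; last first.
  split; first exact/smooth_rsmooth.
  move=> m alpha; have [B hB] := br m (word alpha); have [B' hB'] := bi m (word alpha).
  apply: (@le_lt_trans _ _ (B + B')%:E); last exact: ltry.
  apply: gamma_le => x; apply: (@le_trans _ _ (expR (a * enorm x) * (1 + enorm x) ^+ m *
    (`|ReF (Dmulti alpha f) x| + `|ImF (Dmulti alpha f) x|))).
    apply: ler_wpM2l; last exact: cmod_le.
    by rewrite mulr_ge0 ?expR_ge0// exprn_ge0// addr_ge0// enorm_ge0.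
  by rewrite ReF_partials ImF_partials mulrDr; apply: lerD; [exact: hB|exact: hB'].
have [hr hi] := (smooth_rsmooth f).1 hs.
have bound m s : exists B : R, forall x, expR (a * enorm x) * (1 + enorm x) ^+ m *
    cmod (Dmulti [ffun i => count_mem i s] f x) <= B.
  (* [gamma_ge] asks for a strict inequality, hence the added 1. *)
  exists (fine (gamma a m [ffun i => count_mem i s] f) + 1) => x; apply: gamma_ge.
  have := hg m [ffun i => count_mem i s]; case: (gamma _ _ _ _) => [r|//|] _.
    by rewrite /= lte_fin ltrDl.
  exact: ltNyr.
have w0 m (x : 'rV[R]_d) : 0 <= expR (a * enorm x) * (1 + enorm x) ^+ m.
  by rewrite mulr_ge0 ?expR_ge0// exprn_ge0// addr_ge0// enorm_ge0.
split; split=> // m s; have [B hB] := bound m s; exists B => x; apply: le_trans (hB x);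
  apply: ler_wpM2l => //.
  rewrite (rps_perm hr (perm_word s)) -ReF_partials; exact: Re_le_cmod.
rewrite (rps_perm hi (perm_word s)) -ImF_partials; exact: Im_le_cmod.
Qed.

Lemma Sa_clift P f : (forall u, RSa a u -> RSa a (P u)) -> Sa a f -> Sa a (clift P f).
Proof. by move=> hP /Sa_RSa[h1 h2]; apply/Sa_RSa; split; exact: hP. Qed.

End ComplexLift.

(** * The action of T: vanishing on a power of L, then descent to L *)

Section Eigendistribution.
Context {R : realType} (k : nat) (a t : R).
Hypotheses (a0 : 0 <= a) (t0 : 0 < t).
Notation V := 'rV[R]_k.+2.
Notation c := (phiR k a t).
Implicit Types (f : V -> R[i]) (u g : V -> R) (x : V).

Definition sphereF (F : V -> R) : R := sphere_meanR (fun w => F (t *: w)).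

Lemma bfun_sphereF : bfun (eball t) 1 sphereF.
Proof.
have hm := bfun_mean (R := R) k; split=> [r F G hF hG|F b hF Fb].
  by rewrite /sphereF hm.1//; cont.
apply: hm.2; first by cont.
move=> w ww; apply: Fb.
by rewrite /eball/= enormZ esphere_enorm// mulr1 gtr0_norm.
Qed.

Lemma spherical_averageE f : spherical_average t f = clift (fconv sphereF) f.
Proof. by []. Qed.

Lemma opA_sphere u : continuous u ->
  opA a t u = fun x => (c ^+ 2)^-1 * fconv sphereF (fconv sphereF u) x.
Proof.
move=> hu; apply/funext => x; rewrite /opA /swop pairBE; congr (_ * _).
rewrite /fconv /sphereF; congr sphere_meanR; apply/funext => w; congr sphere_meanR.
by apply/funext => v; rewrite mul1r scalerDr opprD addrA.
Qed.

Definition remainderF (F : V -> R) : R :=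
  Kop k a (Kop k a (fun s => sphere_meanR (fun w => F (s *: w)))) t.

(** [Kop_bound] is used twice, whence the square. Being carried by the ball of radius t, the
    remainder W of the expansion is a convolution that preserves S^a and commutes with L. *)
Lemma bfun_remainderF : exists2 C : R, 0 <= C & bfun (eball t) C remainderF.
Proof.
pose C := expR (a * t) * (t * (t * expR (a * t) * expR (2 * (a * t)))).
have C0 : 0 <= C by rewrite /C !mulr_ge0 ?expR_ge0 ?ltW.
have hm := bfun_mean (R := R) k.
have cS (F : V -> R) : continuous F ->
    continuous (fun s : R => sphere_meanR (fun w : V => F (s *: w))).
  move=> hF; apply: (bfun_cont hm (G := fun (s : R) (w : V) => F (s *: w))).
    exact: esphere_compact.
  by cont.
exists (C * C); first exact: mulr_ge0.
split=> [r F G hF hG|F b hF Fb].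
  rewrite /remainderF -(Kop_lin k a0 r t (cont_Kop a0 (cS F hF)) (cont_Kop a0 (cS G hG))).
  congr (Kop k a _ t); apply/funext => s.
  rewrite -(Kop_lin k a0 r s (cS F hF) (cS G hG)); congr (Kop k a _ s).
  by apply/funext => s'; rewrite hm.1//; cont.
rewrite /remainderF -mulrA; apply: (@Kop_bound R k a a0 _ t _ _).
- exact: (cont_Kop a0 (cS F hF)).
- by rewrite ltW//= lexx.
move=> r rt; apply: (@Kop_bound R k a a0 _ t _ _) => //; first exact: cS.
move=> s /andP[s0 st]; rewrite -[leRHS]mul1r; apply: hm.2; first by cont.
move=> w ww; apply: Fb.
by rewrite /eball/= enormZ esphere_enorm// mulr1 ger0_norm.
Qed.

Lemma C2_rsmooth u : rsmooth u -> C2 u (rpart^~ u) (fun i j => rpart j (rpart i u)).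
Proof.
by move=> hu; split; [exact: C1_rsmooth|move=> i; apply: C1_rsmooth; exact: rsmooth_rpart].
Qed.

Lemma sphereF_expansion u x : rsmooth u ->
  fconv sphereF u x = c * u x - Kop k a (phiR k a) t * lapR a u x
    + fconv remainderF (lapR a (lapR a u)) x.
Proof.
move=> hu; have hl := rsmooth_lapR a hu.
exact: (smean_expansion2 a0 x t (C2_rsmooth hu) (C2_rsmooth hl)).
Qed.

Lemma RSa_lin r u g : RSa a u -> RSa a g -> RSa a (fun x => r * u x + g x).
Proof.
move=> [hu bu] [hg bg]; split; first exact: rsmooth_lin.
move=> m s; have [B hB] := bu m s; have [B' hB'] := bg m s.
exists (`|r| * B + B') => x; rewrite rps_lin//.
have w0 : 0 <= expR (a * enorm x) * (1 + enorm x) ^+ m.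
  by rewrite mulr_ge0 ?expR_ge0// exprn_ge0// addr_ge0// enorm_ge0.
apply: (@le_trans _ _ (expR (a * enorm x) * (1 + enorm x) ^+ m *
  (`|r| * `|rps s u x| + `|rps s g x|))).
  by apply: ler_wpM2l => //; rewrite -normrM; exact: ler_normD.
by rewrite mulrDr mulrCA; apply: lerD => //; apply: ler_wpM2l.
Qed.

Lemma RSa0 : RSa a (fun _ : V => 0).
Proof.
split; first exact: rsmooth0.
by move=> m s; exists 0 => x; rewrite rps0 normr0 mulr0.
Qed.

Lemma RSa_lapR u : RSa a u -> RSa a (lapR a u).
Proof.
move=> hu; rewrite lapR_fold; elim: (enum _) => [|i e IH] /=.
  by apply: RSa_lin => //; exact: RSa0.
by apply: RSa_lin => //; do 2 apply: RSa_rpart.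
Qed.

Lemma RSa_A N u : RSa a u -> RSa a (iter N (opA a t) u).
Proof.
move=> hu; elim: N => [//|N IH] /=.
apply: (RSa_fconv (bfun_A k a0 t0) a0 _ IH).
by rewrite mulr1 invr_ge0 sqr_ge0.
Qed.

Lemma RSa_iter_lapR q u : RSa a u -> RSa a (iter q (lapR a) u).
Proof. by move=> hu; elim: q => //= q; exact: RSa_lapR. Qed.

Lemma RSa_stepH n u : RSa a u -> RSa a (stepH a t n u).
Proof. by move=> hu; apply: RSa_lapR; exact: RSa_A. Qed.

Variable T : (V -> R[i]) -> R[i].
Hypothesis hT : Sa_dual a T.
Hypothesis hM : forall f, Sa a f -> T (clift (fconv sphereF) f) = c%:C * T f.

Lemma Sa0 : Sa a (fun _ : V => 0).
Proof. by apply/Sa_RSa => //; split; exact: RSa0. Qed.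

Lemma T_0 : T (fun=> 0) = 0.
Proof.
have := hT.1 1 _ _ Sa0 Sa0; rewrite (_ : (fun _ : V => 1 * 0 + 0 : R[i]) = fun=> 0).
  by rewrite mul1r => /eqP; rewrite -subr_eq0 opprD addrA subrr sub0r oppr_eq0 => /eqP.
by apply/funext => x; rewrite mulr0 addr0.
Qed.

Lemma T_Z r f : Sa a f -> T (fun x => r * f x) = r * T f.
Proof.
move=> hf; have := hT.1 r _ _ hf Sa0; rewrite T_0 addr0 => <-.
by congr T; apply/funext => x; rewrite addr0.
Qed.

Lemma complex_lin (r x y x' y' : R) :
  (r * x + x') +i* (r * y + y') = r%:C * (x +i* y) + (x' +i* y').
Proof. by apply/eqP; rewrite eq_complex /= !mul0r subr0 addr0 !eqxx. Qed.

Lemma complexZ (r x y : R) : (r * x) +i* (r * y) = r%:C * (x +i* y).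
Proof. by apply/eqP; rewrite eq_complex /= !mul0r subr0 addr0 !eqxx. Qed.

Lemma T_clift_lin (r : R) P Q f : Sa a (clift P f) -> Sa a (clift Q f) ->
  T (clift (fun u x => r * P u x + Q u x) f) = r%:C * T (clift P f) + T (clift Q f).
Proof.
move=> hP hQ; rewrite -hT.1//; congr T; apply/funext => x.
exact: complex_lin.
Qed.

Lemma T_A N f : Sa a f -> T (clift (iter N (opA a t)) f) = T f.
Proof.
move=> hf; elim: N => [|N IH].
  by congr T; apply/funext => x; rewrite /clift /= /ReF /ImF; case: (f x).
set h := clift (iter N (opA a t)) f in IH *.
have hh : Sa a h by apply: Sa_clift hf => // u; exact: RSa_A.
have RM u : RSa a u -> RSa a (fconv sphereF u) by move=> hu; apply: (RSa_fconv bfun_sphereF).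
have h1 : Sa a (clift (fconv sphereF) h) by apply: Sa_clift hh.
rewrite (_ : clift _ f = fun x => ((c ^+ 2)^-1)%:C * clift (fconv sphereF) (clift (fconv sphereF) h) x).
  rewrite T_Z; last by apply: Sa_clift h1.
  rewrite hM// hM// -IH mulrA mulrA -!rmorphM /= -mulrA -expr2 mulVf ?mul1r//.
  by rewrite lt0r_neq0// c2_gt0.
have [[hr _] [hi _]] : RSa a (ReF h) /\ RSa a (ImF h) by apply/Sa_RSa.
apply/funext => x; rewrite /clift /=.
have -> := congr1 (fun F => F x) (opA_sphere (rsmooth_cont hr)).
have -> := congr1 (fun F => F x) (opA_sphere (rsmooth_cont hi)).
exact: complexZ.
Qed.

Lemma clift_id f : clift id f = f.
Proof. by apply/funext => x; rewrite /clift /ReF /ImF; case: (f x). Qed.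

Lemma clift_eq P Q f : (forall u, rsmooth u -> P u = Q u) -> Sa a f ->
  clift P f = clift Q f.
Proof.
move=> h /(Sa_RSa a _)[[hr _] [hi _]].
by rewrite /clift (h _ hr) (h _ hi).
Qed.

(** L commutes with A, so each A^(n^3) can be moved to the outside, where [T_A] removes it. *)
Lemma T_stepH q n f : Sa a f ->
  T (clift (iter q (stepH a t n)) f) = T (clift (iter q (lapR a)) f).
Proof.
elim: q f => [//|q IH] f hf.
rewrite (_ : clift _ f = clift (iter q (stepH a t n)) (clift (stepH a t n) f)); last first.
  by apply/funext => x; rewrite /clift !iterSr.
rewrite IH; last by apply: Sa_clift hf => // u; exact: RSa_stepH.
have hl : Sa a (clift (iter q.+1 (lapR a)) f).
  by apply: Sa_clift hf => // u; exact: RSa_iter_lapR.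
rewrite -(T_A (n * (n * n)) hl); congr T.
apply: (clift_eq (P := fun u => iter q (lapR a) (stepH a t n u))
  (Q := fun u => iter (n * (n * n)) (opA a t) (iter q.+1 (lapR a) u))) => // u hu.
rewrite /stepH -iterSr; elim: (q.+1) => [//|p IHp] /=.
have hp : rsmooth (iter p (lapR a) u) by apply: rsmooth_iter hu => v; exact: rsmooth_lapR.
by rewrite IHp (lapR_A a0 t0 _ hp).
Qed.

Lemma cmodZ (r : R) (w : R[i]) : cmod (r%:C * w) = `|r| * cmod w.
Proof.
case: w => x y; rewrite /cmod /= !mul0r subr0 addr0 !exprMn -mulrDr.
by rewrite sqrtrM ?sqr_ge0// sqrtr_sqr.
Qed.

Lemma cmod_eq0 (w : R[i]) : cmod w = 0 -> w = 0.
Proof.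
move=> h; have hr := Re_le_cmod w; have hi := Im_le_cmod w.
move: hr hi; rewrite h !normr_le0; case: w {h} => x y /= /eqP -> /eqP ->.
by [].
Qed.

Lemma RSa_Z r u : RSa a u -> RSa a (fun x => r * u x).
Proof.
move=> hu; have := RSa_lin r hu RSa0.
by rewrite (_ : (fun x => r * u x + 0) = fun x => r * u x)//; apply/funext => x; rewrite addr0.
Qed.

Lemma rps_Z (r : R) s u : rsmooth u -> rps s (fun x => r * u x) = fun x => r * rps s u x.
Proof.
move=> hu; have := rps_lin r s hu (@rsmooth0 R k); rewrite rps0.
rewrite (_ : (fun x => r * u x + 0) = fun x => r * u x); last by apply/funext => x; rewrite addr0.
by move=> ->; apply/funext => x; rewrite addr0.
Qed.

Lemma weight_le m m' x : (m <= m')%N -> weight a m x <= weight a m' x.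
Proof.
move=> mm; rewrite /weight ler_wpM2l ?expR_ge0// ler_weXn2l// lerDl.
exact: enorm_ge0.
Qed.

(** Continuity of T at 0 provides finitely many seminorms; m and S are their largest polynomial
    weight and largest number of derivatives, and [RSa_decay] makes all of them small at once. *)
Lemma T_lapR_pow : exists q : nat, forall f, Sa a f -> T (clift (iter q.+1 (lapR a)) f) = 0.
Proof.
have [s [delta [d0 hs]]] := hT.2 _ Sa0 1 ltr01.
pose m := (\max_(p <- s) p.1)%N; pose S := (\max_(p <- s) size (word p.2))%N.
(* The statement has exponent [q.+1], which is 3 m + 1 here. *)
exists (3 * m)%N => f hf; apply/cmod_eq0; apply/eqP; apply/negPn/negP => c0.
set q := (3 * m).+1 in c0 *; set w := T _ in c0 *.
have cw : 0 <= cmod w by exact: sqrtr_ge0.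
(* After scaling by 1 / |w|, T has modulus 1 on the iterated function for every n, while for large n
   that function lies in the neighbourhood of 0 where |T| < 1. *)
pose r : R := (cmod w)^-1; have r0 : 0 <= r by rewrite /r invr_ge0.
have [hr hi] := (Sa_RSa a f).1 hf.
have [D hD] := RSa_decay a0 t0 m S hr; have [D' hD'] := RSa_decay a0 t0 m S hi.
pose B : R := r * (`|D| + `|D'|).
have B0 : 0 <= B by rewrite mulr_ge0// addr_ge0.
have Bd : 0 <= B / delta by rewrite divr_ge0// ltW.
pose n := (Num.bound (B / delta)).+1.
have nB : B / n%:R < delta.
  rewrite ltr_pdivrMr ?ltr0n// mulrC -ltr_pdivrMr//.
  by apply: lt_trans (archi_boundP Bd) _; rewrite ltr_nat.
pose P u : V -> R := iter q (stepH a t n) u.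
have hP u : RSa a u -> RSa a (P u).
  by move=> hu; rewrite /P; elim: (q) => //= p; exact: RSa_stepH.
have hg : Sa a (clift (fun u x => r * P u x) f).
  by apply: Sa_clift hf => // u /hP; exact: RSa_Z.
have := hs _ hg; rewrite /= T_0 subr0.
have -> : T (clift (fun u x => r * P u x) f) = r%:C * w.
  rewrite /w -(T_stepH q n hf) -T_Z; last exact: Sa_clift hf.
  by congr T; apply/funext => x; exact: complexZ.
rewrite cmodZ ger0_norm// /r mulVf// ltxx => hs1.
suff: false by []; apply: hs1 => -[p alpha] ps /=.
apply: (@le_lt_trans _ _ (B / n%:R)%:E); last by rewrite lte_fin.
rewrite (_ : (fun x => _ - 0) = clift (fun u x => r * P u x) f); last first.
  by apply/funext => x; rewrite subr0.
apply: gamma_le => x; rewrite -/(weight a p x).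
have pm : (p <= m)%N by exact: (leq_bigmax_seq (p, alpha) ps).
have aS : (size (word alpha) <= S)%N by exact: (leq_bigmax_seq (p, alpha) ps).
have w0 i : 0 <= weight a i x.
  by rewrite mulr_ge0 ?expR_ge0// exprn_ge0// addr_ge0// enorm_ge0.
apply: (@le_trans _ _ (weight a m x * (r * (`|rps (word alpha) (P (ReF f)) x| +
   `|rps (word alpha) (P (ImF f)) x|)))).
  apply: ler_pM => //; [exact: sqrtr_ge0|exact: weight_le|].
  apply: le_trans (cmod_le _) _.
  rewrite -[complex.Re _]/(ReF (partials (word alpha) _) x) ReF_partials.
  rewrite -[complex.Im _]/(ImF (partials (word alpha) _) x) ImF_partials.
  rewrite ReF_clift ImF_clift !rps_Z; [|by case: (hP _ hi)|by case: (hP _ hr)].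
  by rewrite !normrM ger0_norm// -mulrDr.
rewrite mulrCA /B -mulrA; apply: ler_wpM2l => //.
rewrite mulrDr mulrDl; apply: lerD.
  apply: le_trans (hD n _ _ aS x) _ => //.
  by rewrite ler_pM2r ?invr_gt0 ?ltr0n// ler_norm.
apply: le_trans (hD' n _ _ aS x) _ => //.
by rewrite ler_pM2r ?invr_gt0 ?ltr0n// ler_norm.
Qed.

Lemma iter_lapR_fconv rho C Lam q u : bfun (eball rho) C Lam -> rsmooth u ->
  iter q (lapR a) (fconv Lam u) = fconv Lam (iter q (lapR a) u).
Proof.
move=> hL hu; elim: q => //= q ->; apply: (lapR_fconv a hL).
by apply: rsmooth_iter hu => v; exact: rsmooth_lapR.
Qed.

Lemma clift_comp P Q f : clift P (clift Q f) = clift (fun u => P (Q u)) f.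
Proof. by []. Qed.

Lemma T_lapR_descent q :
  (forall f, Sa a f -> T (clift (iter q.+2 (lapR a)) f) = 0) ->
  forall f, Sa a f -> T (clift (iter q.+1 (lapR a)) f) = 0.
Proof.
move=> H f hf; have [C C0 hR] := bfun_remainderF.
set g := clift (iter q (lapR a)) f.
have hg : Sa a g by apply: Sa_clift hf => u; exact: RSa_iter_lapR.
have RR u : RSa a u -> RSa a (fconv remainderF u) by move=> hu; apply: (RSa_fconv hR).
have S1 : Sa a (clift (lapR a) g) by apply: Sa_clift hg => u; exact: RSa_lapR.
pose W u := fconv remainderF (lapR a (lapR a u)).
have S2 : Sa a (clift W g) by apply: Sa_clift hg => u hu; apply: RR; do 2 apply: RSa_lapR.
pose K := Kop k a (phiR k a) t.
pose Q u := fun x => - K * lapR a u x + W u x.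
have S3 : Sa a (clift Q g).
  by apply: Sa_clift hg => u hu; apply: RSa_lin; [exact: RSa_lapR|apply: RR; do 2 apply: RSa_lapR].
have := hM hg; rewrite (@clift_eq _ (fun u x => c * id u x + Q u x))//; last first.
  by move=> u hu; apply/funext => x; rewrite sphereF_expansion// /Q /= mulNr addrA.
rewrite T_clift_lin// (_ : clift (fun u => [eta u]) g = g); last exact: clift_id.
rewrite T_clift_lin//.
(* The remainder convolution commutes with L, so W g is L^(q+2) of the convolution of f, a function
   of S^a to which [H] applies. *)
have EW : clift W g = clift (iter q.+2 (lapR a)) (clift (fconv remainderF) f).
  apply: (etrans (clift_comp W (iter q (lapR a)) f)).
  apply: etrans (esym (clift_comp (iter q.+2 (lapR a)) (fconv remainderF) f)).
  apply: (clift_eq (P := fun u => W (iter q (lapR a) u))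
    (Q := fun u => iter q.+2 (lapR a) (fconv remainderF u)) _ hf) => u hu.
  exact: (esym (iter_lapR_fconv q.+2 hR hu)).
rewrite EW H; last exact: Sa_clift hf.
(* The terms c T g cancel on both sides, leaving -psi T (L^(q+1) f) = 0. *)
rewrite addr0 => /eqP; rewrite -subr_eq0 addrAC subrr add0r mulf_eq0 => /orP[|/eqP //].
have K0 : 0 < K by exact: Kop_phi_gt0.
by rewrite eq_complex /= oppr_eq0 (negbTE (lt0r_neq0 K0)).
Qed.

Lemma T_lapR_eq0 f : Sa a f -> T (clift (lapR a) f) = 0.
Proof.
have [q] := T_lapR_pow; elim: q f => [|q IH] f; first exact.
by move=> H; apply: IH; exact: T_lapR_descent.
Qed.

Lemma laplacianE f : laplacian f = fun x => (- (a ^+ 2)%:C) * f x + clift (lapR a) f x.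
Proof.
apply/funext => x; rewrite /laplacian /clift /lapR.
have -> : \sum_i partial i (partial i f) x =
    (\sum_i rpart i (rpart i (ReF f)) x) +i* (\sum_i rpart i (rpart i (ImF f)) x).
  apply/eqP; rewrite eq_complex /= !raddf_sum /=; apply/andP; split; apply/eqP;
    apply: eq_bigr => i _; rewrite !rpartE; congr ('D__ _ _); apply/funext => y;
    by rewrite rpartE.
rewrite /ReF /ImF; case: (f x) => p q.
apply/eqP; rewrite eq_complex /=; apply/andP; split; apply/eqP; ring.
Qed.

Lemma eigendistribution f : Sa a f -> T (laplacian f) = - (a ^+ 2)%:C * T f.
Proof.
move=> hf; rewrite laplacianE hT.1//; first by rewrite T_lapR_eq0// addr0.
by apply: Sa_clift hf => u; exact: RSa_lapR.
Qed.

End Eigendistribution.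

(** Since i (i a) = -a, the integrand is the real exponential exp(-a t w_1), with zero imaginary
    part. *)
Lemma phi_phiR {R : realType} k (a t : R) :
  phi (0 +i* a) (t *: e1 k.+2) = (phiR k a t)%:C.
Proof.
have E w : cexp ((0 +i* 1) * (0 +i* a) * (dotv (t *: e1 k.+2) w)%:C) =
    (expz (a *: e1 k.+2) (0 - t *: w))%:C.
  rewrite /cexp /expz sub0r dotvNr dotvZl !dotvZr dotvZl; move: (dotv _ _) => y.
  apply/eqP; rewrite eq_complex /=.
  have -> : (0 * 0 - 1 * a) * (t * y) - (0 * a + 1 * 0) * 0 = - (t * (a * y)) by ring.
  have -> : (0 * 0 - 1 * a) * 0 + (0 * a + 1 * 0) * (t * y) = 0 by ring.
  by rewrite cos0 sin0 !mulr0 mulr1 mul0r subr0 addr0 !eqxx.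
rewrite /phi /sphere_mean phiRE /smean; congr (_ +i* _).
  by congr sphere_meanR; apply/funext => w; rewrite E.
rewrite -[RHS](mean_cst k 0); by congr sphere_meanR; apply/funext => w; rewrite E.
Qed.

Theorem theorem2p15 (R : realType) (d : nat) (hd : (2 <= d)%N)
    (t a : R) (ht : 0 < t) (ha : 0 <= a)
    (T : ('rV[R]_d -> R[i]) -> R[i]) (hT : Sa_dual a T)
    (hM : dual_eq a (dual_average t T)
            (dual_scale (phi (0 +i* a) (t *: e1 d)) T)) :
  dual_eq a (dual_laplacian T) (dual_scale (- (a ^+ 2)%:C) T).
Proof.
case: d hd T hT hM => [|[|k]] // _ T hT hM f hf.
apply: (eigendistribution ha ht hT _ hf) => g hg.
by rewrite -phi_phiR -spherical_averageE; exact: hM.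
Qed.
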